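(* Let $(M,\omega)$ be a symplectic manifold and $C\subset(M,\omega)$ a coisotropic submanifold with characteristic foliation $\mathcal{F}$, let $\omega_C$ be the pullback of $\omega$ to $C$, and let $G$ be a complement to $T\mathcal{F}$ in $TC$. (i) The map $\Phi:\big(\Omega^{\bullet}(\mathcal{F}),d_{\mathcal{F}}\big)\rightarrow\big(\Omega^{\bullet}(\mathcal{F};G),d_{\nabla}\big)$ is a chain map up to sign; that is, $\Phi\circ d_{\mathcal{F}}=-d_{\nabla}\circ\Phi$. (ii) The map $[\Phi]$ induced in cohomology is canonical (independent of $G$), since (under the identification $G\cong N\mathcal{F}$) it agrees with $$\big[-\mathrm{Id}\otimes(\omega_{C}^{\flat})^{-1}\big]\circ d_{\nu}:H^{\bullet}(\mathcal{F})\rightarrow H^{\bullet}(\mathcal{F};N\mathcal{F}).$$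
   Context: Everything is smooth. $C\subset(M,\omega)$ is coisotropic if $TC^{\omega}\subset TC$ (symplectic orthogonal); then $\omega_C$ is closed of constant rank and $T\mathcal{F}=\ker\omega_C$ defines the characteristic foliation. $\Omega^{k}(\mathcal{F})=\Gamma(\wedge^kT^{*}\mathcal{F})$, with leafwise de Rham differential $d_{\mathcal{F}}$ and cohomology $H^{\bullet}(\mathcal{F})$. $N\mathcal{F}=TC/T\mathcal{F}$ carries the flat Bott $T\mathcal{F}$-connection $\nabla_X\overline{Y}=\overline{[X,Y]}$, with dual connection $\nabla^{*}$ on $N^{*}\mathcal{F}$; $d_{\nabla}$, $d_{\nabla^{*}}$ are the associated Koszul-type differentials on $\Omega^{k}(\mathcal{F};N\mathcal{F})=\Gamma(\wedge^kT^{*}\mathcal{F}\otimes N\mathcal{F})$ and $\Omega^{k}(\mathcal{F};N^{*}\mathcal{F})=\Gamma(\wedge^kT^{*}\mathcal{F}\otimes N^{*}\mathcal{F})$, with cohomologies $H^{\bullet}(\mathcal{F};N\mathcal{F})$, $H^{\bullet}(\mathcal{F};N^{*}\mathcal{F})$. Via $G\cong N\mathcal{F}$, the connection on $G$ reads $\nabla_XY=\mathrm{pr}_G[X,Y]$ and one gets $(\Omega^{\bullet}(\mathcal{F};G),d_{\nabla})$. The isomorphism $\omega_C^{\flat}:N\mathcal{F}\to N^{*}\mathcal{F}$ (equivalently $G\to G^{*}$), $Y\mapsto\omega_C(Y,\cdot)$, is compatible with $\nabla,\nabla^{*}$, so $\mathrm{Id}\otimes(\omega_C^{\flat})^{-1}$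 induces an isomorphism $H^{\bullet}(\mathcal{F};N^{*}\mathcal{F})\to H^{\bullet}(\mathcal{F};N\mathcal{F})$. Let $j:\Omega^{\bullet}(\mathcal{F})\hookrightarrow\Omega^{\bullet}(C)$ be extension by zero on $G$. The map $\Phi:\Gamma(\wedge^{k}T^{*}\mathcal{F})\to\Gamma(\wedge^{k}T^{*}\mathcal{F}\otimes G)$ is defined by $\langle\Phi(\alpha)(V_1,\ldots,V_k),\beta\rangle=d(j(\alpha))\big(V_1,\ldots,V_k,(\omega_C^{\flat})^{-1}(\beta)\big)$ for $\beta\in\Gamma(G^{*})$, $V_i\in\Gamma(T\mathcal{F})$. The transverse differentiation map is $d_{\nu}:H^{k}(\mathcal{F})\to H^{k}(\mathcal{F};N^{*}\mathcal{F})$, $[\alpha]\mapsto[\mathsf{p}(d\widetilde{\alpha})]$, where $\widetilde{\alpha}\in\Omega^{k}(C)$ is any extension of $\alpha$ (i.e. restricting to $\alpha$ along the leaves), and for $\eta\in\Omega^{k+1}(C)$ vanishing when restricted to the leaves, $\langle \mathsf{p}(\eta)(V_1,\ldots,V_k),\overline{N}\rangle=\eta(V_1,\ldots,V_k,N)$ for $V_i\in\Gamma(T\mathcal{F})$, $\overline{N}\in\Gamma(N\mathcal{F})$. *)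

(* Defs.v *)
From HB Require Import structures.
From mathcomp Require Import all_boot all_order all_algebra.
From mathcomp Require Import all_classical all_reals all_analysis.

Set Implicit Arguments.
Unset Strict Implicit.
Unset Printing Implicit Defensive.

Import Order.TTheory GRing.Theory Num.Theory.
Import numFieldNormedType.Exports.
Import Quotient.

Local Open Scope quotient_scope.
Local Open Scope classical_set_scope.
Local Open Scope ring_scope.

Section Smoothness.
Variables (R : realType) (n : nat).
Implicit Types (U : set 'rV[R]_n) (f g : 'rV[R]_n -> R).

(* f is of class C^k on the open set U. *)
Fixpoint class_C (k : nat) U f : Prop :=
  (forall x, U x -> {for x, continuous f}) /\
  if k is k'.+1 then
    forall i : 'I_n, (forall x, U x -> derivable f x (delta_mx 0 i)) /\
                     class_C k' U ('D_(delta_mx 0 i) f)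
  else True.

Definition smooth_on U f : Prop := forall k, class_C k U f.

Lemma class_C_eq k U f g : open U -> (forall x, U x -> f x = g x) ->
  class_C k U f -> class_C k U g.
Proof.
move=> oU; have nearU f' g' : (forall x, U x -> f' x = g' x) ->
    forall x, U x -> \forall y \near x, f' y = g' y.
  move=> fg x Ux; have : nbhs x U by exact: open_nbhs_nbhs.
  by apply: filterS => y; exact: fg.
have contU f' g' : (forall x, U x -> f' x = g' x) ->
    (forall x, U x -> {for x, continuous f'}) ->
    forall x, U x -> {for x, continuous g'}.
  move=> fg cf x Ux; have := cf x Ux.
  rewrite /prop_for /continuous_at (fg x Ux); apply: cvg_trans.
  exact: (@near_eq_cvg _ _ (nbhs x) _ _ _ (nearU _ _ fg _ Ux)).
elim: k f g => [|k IH] f g fg /= [cf Hf].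
  by split=> //; exact: contU cf.
split; first exact: contU cf.
move=> i; have [df Cf] := Hf i; split=> [x Ux|].
  exact: near_eq_derivable (nearU _ _ fg _ Ux) (df _ Ux).
apply: IH Cf => x Ux; exact: near_eq_derive (nearU _ _ fg _ Ux).
Qed.

Lemma class_C_cst k U a : class_C k U (cst a).
Proof.
elim: k a => [|k IH] a /=; (split; first by move=> x _; exact: cst_continuous) => //.
move=> i; split=> [x _|]; first exact: derivable_cst.
have -> : 'D_(delta_mx 0 i) (cst a) = cst (0 : R) :> ('rV[R]_n -> R).
  by apply/funext => x; rewrite derive_cst.
exact: IH.
Qed.

Lemma class_CD k U f g : open U ->
  class_C k U f -> class_C k U g -> class_C k U (f + g).
Proof.
move=> oU; elim: k f g => [|k IH] f g /= [cf Hf] [cg Hg].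
  by split=> // x Ux; exact: (continuousD (cf x Ux) (cg x Ux)).
split=> [x Ux|i]; first by exact: (continuousD (cf x Ux) (cg x Ux)).
have [df Cf] := Hf i; have [dg Cg] := Hg i.
split=> [x Ux|]; first by apply: derivableD; [exact: df | exact: dg].
apply: class_C_eq (IH _ _ Cf Cg) => // x Ux.
by rewrite deriveD//; [exact: df | exact: dg].
Qed.

Lemma class_CW k U f : class_C k.+1 U f -> class_C k U f.
Proof.
elim: k f => [|k IH] f /= [cf Hf]; split=> // i.
by have [df Cf] := Hf i; split=> //; exact: IH.
Qed.

Lemma class_CM k U f g : open U ->
  class_C k U f -> class_C k U g -> class_C k U (f * g).
Proof.
move=> oU; elim: k f g => [|k IH] f g Ckf Ckg; have [cf Hf] := Ckf;
  have [cg Hg] := Ckg.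
  by split=> // x Ux; exact: (continuousM (cf x Ux) (cg x Ux)).
split=> [x Ux|i]; first by exact: (continuousM (cf x Ux) (cg x Ux)).
have [df Cf] := Hf i; have [dg Cg] := Hg i.
split=> [x Ux|]; first by apply: derivableM; [exact: df | exact: dg].
apply: (@class_C_eq _ _ (f * 'D_(delta_mx 0 i) g + g * 'D_(delta_mx 0 i) f)).
- exact: oU.
- by move=> x Ux; rewrite deriveM//; [exact: df | exact: dg].
- by apply: class_CD => //; apply: IH => //; exact: class_CW.
Qed.

End Smoothness.

Section Manifolds.
Variables (R : realType) (n : nat).

(* [cinv] is only meaningful on the image of [cdom], where it inverts [cmap]. *)
Record chart (T : topologicalType) := Chart {
  cdom : set T;
  cmap : T -> 'rV[R]_n;
  cinv : 'rV[R]_n -> T;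
  cdom_open : open cdom;
  cimg_open : open (cmap @` cdom);
  cmapK : forall p, cdom p -> cinv (cmap p) = p;
  cmap_continuous : forall p, cdom p -> {for p, continuous cmap};
  cinv_continuous : forall x, (cmap @` cdom) x -> {for x, continuous cinv} }.

Record manifold := Manifold {
  carrier :> topologicalType;
  atlas : set (chart carrier);
  manifold_hausdorff : hausdorff_space carrier;
  manifold_second_countable : @second_countable carrier;
  atlas_cover : forall p : carrier, exists2 c, atlas c & cdom c p;
  atlas_compatible : forall c c', atlas c -> atlas c' -> forall i : 'I_n,
    smooth_on (cmap c @` (cdom c `&` cdom c'))
              (fun x => cmap c' (cinv c x) 0 i) }.

Definition smooth (M : manifold) : {pred M -> R} := fun f =>
  `[< forall c, atlas c -> smooth_on (cmap c @` cdom c) (f \o cinv c) >].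

Lemma smooth_cst (M : manifold) (a : R) : (cst a : M -> R) \in @smooth M.
Proof. by apply/asboolP => c _ k; exact: class_C_cst. Qed.

Lemma smooth_subring (M : manifold) : subring_closed (@smooth M).
Proof.
split=> [|f g|f g]; first exact: smooth_cst.
- move=> /asboolP sf /asboolP sg; apply/asboolP => c Ac k.
  have oU := @cimg_open _ c.
  have := class_CD oU (sf c Ac k)
    (class_CM oU (@class_C_cst _ _ k _ (-1)) (sg c Ac k)).
  apply: class_C_eq => // x _ /=.
  by rewrite !fctE/= mulN1r.
- move=> /asboolP sf /asboolP sg; apply/asboolP => c Ac k.
  exact: class_CM (@cimg_open _ c) (sf c Ac k) (sg c Ac k).
Qed.

HB.instance Definition _ (M : manifold) :=
  GRing.isSubringClosed.Build (M -> R) (@smooth M) (@smooth_subring M).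

(* The ring C^oo(M). *)
Record Cinf (M : manifold) := MkCinf {
  Cinf_fun :> M -> R;
  Cinf_smooth : Cinf_fun \in @smooth M }.

HB.instance Definition _ (M : manifold) := [isSub for @Cinf_fun M].
HB.instance Definition _ (M : manifold) := [Choice of Cinf M by <:].
HB.instance Definition _ (M : manifold) :=
  
  GRing.SubChoice_isSubComPzRing.Build _ _ (Cinf M) (@smooth_subring M).

End Manifolds.

Arguments smooth {R n M}.
Definition Cinf_cst {R : realType} {n : nat} {M : manifold R n} (a : R) : Cinf M :=
  MkCinf (smooth_cst M a).

Section VectorFields.
Variables (R : realType) (n : nat) (M : manifold R n).
Notation A := (Cinf M).

(* The tangent space T_p M: R-linear point derivations of C^oo(M) at p. *)
Definition tangent (p : M) : set (A -> R^o) :=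
  [set v | (forall a f g, v (Cinf_cst a * f + g) = a * v f + v g) /\
           (forall f g, v (f * g) = f p * v g + g p * v f)].

(* Smooth vector fields: R-linear derivations of C^oo(M). *)
Definition is_derivation : {pred A -> A^o} := fun X =>
  `[< (forall a f g, X (Cinf_cst a * f + g) = Cinf_cst a * X f + X g) /\
      (forall f g, X (f * g) = f * X g + g * X f) >].

Lemma derivation_submod : submod_closed is_derivation.
Proof.
split.
  apply/asboolP; split=> [a f g|f g].
    by transitivity (Cinf_cst a * 0 + 0 : A) => //; rewrite mulr0 addr0.
  by transitivity (f * 0 + g * 0 : A) => //; rewrite !mulr0 addr0.
move=> h X Y /asboolP [X1 X2] /asboolP [Y1 Y2]; apply/asboolP.
have E f : (h *: X + Y) f = h * X f + Y f by [].
split=> [a f g|f g]; rewrite !E.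
  by rewrite X1 Y1 !mulrDr mulrCA addrACA.
by rewrite X2 Y2 !mulrDr !(mulrCA h) addrACA.
Qed.

HB.instance Definition _ :=
  GRing.isSubmodClosed.Build A (A -> A^o) is_derivation derivation_submod.

Record vfield := MkVfield {
  vfield_fun :> A -> A^o;
  vfieldP : vfield_fun \in is_derivation }.

HB.instance Definition _ := [isSub for vfield_fun].
HB.instance Definition _ := [Choice of vfield by <:].
HB.instance Definition _ := [SubChoice_isSubLmodule of vfield by <:].

Lemma vfieldL (X : vfield) a f g :
  X (Cinf_cst a * f + g) = Cinf_cst a * X f + X g.
Proof. by have /asboolP[+ _] := vfieldP X; apply. Qed.

Lemma vfieldM (X : vfield) f g : X (f * g) = f * X g + g * X f.
Proof. by have /asboolP[_] := vfieldP X; apply. Qed.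

Lemma Cinf_cst1 : Cinf_cst 1 = 1 :> A.
Proof. exact: val_inj. Qed.

Lemma vfieldD (X : vfield) f g : X (f + g) = X f + X g.
Proof. by have := vfieldL X 1 f g; rewrite Cinf_cst1 !mul1r. Qed.

Lemma vfieldN (X : vfield) f : X (- f) = - X f.
Proof.
have X0 : X 0 = 0 by have := vfieldM X 0 0; rewrite !mul0r addr0.
by apply/eqP; rewrite -addr_eq0 -vfieldD addNr X0.
Qed.

Lemma lie_subproof (X Y : vfield) :
  (fun f => X (Y f) - Y (X f)) \in is_derivation.
Proof.
apply/asboolP; split=> [a f g|f g].
  by rewrite !vfieldL opprD addrACA mulrBr.
have swap (a b a' b' p q : A) :
    a + p + (b + q) - (a' + q + (b' + p)) = a - a' + (b - b').
  rewrite (addrACA a p) (addrACA a' q) (addrC q p) opprD [LHS]addrACA addrN addr0.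
  by rewrite opprD addrACA.
rewrite !vfieldM !vfieldD !vfieldM (mulrC (X g)) (mulrC (X f)) swap.
by rewrite !mulrBr.
Qed.

Definition lie (X Y : vfield) : vfield := MkVfield (lie_subproof X Y).

Definition at_pt (X : vfield) (p : M) : A -> R^o := fun f => X f p.

End VectorFields.

Arguments is_derivation {R n M}.
Arguments tangent {R n M}.
Arguments lie {R n M}.
Arguments at_pt {R n M}.

(* Quotient of a module by a submodule; the additive part is ring_quotient's. *)
Section LmodQuotient.
Variables (A : pzRingType) (L : lmodType A) (S : submodClosed L).

Definition lquot_pred : {pred L} := fun x => x \in S.

Lemma lquot_pred_zmod : zmod_closed lquot_pred.
Proof.
split; first exact: rpred0.
by move=> x y Sx Sy; rewrite -scaleN1r; apply: rpredD => //; exact: rpredZ.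
Qed.

HB.instance Definition _ :=
  GRing.isZmodClosed.Build L lquot_pred lquot_pred_zmod.

Definition lquot := {quot lquot_pred}.
HB.instance Definition _ := GRing.Zmodule.on lquot.
HB.instance Definition _ := ZmodQuotient.on lquot.

Definition lquot_pi (x : L) : lquot := \pi_lquot x.
Definition lquot_repr (n : lquot) : L := repr n.
Definition lquot_scale (a : A) (n : lquot) : lquot :=
  lquot_pi (a *: lquot_repr n).

Lemma lquot_piK n : lquot_pi (lquot_repr n) = n.
Proof. exact: reprK. Qed.

Lemma lquot_piP x y : reflect (lquot_pi x = lquot_pi y) (x - y \in S).
Proof.
rewrite -[_ \in S]/(x - y \in lquot_pred) (idealrBE lquot_pred x y).
exact: eqP.
Qed.

Lemma lquot_piD : {morph lquot_pi : x y / x + y}.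
Proof. exact: pi_add. Qed.

Lemma lquot_piZ a x : lquot_pi (a *: x) = lquot_scale a (lquot_pi x).
Proof.
apply/lquot_piP; rewrite -scalerBr; apply: rpredZ.
by apply/lquot_piP; rewrite lquot_piK.
Qed.

Lemma lquot_scaleA a b n :
  lquot_scale a (lquot_scale b n) = lquot_scale (a * b) n.
Proof. by rewrite -(lquot_piK n) -!lquot_piZ scalerA. Qed.

Lemma lquot_scale1 : left_id 1 lquot_scale.
Proof. by move=> n; rewrite -(lquot_piK n) -!lquot_piZ scale1r. Qed.

Lemma lquot_scaleDr : right_distributive lquot_scale +%R.
Proof.
move=> a n m; rewrite -(lquot_piK n) -(lquot_piK m).
by rewrite -lquot_piD -!lquot_piZ scalerDr lquot_piD.
Qed.

Lemma lquot_scaleDl n : {morph lquot_scale^~ n : a b / a + b}.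
Proof.
by move=> a b; rewrite -(lquot_piK n) -!lquot_piZ scalerDl lquot_piD.
Qed.

HB.instance Definition _ := GRing.Zmodule_isLmodule.Build A lquot
  lquot_scaleA lquot_scale1 lquot_scaleDr lquot_scaleDl.
End LmodQuotient.

(* The dual module Hom_A(E, A). *)
Section Dual.
Variables (A : comPzRingType) (E : lmodType A).

Definition linear_form : {pred E -> A^o} := fun b =>
  `[< forall a x y, b (a *: x + y) = a * b x + b y >].

Lemma linear_form_submod : submod_closed linear_form.
Proof.
split; first by apply/asboolP=> a x y; transitivity (a * 0 + 0 : A) => //;
  rewrite mulr0 addr0.
move=> h b c /asboolP lb /asboolP lc; apply/asboolP => a x y.
have Q z : (h *: b + c) z = h * b z + c z by [].
by rewrite !Q lb lc !mulrDr mulrCA addrACA.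
Qed.

HB.instance Definition _ :=
  GRing.isSubmodClosed.Build A (E -> A^o) linear_form linear_form_submod.

Record dual_mod := MkDual {
  dual_fun :> E -> A^o;
  dual_linear : dual_fun \in linear_form }.

HB.instance Definition _ := [isSub for dual_fun].
HB.instance Definition _ := [Choice of dual_mod by <:].
HB.instance Definition _ := [SubChoice_isSubLmodule of dual_mod by <:].

Lemma dualL (b : dual_mod) a x y : b (a *: x + y) = a * b x + b y.
Proof. by have /asboolP := dual_linear b; apply. Qed.

End Dual.

(* For a bracket on an A-module L and a connection of L on an
   A-module E, the complex of alternating A-multilinear maps L^k -> E.  For
   L = Gamma(V) and E = Gamma(W), V and W vector bundles over a manifold with
   ring of functions A, these maps are the sections of wedge^k V^* (x) W. *)
Section Koszul.
Variables (A : comPzRingType) (L E : lmodType A).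

Definition cochain (k : nat) := ('I_k -> L) -> E.

Definition upd k (V : 'I_k -> L) (i : 'I_k) (x : L) : 'I_k -> L :=
  fun j => if j == i then x else V j.

Definition alternating_forms (k : nat) : set (cochain k) :=
  [set eta : cochain k |
    (forall (i : 'I_k) (V : 'I_k -> L) (a : A) (x y : L),
       eta (upd V i (a *: x + y)) =
       a *: eta (upd V i x) + eta (upd V i y)) /\
    (forall (V : 'I_k -> L) (i j : 'I_k), i != j -> V i = V j -> eta V = 0)].

Record connection := Connection {
  bracket : L -> L -> L;
  nabla : L -> E -> E }.

Variable D : connection.

(* (x, V_0, .., ^V_i, .., ^V_j, .., V_k) for i < j. *)
Definition insert_remove2 k (V : 'I_k.+1 -> L) (i j : 'I_k.+1) (x : L) :
    'I_k -> L :=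
  fun l => if l == 0%N :> nat then x else V (inord (bump j (bump i l.-1))).

Definition koszul k (eta : cochain k) : cochain k.+1 := fun V =>
  \sum_(i < k.+1) (-1) ^+ i *: nabla D (V i) (eta (fun l => V (lift i l))) +
  \sum_(i < k.+1) \sum_(j < k.+1 | (i < j)%N)
     (-1) ^+ (i + j) *: eta (insert_remove2 V i j (bracket D (V i) (V j))).

Definition exact_forms (k : nat) : set (cochain k) :=
  match k with
  | 0 => [set 0]
  | k'.+1 => [set koszul eta | eta in @alternating_forms k']
  end.

Definition coh_class k (eta : cochain k) : set (cochain k) :=
  [set theta | alternating_forms theta /\ exact_forms (theta - eta)].

(* H^k, as the set of classes of closed forms modulo exact forms. *)
Definition cohomology (k : nat) : set (set (cochain k)) :=
  [set coh_class eta | eta in [set eta | alternating_forms eta /\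
                                         koszul eta = 0]].

End Koszul.

Arguments alternating_forms {A L E}.
Arguments coh_class {A L E} D {k}.
Arguments cohomology {A L E}.

(* The map induced in cohomology by f: it sends a class c to the union of the
   classes of the f eta, eta in c (a single class when f is a chain map up to
   sign). *)
Definition coh_map (A : comPzRingType) (L E E' : lmodType A)
    (D' : connection L E') k (f : cochain L E k -> cochain L E' k)
    (c : set (cochain L E k)) : set (cochain L E' k) :=
  \bigcup_(eta in c) coh_class D' (f eta).

Arguments coh_map {A L E E'} D' {k}.

Section Forms.
Variables (R : realType) (n : nat) (M : manifold R n).
Notation A := (Cinf M).

Definition dform (k : nat) := cochain (vfield M) A^o k.

Definition de_rham : connection (vfield M) A^o :=
  @Connection A (vfield M) A^o lie (fun X f => X f).

Definition ext_d k (w : dform k) : dform k.+1 := koszul de_rham w.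

(* w_p(v_1, .., v_k), computed on any vector fields extending v_1, .., v_k; by
   C^oo(M)-multilinearity the value does not depend on the extensions. *)
Definition form_at k (w : dform k) (p : M) (v : 'I_k -> (A -> R^o)) : R :=
  xget 0 [set r | exists2 X : 'I_k -> vfield M,
                    forall i, at_pt (X i) p = v i & w X p = r].

Definition pair2 T (x y : T) : 'I_2 -> T := fun i => if i == 0 then x else y.

Definition nondegenerate (w : dform 2) : Prop :=
  forall p v, tangent p v ->
    (forall u, tangent p u -> form_at w p (pair2 v u) = 0) -> v = 0.

Definition symplectic (w : dform 2) : Prop :=
  [/\ alternating_forms 2 w, ext_d w = 0 & nondegenerate w].

End Forms.

Section Submanifold.
Variables (R : realType) (m n : nat) (M : manifold R m) (C : manifold R n).

(* C as an embedded submanifold of M; a map is smooth iff it pulls smooth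
   functions back to smooth functions. *)
Record submanifold := Submanifold {
  incl :> C -> M;
  incl_smooth : forall f : M -> R, f \in smooth -> f \o incl \in smooth;
  incl_inj : injective incl;
  incl_topology : forall U : set C,
    open U <-> exists2 V : set M, open V & U = incl @^-1` V;
  incl_immersion : forall p (v : Cinf C -> R^o), tangent p v ->
    (forall f : Cinf M, v (MkCinf (incl_smooth (Cinf_smooth f))) = 0) -> v = 0 }.

Variable iota : submanifold.

Definition pull_fun (f : Cinf M) : Cinf C :=
  MkCinf (incl_smooth iota (Cinf_smooth f)).

(* The differential of the inclusion. *)
Definition push (v : Cinf C -> R^o) : Cinf M -> R^o := v \o pull_fun.

Definition coisotropic (w : dform M 2) : Prop :=
  forall p v, tangent (iota p) v ->
    (forall u, tangent p u -> form_at w (iota p) (pair2 v (push u)) = 0) ->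
    exists2 u, tangent p u & v = push u.

Definition is_pullback k (w : dform M k) (wC : dform C k) : Prop :=
  alternating_forms k wC /\
  forall (X : 'I_k -> vfield C) (p : C),
    wC X p = form_at w (iota p) (fun i => push (at_pt (X i) p)).

End Submanifold.

Section Distributions.
Variables (R : realType) (n : nat) (M : manifold R n).
Notation A := (Cinf M).

(* Smooth subbundles of TM: near every point, the fibres have a basis of r
   smooth vector fields. *)
Record subbundle := Subbundle {
  fiber :> forall p : M, set (A -> R^o);
  local_frame : exists r : nat, forall p : M,
    exists (U : set M) (X : 'I_r -> vfield M),
      [/\ open U, U p & forall q, U q ->
        (forall v, fiber q v <->
           exists c : 'I_r -> R, v = \sum_(i < r) c i *: at_pt (X i) q) /\
        (forall c : 'I_r -> R, \sum_(i < r) c i *: at_pt (X i) q = 0 ->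
           forall i, c i = 0)] }.

Definition is_section (D : subbundle) : {pred vfield M} := fun X =>
  `[< forall p, D p (at_pt X p) >].

Lemma section_submod (D : subbundle) : submod_closed (is_section D).
Proof.
have [r frame] := local_frame D.
split; first apply/asboolP => p.
  have [U [X [_ Up /(_ p Up) [DX _]]]] := frame p.
  apply/DX; exists (fun=> 0); rewrite big1// => i _; exact: scale0r.
move=> a Y Z /asboolP DY /asboolP DZ; apply/asboolP => p.
have [U [X [_ Up /(_ p Up) [DX _]]]] := frame p.
have [c Yc] := (DX _).1 (DY p); have [d Zd] := (DX _).1 (DZ p).
apply/DX; exists (fun i => a p * c i + d i).
have -> : at_pt (a *: Y + Z) p = a p *: at_pt Y p + at_pt Z p by [].
rewrite Yc Zd scaler_sumr -big_split/=; apply: eq_bigr => i _.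
by rewrite scalerDl scalerA.
Qed.

HB.instance Definition _ (D : subbundle) := GRing.isSubmodClosed.Build
  A (vfield M) (is_section D) (section_submod D).

(* The module Gamma(D) of smooth sections of D. *)
Record sect (D : subbundle) := MkSect {
  sect_field :> vfield M;
  sectP : sect_field \in is_section D }.

HB.instance Definition _ (D : subbundle) := [isSub for @sect_field D].
HB.instance Definition _ (D : subbundle) := [Choice of sect D by <:].
HB.instance Definition _ (D : subbundle) :=
  [SubChoice_isSubLmodule of sect D by <:].

(* A foliation is given by its tangent bundle TF (Frobenius). *)
Record foliation := Foliation {
  tangent_bundle :> subbundle;
  involutive : forall X Y : sect tangent_bundle,
    lie X Y \in is_section tangent_bundle }.

Definition complementary (D E : subbundle) : Prop := forall p,
  (forall v, tangent p v -> exists2 a, D p a & exists2 b, E p b & v = a + b) /\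
  (forall v, D p v -> E p v -> v = 0).

End Distributions.

Section LeafwiseForms.
Variables (R : realType) (n : nat) (C : manifold R n) (F : foliation C).
Notation A := (Cinf C).
Notation TF := (sect F).

Definition lieF (V W : TF) : TF := MkSect (involutive V W).

(* (Omega^k(F), d_F) *)
Definition leafwise : connection TF A^o :=
  @Connection A TF A^o lieF (fun V f => V f).

(* Gamma(NF) = Gamma(TC) / Gamma(TF). *)
Definition normal_mod := lquot (is_section F).

Definition proj_N : vfield C -> normal_mod :=
  @lquot_pi A (vfield C) (is_section F).
Definition repr_N : normal_mod -> vfield C :=
  @lquot_repr A (vfield C) (is_section F).

Definition bott_nabla (V : TF) (N : normal_mod) : normal_mod :=
  proj_N (lie V (repr_N N)).

(* (Omega^k(F; NF), d_nabla) *)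
Definition bott : connection TF normal_mod := Connection lieF bott_nabla.

Lemma bott_nablaE V (X : vfield C) : bott_nabla V (proj_N X) = proj_N (lie V X).
Proof.
apply/lquot_piP.
have FZ : repr_N (proj_N X) - X \in is_section F.
  by apply/lquot_piP; exact: lquot_piK.
have -> : lie V (repr_N (proj_N X)) - lie V X = lie V (MkSect FZ).
  apply: val_inj; apply/funext => f /=.
  rewrite -[LHS]/(V (repr_N (proj_N X) f) - repr_N (proj_N X) (V f)
                  - (V (X f) - X (V f))).
  rewrite -[in RHS]/(V (repr_N (proj_N X) f - X f)
                  - (repr_N (proj_N X) (V f) - X (V f))).
  by rewrite vfieldD vfieldN !opprD !opprK addrACA.
exact: involutive.
Qed.

Lemma bott_nablaL V (a : A) (N N' : normal_mod) :
  bott_nabla V (a *: N + N') =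
  a *: bott_nabla V N + V a *: N + bott_nabla V N'.
Proof.
have KN N0 : proj_N (repr_N N0) = N0 by exact: lquot_piK.
rewrite -(KN N) -(KN N'); set X := repr_N N; set Y := repr_N N'.
rewrite -[a *: proj_N X]lquot_piZ -[_ + proj_N Y]lquot_piD.
rewrite !bott_nablaE.
rewrite -[a *: proj_N _]lquot_piZ -[V a *: proj_N X]lquot_piZ.
rewrite -![lquot_pi _ _ + _]lquot_piD; congr (proj_N _).
apply: val_inj; apply/funext => f /=.
rewrite -[LHS]/(V (a * X f + Y f) - (a * X (V f) + Y (V f))).
rewrite -[RHS]/(a * (V (X f) - X (V f)) + V a * X f + (V (Y f) - Y (V f))).
rewrite vfieldD vfieldM opprD addrACA; congr (_ + _).
by rewrite mulrBr addrAC (mulrC (X f)).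
Qed.

Lemma dual_bott_subproof (V : TF) (b : dual_mod normal_mod) :
  (fun N => V (b N) - b (bott_nabla V N)) \in @linear_form A normal_mod.
Proof.
apply/asboolP => a N N'.
rewrite bott_nablaL -(addrA (a *: _)) !dualL vfieldD vfieldM mulrBr.
have cancel2 (x y z p q : A) : x + y + z - (p + (y + q)) = x - p + (z - q).
  by rewrite -(addrA x) !(addrCA _ y) opprD [LHS]addrACA addrN add0r opprD
             addrACA.
by rewrite (mulrC (V a)) cancel2.
Qed.

(* (Omega^k(F; N^*F), d_{nabla^*}), with N^*F the dual of NF and
   <nabla^*_V b, N> = V <b, N> - <b, nabla_V N>. *)
Definition dual_bott : connection TF (dual_mod normal_mod) :=
  @Connection A TF (dual_mod normal_mod) lieF
    (fun V b => MkDual (dual_bott_subproof V b)).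

End LeafwiseForms.

(* Below, [xget 0 P] picks an element of a set P that is a singleton in the
   situation at hand (w_C the pullback of a symplectic form to a coisotropic
   submanifold, TF = ker w_C, G complementary to TF). *)
Section Coisotropic.
Variables (R : realType) (n : nat) (C : manifold R n) (F : foliation C).
Notation A := (Cinf C).
Notation TF := (sect F).
Variable wC : dform C 2.

(* TF = ker omega_C *)
Definition is_characteristic : Prop := forall p v,
  F p v <-> tangent p v /\
            (forall u, tangent p u -> form_at wC p (pair2 v u) = 0).

(* omega_C^flat on Gamma(NF): N |-> omega_C(N, .). *)
Definition flat_N (N : normal_mod F) : normal_mod F -> A :=
  fun N' => wC (pair2 (repr_N N) (repr_N N')).

Definition sharp_N (b : dual_mod (normal_mod F)) : normal_mod F :=
  xget 0 [set N | flat_N N = b].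

(* (V_1, .., V_k, Y) *)
Definition snoc k (V : 'I_k -> TF) (Y : vfield C) : 'I_k.+1 -> vfield C :=
  fun i => if unlift ord_max i is Some j then V j : vfield C else Y.

Definition restricts_to k (a' : dform C k) (a : cochain TF A^o k) : Prop :=
  forall V : 'I_k -> TF, a' (fun i => V i) = a V.

(* The map p, for eta vanishing along the leaves. *)
Definition normal_part k (eta : dform C k.+1) :
    cochain TF (dual_mod (normal_mod F)) k :=
  fun V => xget 0 [set b : dual_mod (normal_mod F) |
                     forall X : vfield C, b (proj_N F X) = eta (snoc V X)].

(* The transverse differentiation d_nu on cohomology classes: the union of the
   [p(d a')], for a' ranging over all extensions of all representatives. *)
Definition d_nu k (c : set (cochain TF A^o k)) :
    set (cochain TF (dual_mod (normal_mod F)) k) :=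
  [set theta | exists a a', [/\ c a, alternating_forms k a', restricts_to a' a &
     coh_class (dual_bott F) (normal_part (ext_d a')) theta]].

(* - Id (x) (omega_C^flat)^-1 *)
Definition minus_id_sharp k (theta : cochain TF (dual_mod (normal_mod F)) k) :
    cochain TF (normal_mod F) k :=
  fun V => - sharp_N (theta V).

Variable G : subbundle C.
Notation GG := (sect G).

Definition decomposes (X : vfield C) (V : TF) (Y : GG) : Prop :=
  X = (V : vfield C) + (Y : vfield C).

Definition pr_F (X : vfield C) : TF :=
  xget 0 [set V | exists Y, decomposes X V Y].
Definition pr_G (X : vfield C) : GG :=
  xget 0 [set Y | exists V, decomposes X V Y].

(* (Omega^k(F; G), d_nabla), with nabla_V Y = pr_G [V, Y] *)
Definition bott_G : connection TF GG :=
  @Connection A TF GG (@lieF _ _ _ F) (fun V Y => pr_G (lie V Y)).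

(* omega_C^flat on Gamma(G): Y |-> omega_C(Y, .). *)
Definition flat_G (Y : GG) : GG -> A :=
  fun Z => wC (pair2 (Y : vfield C) (Z : vfield C)).

Definition sharp_G (b : dual_mod GG) : GG := xget 0 [set Y | flat_G Y = b].

(* Extension by zero on G. *)
Definition ext0 k (a : cochain TF A^o k) : dform C k :=
  fun X => a (fun i => pr_F (X i)).

(* Phi(a)(V_1, .., V_k) is the section of G whose pairing with each section b
   of G^* is d(j a)(V_1, .., V_k, (omega_C^flat)^-1 b). *)
Definition Phi k (a : cochain TF A^o k) : cochain TF GG k :=
  fun V => xget 0
    [set Y : GG | forall b : dual_mod GG,
                    b Y = ext_d (ext0 a) (snoc V (sharp_G b))].

(* The identification G = NF, on coefficients. *)
Definition G_to_N k (eta : cochain TF GG k) : cochain TF (normal_mod F) k :=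
  fun V => proj_N F (eta V).

Definition Phi_coh k (c : set (cochain TF A^o k)) : set (cochain TF GG k) :=
  coh_map bott_G (@Phi k) c.

(* [Phi] followed by H(F; G) = H(F; NF). *)
Definition Phi_coh_N k (c : set (cochain TF A^o k)) :
    set (cochain TF (normal_mod F) k) :=
  coh_map (bott F) (@G_to_N k) (Phi_coh c).

End Coisotropic.

Arguments d_nu {R n C F k}.
Arguments Phi_coh {R n C F} wC G {k}.
Arguments Phi_coh_N {R n C F} wC G {k}.

(* Main.v *)
From HB Require Import structures.
Require Import Defs.
From mathcomp Require Import all_boot all_order all_algebra.
From mathcomp Require Import all_classical all_reals all_analysis.
From mathcomp Require Import zify ring lra.

Set Implicit Arguments.
Unset Strict Implicit.
Unset Printing Implicit Defensive.

Import Order.TTheory GRing.Theory Num.Theory.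
Import numFieldNormedType.Exports.

Local Open Scope classical_set_scope.
Local Open Scope ring_scope.

(* Because [w_C] is closed with kernel TF, the map omega_C^flat is an isomorphism
   from NF to its dual that intertwines the Bott connections. For a leafwise form
   [a], let [beta] be d(j a) - j(d_F a). It vanishes on the leaves, so it has a normal part
   p(beta), and pairing with G gives Phi(a) = - (omega_C^flat)^-1 p(beta). On forms
   vanishing on the leaves p intertwines d with the differential of the dual Bott
   connection. Since d^2 = 0, the form attached to d_F a is - d(beta), which gives (i);
   and two extensions of a closed [a] differ by a form vanishing on the leaves, so
   the class of p(d a') does not depend on the extension a', which gives (ii).

   Tangent vectors are derivations of the ring of smooth functions. Hadamard's lemma
   and bump functions show that they are spanned by coordinate fields, which makes
   forms pointwise objects and yields smooth coefficients in local frames. *)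

(** * Koszul complexes of Lie-Rinehart pairs *)

(** Two obstacles shape the proof. The operations [Phi], [sharp_N], [sharp_G], [pr_F], [pr_G] and
    [normal_part] are choices by [xget] with default 0, so each is first shown to have a solution.
    For the projections and for the inverse of omega_C^flat the solution must be smooth: Cramer's
    rule gives it near each point, and uniqueness at every single point glues the local solutions.
    Next, [koszul] is a double sum over deleted indices. Manipulating that sum is confined to one
    place, Cartan's formula i_X d = L_X - d i_X; afterwards d^2 = 0 and the comparison of p with the
    differentials are inductions on the degree by contraction. Closedness of omega_C enters through
    d omega_C(V, X, Y) = 0 with V tangent to the leaves, which says that omega_C is parallel for the
    Bott connection. The minus sign is the skew symmetry of omega_C: [Phi] inserts the vector dual
    to b into the form, while (omega_C^flat)^-1 p(beta) occupies the first slot of omega_C. *)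

Section ConsVectors.
Variables (A : comPzRingType) (L E : lmodType A).
Implicit Types (k : nat) (X Y : L) (e : E).

Definition vcons k X (V : 'I_k -> L) : 'I_k.+1 -> L :=
  fun i => if unlift ord0 i is Some j then V j else X.

Definition vtail k (V : 'I_k.+1 -> L) : 'I_k -> L := fun i => V (lift ord0 i).

Lemma vcons0 k X (V : 'I_k -> L) : vcons X V ord0 = X.
Proof. by rewrite /vcons unlift_none. Qed.

Lemma vconsS k X (V : 'I_k -> L) i : vcons X V (lift ord0 i) = V i.
Proof. by rewrite /vcons liftK. Qed.

Lemma vcons_eta k (V : 'I_k.+1 -> L) : vcons (V ord0) (vtail V) = V.
Proof.
apply/funext => i; case: (unliftP ord0 i) => [j|] ->; first by rewrite vconsS.
by rewrite vcons0.
Qed.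

Lemma upd_vcons0 k X Y (V : 'I_k -> L) :
  upd (vcons X V) ord0 Y = vcons Y V.
Proof.
apply/funext => i; case: (unliftP ord0 i) => [j|] ->; rewrite /upd.
  by rewrite !vconsS.
by rewrite !vcons0 eqxx.
Qed.

Lemma upd_vconsS k X Y (V : 'I_k -> L) i :
  upd (vcons X V) (lift ord0 i) Y = vcons X (upd V i Y).
Proof.
apply/funext => j; case: (unliftP ord0 j) => [j'|] ->; rewrite /upd ?vconsS.
  by rewrite (inj_eq lift_inj).
by rewrite !vcons0.
Qed.

Lemma vcons_lift0 k X (V : 'I_k -> L) :
  (fun l => vcons X V (lift ord0 l)) = V.
Proof. by apply/funext => l; rewrite vconsS. Qed.

Lemma vcons_lift k X (V : 'I_k.+1 -> L) i :
  (fun l => vcons X V (lift (lift ord0 i) l)) = vcons X (fun l => V (lift i l)).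
Proof.
apply/funext => l; case: (unliftP ord0 l) => [j|] ->; rewrite ?vconsS ?vcons0.
  rewrite -[RHS](vconsS X V); congr (vcons X V _).
  by apply: val_inj; rewrite /= /bump !add1n ltnS; case: leqP.
by rewrite -[RHS](vcons0 X V); congr (vcons X V _); apply: val_inj.
Qed.

Lemma forms0E (eta : cochain L E 0) V W : eta V = eta W.
Proof. by congr eta; apply/funext => -[]. Qed.

(** The interior product i_X. Since a cochain is determined by its contractions ([cochainP]),
    identities in degree k+1 are reduced to degree k. *)
Definition contr k X (eta : cochain L E k.+1) : cochain L E k :=
  fun V => eta (vcons X V).

Lemma cochainP k (eta theta : cochain L E k.+1) :
  (forall X, contr X eta = contr X theta) -> eta = theta.
Proof.
move=> H; apply/funext => V; rewrite -(vcons_eta V).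
exact: (congr1 (fun f => f _) (H _)).
Qed.

Lemma contr_alternating k X eta :
  alternating_forms k.+1 eta -> alternating_forms k (contr X eta).
Proof.
move=> [lin alt]; split=> [i V a x y|V i j ij Vij]; rewrite /contr.
  by rewrite -!upd_vconsS lin.
by apply: (alt _ (lift ord0 i) (lift ord0 j)); rewrite ?(inj_eq lift_inj) ?vconsS.
Qed.

Lemma alternating_consL k (eta : cochain L E k.+1) a X Y V :
  alternating_forms k.+1 eta ->
  eta (vcons (a *: X + Y) V) = a *: eta (vcons X V) + eta (vcons Y V).
Proof. move=> [lin _]; have := lin ord0 (vcons X V) a X Y.
by rewrite !upd_vcons0. Qed.

Lemma alternating_consD k (eta : cochain L E k.+1) X Y V :
  alternating_forms k.+1 eta ->
  eta (vcons (X + Y) V) = eta (vcons X V) + eta (vcons Y V).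
Proof. by move=> He; rewrite -(scale1r X) alternating_consL// !scale1r. Qed.

Lemma alternating_cons0 k (eta : cochain L E k.+1) V :
  alternating_forms k.+1 eta -> eta (vcons 0 V) = 0.
Proof.
move=> He; have := alternating_consD 0 0 V He.
by rewrite addr0 => /eqP; rewrite -subr_eq0 opprD addrA subrr sub0r oppr_eq0 => /eqP.
Qed.

Lemma alternating_cons2 k (eta : cochain L E k.+2) X V :
  alternating_forms k.+2 eta -> eta (vcons X (vcons X V)) = 0.
Proof.
move=> [_ alt]; apply: (alt _ ord0 (lift ord0 ord0)) => //.
by rewrite vconsS !vcons0.
Qed.

Lemma alternating_swap k (eta : cochain L E k.+2) X Y V :
  alternating_forms k.+2 eta ->
  eta (vcons X (vcons Y V)) = - eta (vcons Y (vcons X V)).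
Proof.
move=> He; have := alternating_cons2 (X + Y) V He.
rewrite alternating_consD//.
have H Z := alternating_consD X Y V (contr_alternating Z He).
rewrite /contr in H; rewrite !H !alternating_cons2// add0r addr0.
by move=> /eqP; rewrite addr_eq0 => /eqP.
Qed.

(** On its way to the front the argument in slot j crosses j others, each at the cost of a sign.
    This turns the deletion of an index in [koszul] into an update in place, as in a Lie
    derivative. *)
Lemma alternating_move k (eta : cochain L E k.+1) V (j : 'I_k.+1) X :
  alternating_forms k.+1 eta ->
  eta (upd V j X) = (-1) ^+ j *: eta (vcons X (fun l => V (lift j l))).
Proof.
elim: k eta V j => [|k IH] eta V j He.
  rewrite (ord1 j) expr0 scale1r -(vcons_eta V) upd_vcons0.
  by congr eta; congr vcons; apply/funext => -[].
rewrite -(vcons_eta V); case: (unliftP ord0 j) => [j'|] ->; last first.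
  by rewrite upd_vcons0 vcons_lift0 expr0 scale1r.
rewrite upd_vconsS vcons_lift.
have := IH (contr (V ord0) eta) (vtail V) j' (contr_alternating _ He).
rewrite /contr => ->; rewrite alternating_swap// lift0 exprS mulN1r.
by rewrite scalerN scaleNr.
Qed.

(* Alternation need only be tested on the first two slots, recursively. *)
Lemma alternatingP k (eta : cochain L E k.+1) :
  (forall X, alternating_forms k (contr X eta)) ->
  (forall a X Y V,
     eta (vcons (a *: X + Y) V) = a *: eta (vcons X V) + eta (vcons Y V)) ->
  (forall V, (if k is k'.+1 return cochain L E k.+1 -> ('I_k -> L) -> Prop
              then fun eta V => eta (vcons (V ord0) V) = 0
              else fun _ _ => True) eta V) ->
  alternating_forms k.+1 eta.
Proof.
move=> alt lin; case: k eta alt lin => [|k] eta alt lin alt2.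
  split=> [i V a x y|V i j]; last by rewrite (ord1 i) (ord1 j) eqxx.
  by rewrite (ord1 i) -(vcons_eta V) !upd_vcons0 lin.
(* A later repetition of the first argument is moved next to it, by alternation of the contraction;
   there [alt2] applies. *)
have first V j : V ord0 = V (lift ord0 j) -> eta V = 0.
  rewrite -(vcons_eta V) vcons0 vconsS => H.
  have -> : vtail V = upd (vtail V) j (V ord0).
    by apply/funext => l; rewrite /upd; case: eqP => // ->.
  have := alternating_move (vtail V) j (V ord0) (alt (V ord0)).
  rewrite /contr => ->.
  have := alt2 (vcons (V ord0) (fun l => vtail V (lift j l))).
  by rewrite vcons0 => ->; rewrite scaler0.
split=> [i V a x y|V i j].
  rewrite -(vcons_eta V); case: (unliftP ord0 i) => [j|] ->.
    by rewrite !upd_vconsS; have [+ _] := alt (V ord0); apply.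
  by rewrite !upd_vcons0 lin.
case: (unliftP ord0 i) => [i'|] ->; case: (unliftP ord0 j) => [j'|] -> ij Vij.
- rewrite -(vcons_eta V); have [_ H] := alt (V ord0).
  have ij' : i' != j' by apply/eqP => e; rewrite e eqxx in ij.
  exact: (H (vtail V) i' j' ij').
- exact: (first V i').
- exact: (first V j').
- by rewrite eqxx in ij.
Qed.

Lemma alternating_forms0 (eta : cochain L E 0) : alternating_forms 0 eta.
Proof. by split=> [[]|V []]. Qed.

Lemma alternating_formsL k (a : A) (eta theta : cochain L E k) :
  alternating_forms k eta -> alternating_forms k theta ->
  alternating_forms k (a *: eta + theta).
Proof.
move=> [lin1 alt1] [lin2 alt2]; split=> [i V b x y|V i j ij Vij].
  rewrite -![(a *: eta + theta) _]/(a *: eta _ + theta _) lin1 lin2 !scalerDr.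
  by rewrite !scalerA (mulrC a) addrACA.
rewrite -[LHS]/(a *: eta _ + theta _).
by rewrite (alt1 _ i j)// (alt2 _ i j)// scaler0 addr0.
Qed.

Lemma alternating_formsN k (eta : cochain L E k) :
  alternating_forms k eta -> alternating_forms k (- eta).
Proof.
move=> H; have /(alternating_formsL (-1) H) :
  alternating_forms k (0 : cochain L E k).
  by split=> *; rewrite -?[_ _]/(0 : E) ?scaler0 ?addr0.
by rewrite scaleN1r addr0.
Qed.

Lemma alternating_formsD k (eta theta : cochain L E k) :
  alternating_forms k eta -> alternating_forms k theta ->
  alternating_forms k (eta + theta).
Proof. by move=> H1 H2; rewrite -(scale1r eta); exact: alternating_formsL. Qed.

End ConsVectors.

(** The axioms of the Cartan calculus. [act] is the anchor, shared by the two Leibniz rules so that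
    their derivative terms cancel in L_X; [jacobi] and [nabla_flat] give d^2 = 0; [act1] lets
    additivity of [nabla] be read off from its Leibniz rule. *)
Record lie_rinehart (A : comPzRingType) (L E : lmodType A)
    (D : connection L E) (act : L -> A -> A) : Prop := LieRinehart {
  bracketDl : forall x y z, bracket D (x + y) z = bracket D x z + bracket D y z;
  bracketL : forall x a y z,
    bracket D x (a *: y + z) = a *: bracket D x y + act x a *: y + bracket D x z;
  bracketxx : forall x, bracket D x x = 0;
  jacobi : forall x y z,
    bracket D (bracket D x y) z = bracket D x (bracket D y z) - bracket D y (bracket D x z);
  nablaZl : forall a x y e, nabla D (a *: x + y) e = a *: nabla D x e + nabla D y e;
  nablaL : forall x a e f,
    nabla D x (a *: e + f) = a *: nabla D x e + act x a *: e + nabla D x f;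
  nabla_flat : forall x y e,
    nabla D (bracket D x y) e = nabla D x (nabla D y e) - nabla D y (nabla D x e);
  act1 : forall x, act x 1 = 0 }.

Lemma big_pairs_recl (V : nmodType) k (G : 'I_k.+1 -> 'I_k.+1 -> V) :
  \sum_(i < k.+1) \sum_(j < k.+1 | (i < j)%N) G i j =
  \sum_(j < k) G ord0 (lift ord0 j) +
  \sum_(i < k) \sum_(j < k | (i < j)%N) G (lift ord0 i) (lift ord0 j).
Proof.
rewrite big_ord_recl; congr (_ + _).
  by rewrite big_mkcond big_ord_recl ltnn /= add0r.
by apply: eq_bigr => i _; rewrite big_mkcond big_ord_recl ltn0 /= add0r [RHS]big_mkcond.
Qed.

(** * Cartan calculus *)

Section Cartan.
Variables (A : comPzRingType) (L E : lmodType A) (D : connection L E).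
Local Notation br := (bracket D).
Local Notation nb := (nabla D).
Implicit Types (k : nat) (X Y Z : L).

Definition lieder k X (eta : cochain L E k) : cochain L E k := fun V =>
  nb X (eta V) - \sum_(j < k) eta (upd V j (br X (V j))).

Lemma insert_remove2_cons0 k X (V : 'I_k.+1 -> L) (j : 'I_k.+1) x :
  insert_remove2 (vcons X V) ord0 (lift ord0 j) x = vcons x (fun l => V (lift j l)).
Proof.
apply/funext => l; case: (unliftP ord0 l) => [l'|] -> /=; last first.
  by rewrite vcons0.
rewrite vconsS -(vconsS X V); congr (vcons X V _).
apply: val_inj; rewrite /= inordK /bump /= ?add1n ?ltnS//.
  by case: leqP => _; rewrite ?add1n ?add0n//.
by case: l' => l' /= lt; rewrite add0n; case: (j <= l')%N => /=; lia.
Qed.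

Lemma insert_remove2_consS k X (V : 'I_k.+2 -> L) (i j : 'I_k.+2) x :
  (i < j)%N ->
  insert_remove2 (vcons X V) (lift ord0 i) (lift ord0 j) x =
  vcons x (vcons X (vtail (insert_remove2 V i j x))).
Proof.
move=> ij; apply/funext => l; case: (unliftP ord0 l) => [l'|] -> /=; last first.
  by rewrite vcons0.
rewrite vconsS; case: (unliftP ord0 l') => [l''|] -> /=; last first.
  rewrite vcons0 -[RHS](vcons0 X V) /insert_remove2 /=; congr (vcons X V _).
  by apply: val_inj; rewrite /= inordK.
rewrite vconsS /vtail /insert_remove2 /= -(vconsS X V); congr (vcons X V _).
have lt : (bump j (bump i l'') < k.+2)%N.
  have := ltn_ord l''; have := ltn_ord j; rewrite /bump.
  by case: leqP; case: leqP => //=; rewrite ?add1n ?add0n; lia.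
have e : bump j.+1 (bump i.+1 (l''.+1)) = (bump j (bump i l'')).+1.
  by rewrite /bump; do 4 case: leqP => //=; lia.
by apply: val_inj; rewrite /= !/(bump 0 _) /= !add1n e !inordK ?add1n//.
Qed.

Lemma koszul_cons1 X (eta : cochain L E 0) V :
  koszul D eta (vcons X V) = nb X (eta V).
Proof.
rewrite /koszul big_ord_recl big_ord0 addr0 expr0 scale1r vcons0.
rewrite big_ord_recl big_ord0 !big1 ?addr0//; last by move=> j; rewrite (ord1 j).
by congr (nb X _); exact: forms0E.
Qed.

(** Cartan's formula. The terms involving slot 0 make up the Lie derivative. In the others the index
    shift changes the sign of the single sum, and in the double sum the sign comes from exchanging X
    with the bracket that precedes it. *)
Lemma koszul_cons k X (eta : cochain L E k.+1) V :
  alternating_forms k.+1 eta ->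
  koszul D eta (vcons X V) = lieder X eta V - koszul D (contr X eta) V.
Proof.
move=> He; rewrite /koszul big_ord_recl vcons0 vcons_lift0 expr0 scale1r.
rewrite big_pairs_recl /lieder -!addrA; congr (_ + _).
rewrite opprD addrCA; congr (_ + _).
  rewrite -sumrN; apply: eq_bigr => j _ /=.
  rewrite insert_remove2_cons0 vcons0 vconsS (alternating_move _ _ _ He).
  by rewrite add0n exprS mulN1r scaleNr.
rewrite -!sumrN; congr (_ + _).
  by apply: eq_bigr => i _; rewrite vconsS vcons_lift lift0 exprS mulN1r scaleNr.
apply: eq_bigr => i _; rewrite -sumrN; apply: eq_bigr => j ij.
rewrite !lift0 !vconsS; set b := br _ _.
have -> : (-1) ^+ (i.+1 + j.+1) = (-1) ^+ (i + j) :> A.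
  by rewrite addSn addnS !exprS mulrA mulrNN mulr1 mul1r.
rewrite -scalerN; congr (_ *: _).
(* The exchange requires two slots; with a single one there is no pair i < j. *)
case: k eta V He i j ij @b => [|k] eta V He i j ij b.
  by move: ij; rewrite (ord1 i) (ord1 j).
rewrite insert_remove2_consS// /contr alternating_swap//; congr (- eta (vcons X _)).
by rewrite -[in RHS](vcons_eta (insert_remove2 V i j b)).
Qed.

End Cartan.

Section KoszulAdditive.
Variables (A : comPzRingType) (L E : lmodType A) (D : connection L E).
Hypothesis nbD : forall x e f, nabla D x (e + f) = nabla D x e + nabla D x f.

Lemma koszulD k (eta theta : cochain L E k) :
  koszul D (eta + theta) = koszul D eta + koszul D theta.
Proof.
apply/funext => V; rewrite -[RHS]/(koszul D eta V + koszul D theta V) /koszul.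
rewrite addrACA; congr (_ + _); rewrite -big_split; apply: eq_bigr => i _.
  by rewrite -[(eta + theta) _]/(eta _ + theta _) nbD scalerDr.
by rewrite -big_split; apply: eq_bigr => j _; exact: scalerDr.
Qed.

Lemma koszul0 k : koszul D (0 : cochain L E k) = 0.
Proof.
have := koszulD (0 : cochain L E k) 0; rewrite addr0 => /eqP.
by rewrite -subr_eq0 opprD addrA subrr sub0r oppr_eq0 => /eqP.
Qed.

Lemma koszulN k (eta : cochain L E k) : koszul D (- eta) = - koszul D eta.
Proof. by apply/eqP; rewrite -addr_eq0 -koszulD addNr koszul0. Qed.

End KoszulAdditive.

Section LieRinehart.
Variables (A : comPzRingType) (L E : lmodType A) (D : connection L E).
Variable act : L -> A -> A.
Hypothesis HD : lie_rinehart D act.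
Local Notation br := (bracket D).
Local Notation nb := (nabla D).
Local Notation alt := (@alternating_forms A L E).
Implicit Types (k : nat) (X Y Z : L).

Lemma nablaD X e f : nb X (e + f) = nb X e + nb X f.
Proof. by have := nablaL HD X 1 e f; rewrite (act1 HD) scale0r addr0 !scale1r. Qed.

Lemma nabla0 X : nb X 0 = 0.
Proof.
have := nablaD X 0 0; rewrite addr0 => /eqP.
by rewrite -subr_eq0 opprD addrA subrr sub0r oppr_eq0 => /eqP.
Qed.

Lemma nablaN X e : nb X (- e) = - nb X e.
Proof. by apply/eqP; rewrite -addr_eq0 -nablaD addNr nabla0. Qed.

Lemma nablaDl X Y e : nb (X + Y) e = nb X e + nb Y e.
Proof. by have := nablaZl HD 1 X Y e; rewrite !scale1r. Qed.

Lemma liederD k X (eta theta : cochain L E k) :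
  lieder D X (eta + theta) = lieder D X eta + lieder D X theta.
Proof.
apply/funext => V; rewrite -[RHS]/(lieder D X eta V + lieder D X theta V).
rewrite /lieder -[(eta + theta) V]/(eta V + theta V) nablaD addrACA.
by rewrite -opprD -big_split.
Qed.

Lemma liederN k X (eta : cochain L E k) : lieder D X (- eta) = - lieder D X eta.
Proof.
apply/funext => V; rewrite -[RHS]/(- lieder D X eta V) /lieder.
by rewrite -[(- eta) V]/(- eta V) nablaN opprD; congr (_ - _);
  rewrite -?sumrN.
Qed.

Lemma liederDl k X Y (eta : cochain L E k) V : alt k eta ->
  lieder D (X + Y) eta V = lieder D X eta V + lieder D Y eta V.
Proof.
move=> [lin _]; rewrite /lieder nablaDl addrACA; congr (_ + _).
rewrite -opprD -big_split; congr (- _); apply: eq_bigr => j _.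
by rewrite (bracketDl HD) -(scale1r (br X _)) lin !scale1r.
Qed.

Lemma lieder_forms0 X (eta : cochain L E 0) V : lieder D X eta V = nb X (eta V).
Proof. by rewrite /lieder big_ord0 subr0. Qed.

Lemma lieder_cons k X Y (eta : cochain L E k.+1) V :
  lieder D X eta (vcons Y V) = lieder D X (contr Y eta) V - eta (vcons (br X Y) V).
Proof.
rewrite /lieder big_ord_recl upd_vcons0 vcons0 opprD -addrA; congr (_ + _).
rewrite addrC; congr (_ - _); apply: eq_bigr => j _.
by rewrite vconsS upd_vconsS.
Qed.

Lemma contr_lieder k X Y (eta : cochain L E k.+1) :
  contr Y (lieder D X eta) = lieder D X (contr Y eta) - contr (br X Y) eta.
Proof. by apply/funext => V; exact: lieder_cons. Qed.

Lemma contr_koszul1 X (eta : cochain L E 0) :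
  contr X (koszul D eta) = lieder D X eta.
Proof. by apply/funext => V; rewrite /contr koszul_cons1 lieder_forms0. Qed.

Lemma contr_koszul k X (eta : cochain L E k.+1) : alt k.+1 eta ->
  contr X (koszul D eta) = lieder D X eta - koszul D (contr X eta).
Proof. by move=> He; apply/funext => V; exact: koszul_cons. Qed.

Lemma lieder_alternating k X (eta : cochain L E k) :
  alt k eta -> alt k (lieder D X eta).
Proof.
elim: k eta => [|k IH] eta He; first exact: alternating_forms0.
apply: alternatingP => [Y|a Y Z V|].
- rewrite contr_lieder; apply: alternating_formsD; first exact/IH/contr_alternating.
  exact/alternating_formsN/contr_alternating.
- rewrite !lieder_cons (bracketL HD).
  have -> : eta (vcons (a *: br X Y + act X a *: Y + br X Z) V) =
      a *: eta (vcons (br X Y) V) +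
      (act X a *: eta (vcons Y V) + eta (vcons (br X Z) V)).
    by rewrite -addrA !(alternating_consL _ _ _ _ He).
  have -> : contr (a *: Y + Z) eta = a *: contr Y eta + contr Z eta.
    by apply/funext => W; exact: alternating_consL.
  rewrite liederD -[X in X - _ = _]/(lieder D X (a *: contr Y eta) V + lieder D X (contr Z eta) V).
  have -> : lieder D X (a *: contr Y eta) V =
            a *: lieder D X (contr Y eta) V + act X a *: eta (vcons Y V).
    rewrite /lieder -[(a *: contr Y eta) V]/(a *: eta (vcons Y V)).
    have := nablaL HD X a (eta (vcons Y V)) 0; rewrite !addr0 nabla0 addr0 => ->.
    by rewrite scalerBr scaler_sumr addrAC.
  (* The terms with [act X a], one from [nabla] and one from the bracket, cancel. *)
  rewrite scalerBr !opprD !addrA.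
  by rewrite [LHS](ACl (1*5*3*4*7*(2*6)))/= subrr addr0.
- case: k eta He {IH} => [|k] eta He V //.
  rewrite lieder_cons -[V]vcons_eta !vcons0 lieder_cons /contr.
  set W := vtail V; set Y := V ord0.
  have -> : lieder D X (fun U => eta (vcons Y (vcons Y U))) W = 0.
    have -> : (fun U => eta (vcons Y (vcons Y U))) = 0.
      by apply/funext => U; exact: alternating_cons2.
    by rewrite /lieder -[_ W]/(0 : E) nabla0 big1// subr0.
  by rewrite sub0r (alternating_swap _ _ _ He) opprK subrr.
Qed.

(** L_X is not A-linear in X, so Cartan's formula does not yield linearity in the first slot at
    once. It yields additivity there, vanishing on equal leading arguments, and linearity in the
    remaining slots; polarisation then makes the first two slots skew, and linearity is carried over
    from the second to the first. *)
Lemma koszul_alternating k (eta : cochain L E k) :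
  alt k eta -> alt k.+1 (koszul D eta).
Proof.
elim: k eta => [|k IH] eta He; apply: alternatingP => [Y|a Y Z V|] //.
- exact: alternating_forms0.
- by rewrite !koszul_cons1 (nablaZl HD).
- rewrite contr_koszul//; apply: alternating_formsD; first exact: lieder_alternating.
  exact/alternating_formsN/IH/contr_alternating.
- have kD Y' Z' W : koszul D eta (vcons (Y' + Z') W) =
      koszul D eta (vcons Y' W) + koszul D eta (vcons Z' W).
    rewrite !koszul_cons//.
    have -> : contr (Y' + Z') eta = contr Y' eta + contr Z' eta.
      by apply/funext => U; exact: alternating_consD.
    rewrite (koszulD nablaD) liederDl//.
    rewrite -[(koszul D (contr Y' eta) + koszul D (contr Z' eta)) W]
            /(koszul D (contr Y' eta) W + koszul D (contr Z' eta) W) opprD.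
    move: (lieder D Y' eta W) (lieder D Z' eta W) => p q.
    by rewrite addrACA.
  have k2 Y' W : koszul D eta (vcons Y' (vcons Y' W)) = 0.
    rewrite koszul_cons// lieder_cons (bracketxx HD) (alternating_cons0 _ He) subr0.
    case: k eta He W {kD IH V} => [|k] eta He W.
      by rewrite koszul_cons1 lieder_forms0 subrr.
    rewrite (koszul_cons _ _ _ (contr_alternating _ He)) opprD opprK addrA subrr add0r.
    have -> : contr Y' (contr Y' eta) = 0 by apply/funext => U; exact: alternating_cons2.
    by rewrite (koszul0 nablaD).
  have kS Y' Z' W : koszul D eta (vcons Y' (vcons Z' W)) =
      - koszul D eta (vcons Z' (vcons Y' W)).
    apply/eqP; rewrite -addr_eq0.
    have := k2 (Y' + Z') W; rewrite kD.
    have altE U : alt k.+1 (contr U (koszul D eta)).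
      rewrite contr_koszul//; apply: alternating_formsD; first exact: lieder_alternating.
      exact/alternating_formsN/IH/contr_alternating.
    have H U := alternating_consD Y' Z' W (altE U).
    by rewrite /contr in H; rewrite !H !k2 add0r addr0 => ->.
  have altZ : alt k.+1 (contr (V ord0) (koszul D eta)).
    rewrite contr_koszul//; apply: alternating_formsD; first exact: lieder_alternating.
    exact/alternating_formsN/IH/contr_alternating.
  rewrite -(vcons_eta V) kD; congr (_ + _).
  rewrite kS [in RHS]kS scalerN; congr (- _).
  have := alternating_consL a Y 0 (vtail V) altZ.
  by rewrite !addr0 alternating_cons0// addr0.
- move=> V; rewrite -[V]vcons_eta vcons0.
  rewrite koszul_cons// lieder_cons (bracketxx HD) (alternating_cons0 _ He) subr0.
  case: k eta He V {IH} => [|k] eta He V.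
    by rewrite koszul_cons1 lieder_forms0 subrr.
  rewrite (koszul_cons _ _ _ (contr_alternating _ He)) opprD opprK addrA subrr add0r.
  have -> : contr (V ord0) (contr (V ord0) eta) = 0.
    by apply/funext => U; exact: alternating_cons2.
  by rewrite (koszul0 nablaD).
Qed.

(** Degree 0 is flatness of the connection. In the induction step the contractions with iterated
    brackets combine by the Jacobi identity. *)
Lemma lieder_comm k X Y (eta : cochain L E k) : alt k eta ->
  lieder D X (lieder D Y eta) - lieder D Y (lieder D X eta) = lieder D (br X Y) eta.
Proof.
elim: k eta => [|k IH] eta He.
  apply/funext => V; rewrite !lieder_forms0 (nabla_flat HD).
  by rewrite -[LHS]/(lieder D X (lieder D Y eta) V - lieder D Y (lieder D X eta) V)
             !lieder_forms0.
apply: cochainP => Z.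
have c2 X' Y' : contr Z (lieder D X' (lieder D Y' eta)) =
    lieder D X' (lieder D Y' (contr Z eta)) - lieder D X' (contr (br Y' Z) eta)
    - (lieder D Y' (contr (br X' Z) eta) - contr (br Y' (br X' Z)) eta).
  by rewrite !contr_lieder (liederD X' (lieder D Y' (contr Z eta)))
    (liederN X' (contr (br Y' Z) eta)).
transitivity (contr Z (lieder D X (lieder D Y eta)) -
              contr Z (lieder D Y (lieder D X eta))); first by [].
rewrite !c2 contr_lieder -IH; last exact: contr_alternating.
have -> : contr (br (br X Y) Z) eta = contr (br X (br Y Z)) eta - contr (br Y (br X Z)) eta.
  rewrite (jacobi HD); apply/funext => V.
  rewrite -[RHS]/(eta (vcons _ V) - eta (vcons _ V)) /contr alternating_consD//.
  congr (_ + _); rewrite -scaleN1r -[_ *: _]addr0 alternating_consL//.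
  by rewrite alternating_cons0// addr0 scaleN1r.
set p := lieder D X (lieder D Y _); set q := lieder D Y (lieder D X _).
set a := lieder D X (contr _ _); set b := lieder D Y (contr _ _).
set c := contr _ _; set d := contr _ _.
apply/funext => V.
rewrite -[LHS]/(p V - a V - (b V - c V) - (q V - b V - (a V - d V))).
rewrite -[RHS]/(p V - q V - (d V - c V)).
move: (p V) (q V) (a V) (b V) (c V) (d V) => {}p {}q {}a {}b {}c {}d.
rewrite !opprD !opprK !addrA.
by rewrite [LHS](ACl (1*5*8*4*(7*2)*(6*3)))/= !subrr !addr0.
Qed.

Lemma lieder_koszul k X (eta : cochain L E k) : alt k eta ->
  lieder D X (koszul D eta) = koszul D (lieder D X eta).
Proof.
elim: k eta => [|k IH] eta He; apply: cochainP => Y; rewrite contr_lieder.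
  rewrite !contr_koszul1 -(lieder_comm X Y He) opprB addrC subrK.
  by [].
have HY := contr_alternating Y He.
rewrite !contr_koszul//; last exact: lieder_alternating.
rewrite (liederD X (lieder D Y eta)) (liederN X (koszul D (contr Y eta))) IH//.
rewrite contr_lieder (koszulD nablaD (lieder D X (contr Y eta))).
rewrite (koszulN nablaD (contr (br X Y) eta)) -(lieder_comm X Y He).
move: (lieder D X (lieder D Y eta)) (lieder D Y (lieder D X eta)) => p q.
move: (koszul D (lieder D X (contr Y eta))) (koszul D (contr (br X Y) eta)) => r s.
by rewrite !opprD !opprK !addrA [LHS](ACl ((1*3)*4*2*5))/= subrr add0r.
Qed.

(** By Cartan's formula used twice, i_X d d = L_X d - d L_X + d d i_X: the first two terms cancel by
    [lieder_koszul], the last one vanishes by induction. *)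
Lemma koszul_koszul k (eta : cochain L E k) : alt k eta -> koszul D (koszul D eta) = 0.
Proof.
elim: k eta => [|k IH] eta He; apply: cochainP => X;
  rewrite contr_koszul ?lieder_koszul//; try exact: koszul_alternating.
  by rewrite contr_koszul1 subrr.
rewrite contr_koszul// (koszulD nablaD (lieder D X eta)) (koszulN nablaD (koszul D (contr X eta))).
by rewrite IH; [rewrite oppr0 addr0 subrr | exact: contr_alternating].
Qed.

End LieRinehart.

Section KoszulMap.
Variables (A : comPzRingType) (L E E' : lmodType A).
Variables (D : connection L E) (D' : connection L E') (f : E -> E').
Hypothesis br_eq : bracket D = bracket D'.
Hypothesis fL : forall a e e', f (a *: e + e') = a *: f e + f e'.
Hypothesis f_nabla : forall x e, f (nabla D x e) = nabla D' x (f e).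

Lemma koszul_map k (eta : cochain L E k) :
  koszul D' (fun V => f (eta V)) = fun V => f (koszul D eta V).
Proof.
have fD e e' : f (e + e') = f e + f e' by have := fL 1 e e'; rewrite !scale1r.
have f0 : f 0 = 0.
  have := fD 0 0; rewrite addr0 => /eqP.
  by rewrite -subr_eq0 opprD addrA subrr sub0r oppr_eq0 => /eqP.
have fZ a e : f (a *: e) = a *: f e by have := fL a e 0; rewrite f0 !addr0.
apply/funext => V; rewrite /koszul fD !(big_morph f fD f0); congr (_ + _).
  by apply: eq_bigr => i _; rewrite fZ f_nabla.
apply: eq_bigr => i _; rewrite (big_morph f fD f0); apply: eq_bigr => j _.
by rewrite fZ br_eq.
Qed.

Lemma alternating_map k (eta : cochain L E k) :
  alternating_forms k eta -> alternating_forms k (fun V => f (eta V)).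
Proof.
have f0 : f 0 = 0.
  have := fL 1 0 0; rewrite !scale1r addr0 => /eqP.
  by rewrite -subr_eq0 opprD addrA subrr sub0r oppr_eq0 => /eqP.
move=> [lin alt]; split=> [i V a x y|V i j ij Vij]; first by rewrite lin fL.
by rewrite (alt _ i j).
Qed.

End KoszulMap.

(** * Calculus in several real variables *)

Lemma is_derive_mulr (R : realType) (c a : R) :
  is_derive c (1 : R) (fun t : R => t * a) a.
Proof.
have -> : (fun t : R => t * a) = (a \*: (@id R)).
  by apply/funext => t; rewrite /GRing.scale_fun /= mulrC.
by apply: is_derive_eq; rewrite [LHS]mulr1.
Qed.

Section PartialDerivatives.
Variables (R : realType) (n : nat).
Implicit Types (f g : 'rV[R]_n -> R) (x y v : 'rV[R]_n).

Lemma derive_lineE f y v (s : R) :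
  (fun h => h^-1 *: (((fun t : R => f (y + t *: v)) \o shift s) (h *: 1) - f (y + s *: v))) =
  (fun h => h^-1 *: ((f \o shift (y + s *: v)) (h *: v) - f (y + s *: v))).
Proof.
apply/funext => h /=; congr (_ *: (f _ - _)).
by rewrite [h *: 1]mulr1 scalerDl addrCA.
Qed.

Lemma is_derive_line f y v (s : R) : derivable f (y + s *: v) v ->
  is_derive s (1 : R) (fun t : R => f (y + t *: v)) ('D_v f (y + s *: v)).
Proof.
by move=> df; split; rewrite /derivable /derive derive_lineE.
Qed.

Lemma derivable_line f y v (s : R) : derivable (fun t : R => f (y + t *: v)) s 1 ->
  derivable f (y + s *: v) v /\
  'D_v f (y + s *: v) = 'D_1 (fun t : R => f (y + t *: v)) s.
Proof. by rewrite /derivable /derive derive_lineE. Qed.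

Local Notation e_ i := (delta_mx 0 i : 'rV[R]_n).

Lemma norm_delta_mx i : `|e_ i| <= 1.
Proof.
rewrite /Num.norm/= mx_normrE; apply: bigmax_le => // -[j k] _ /=.
by rewrite mxE; case: (_ && _); rewrite ?normr1 ?normr0.
Qed.

Lemma coord_norm x i : `|x 0 i| <= `|x|.
Proof. by rewrite /Num.norm/= mx_normrE; apply: (le_bigmax _ (fun ij => `|x ij.1 ij.2|) (0, i)). Qed.

Lemma norm_le_coord x (M : R) : 0 <= M -> (forall i, `|x 0 i| <= M) -> `|x| <= M.
Proof. by move=> M0 H; rewrite /Num.norm/= mx_normrE; apply: bigmax_le => // -[j k] _ /=; rewrite ord1. Qed.

(** For k = 0, ..., n these are the corners of a path from 0 to x parallel to the axes, along which
    increments telescope. *)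
Definition trunc_rV (k : nat) (x : 'rV[R]_n) : 'rV[R]_n := \row_i (if (i < k)%N then x 0 i else 0).

Lemma trunc_rVS x (i : 'I_n) : trunc_rV i.+1 x = trunc_rV i x + x 0 i *: e_ i.
Proof.
apply/rowP => j; rewrite !mxE eqxx /= -val_eqE /= ltnS leq_eqVlt.
by case: ltngtP => //= [_|_|/val_inj ->]; rewrite ?mulr0 ?mulr1 ?addr0 ?add0r.
Qed.

Lemma trunc_rV0 x : trunc_rV 0 x = 0.
Proof. by apply/rowP => j; rewrite !mxE. Qed.

Lemma trunc_rVn x : trunc_rV n x = x.
Proof. by apply/rowP => j; rewrite !mxE ltn_ord. Qed.

Lemma norm_trunc_rV x (i : 'I_n) (c : R) : 0 <= c <= 1 ->
  `|trunc_rV i x + (c * x 0 i) *: e_ i| <= `|x|.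
Proof.
move=> /andP[c0 c1]; apply: norm_le_coord => // j; rewrite !mxE eqxx /=.
have [->|ij] := eqVneq j i.
  rewrite ltnn add0r mulr1 normrM (ger0_norm c0).
  by rewrite (le_trans _ (coord_norm x i))// ler_piMl.
by rewrite mulr0 addr0; case: ifP => _; rewrite ?normr0 ?coord_norm.
Qed.

(* Mean value theorem along each coordinate direction in turn. *)
Lemma C1_increment f x h :
  (forall y i, `|y| <= `|h| -> derivable f (x + y) (e_ i)) ->
  exists xi : 'I_n -> 'rV[R]_n, (forall i, `|xi i| <= `|h|) /\
    f (x + h) - f x = \sum_i h 0 i * 'D_(e_ i) f (x + xi i).
Proof.
move=> df.
have step (i : 'I_n) : exists xi, `|xi| <= `|h| /\
    f (x + trunc_rV i.+1 h) - f (x + trunc_rV i h) = h 0 i * 'D_(e_ i) f (x + xi).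
  pose y := x + trunc_rV i h.
  pose z (c : R) := trunc_rV i h + (c * h 0 i) *: e_ i.
  have zh (c : R) : 0 <= c <= 1 -> `|z c| <= `|h|.
    exact: norm_trunc_rV.
  have dphi (c : R) : 0 <= c <= 1 ->
      is_derive c (1 : R) (fun t : R => f (y + (t * h 0 i) *: e_ i)) (h 0 i * 'D_(e_ i) f (x + z c)).
    move=> c01; rewrite /z addrA -/y.
    have := @is_derive_line f y (e_ i) (c * h 0 i).
    rewrite -addrA => /(_ (df _ _ (zh _ c01))).
    rewrite addrA => H.
    have -> : (fun t : R => f (y + (t * h 0 i) *: e_ i)) =
      (fun t : R => f (y + t *: e_ i)) \o (fun t : R => t * h 0 i) by [].
    have := @is_derive1_comp _ (fun t : R => f (y + t *: e_ i)) (fun t : R => t * h 0 i) c _ (h 0 i) H.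
    rewrite mulrC; apply.
    exact: is_derive_mulr.
  have in01 (c : R) : c \in `]0, 1[ -> 0 <= c <= 1.
    by rewrite in_itv /= => /andP[c0 c1]; rewrite !ltW.
  have [||c c01 E] := @MVT_segment R (fun t : R => f (y + (t * h 0 i) *: e_ i))
    (fun c => h 0 i * 'D_(e_ i) f (x + z c)) 0 1 ler01.
  - by move=> c /in01; exact: dphi.
  - apply: derivable_within_continuous => c; rewrite in_itv /= => c01.
    by have [] := dphi c c01.
  rewrite in_itv /= in c01.
  exists (z c); split; first exact: zh.
  rewrite trunc_rVS addrA -/y; move: E.
  by rewrite mul1r mul0r scale0r addr0 subr0 mulr1.
have [xi Hxi] := choice step.
exists xi; split=> [i|]; first by have [] := Hxi i.
transitivity (\sum_(i < n) (f (x + trunc_rV i.+1 h) - f (x + trunc_rV i h))).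
  rewrite -(big_mkord xpredT (fun i => f (x + trunc_rV i.+1 h) - f (x + trunc_rV i h))).
  by rewrite telescope_sumr// trunc_rV0 trunc_rVn addr0.
by apply: eq_bigr => i _; have [] := Hxi i.
Qed.

Lemma C1_differentiable f x :
  (\forall y \near x, forall i, derivable f y (e_ i)) ->
  (forall i, {for x, continuous ('D_(e_ i) f)}) ->
  differentiable f x /\ forall v, 'D_v f x = \sum_i v 0 i * 'D_(e_ i) f x.
Proof.
move=> df cf.
pose l (v : 'rV[R]_n) : R := \sum_i v 0 i * 'D_(e_ i) f x.
have l_lin : linear l.
  move=> a u v; rewrite /l scaler_sumr -big_split; apply: eq_bigr => i _ /=.
  by rewrite !mxE mulrDl -mulrA.
pose lM := GRing.isLinear.Build _ _ _ _ _ l_lin.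
pose lL : {linear 'rV[R]_n -> R} := HB.pack l lM.
have lc : continuous lL.
  have -> : (lL : _ -> _) = \sum_i (fun v : 'rV[R]_n => v 0 i * 'D_(e_ i) f x).
    by apply/funext => v; rewrite fct_sumE.
  apply: (big_ind (fun g : 'rV[R]_n -> R => continuous g)).
  - by move=> v; exact: (@cst_continuous _ _ (0 : R) v).
  - by move=> g h cg ch v; exact: (continuousD (cg v) (ch v)).
  - move=> i _ v; have ci := @coord_continuous R 1 n 0 i v.
    exact: (continuousM ci (@cst_continuous _ _ ('D_(e_ i) f x) v)).
have expand : forall e : R, 0 < e ->
    \forall h \near (0 : 'rV[R]_n), `|f (h + x) - (f x + l h)| <= e * `|h|.
  move=> e e0.
  (* The n partial derivatives contribute at most [e' * |h|] each; dividing by n+1 also covers n =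
     0. *)
  pose e' := e / n.+1%:R.
  have e'0 : 0 < e' by rewrite divr_gt0.
  have near_i : \forall y \near x, forall i, `|'D_(e_ i) f x - 'D_(e_ i) f y| < e'.
    apply: (@filter_forall _ _ (fun i y => `|'D_(e_ i) f x - 'D_(e_ i) f y| < e') (nbhs x)).
    by move=> i; move/cvgrPdist_lt : (cf i) => /(_ _ e'0).
  have : \forall y \near x, (forall i, derivable f y (e_ i)) /\
       (forall i, `|'D_(e_ i) f x - 'D_(e_ i) f y| < e') by near=> y; split; near: y.
  move=> /nbhs_ballP[r /= r0 Hr]; apply/nbhs_ballP; exists r => //= h.
  rewrite -ball_normE /= sub0r normrN => hr.
  have inb y : `|y| <= `|h| -> ball x r (x + y).
    by move=> yh; rewrite -ball_normE /= opprD addrA subrr sub0r normrN (le_lt_trans yh).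
  have [|xi [xih E]] := @C1_increment f x h.
    by move=> y i /inb /Hr[+ _]; apply.
  rewrite /l opprD addrA [h + x]addrC E -sumrB.
  apply: (le_trans (ler_norm_sum _ _ _)).
  apply: (@le_trans _ _ (\sum_(i < n) `|h| * e')).
    apply: ler_sum => i _; rewrite -mulrBr normrM ler_pM//; first exact: coord_norm.
    by have [_ /(_ i)/ltW] := Hr _ (inb _ (xih i)); rewrite distrC.
  rewrite sumr_const card_ord -mulr_natr -mulrA mulrC ler_wpM2r//.
  by rewrite /e' -mulrA ler_piMr ?(ltW e0)// mulrC ler_pdivrMr// mul1r ler_nat.
have E : f \o shift x = (cst (f x) : 'rV[R]_n -> R) + (lL : 'rV[R]_n -> R) +o_ (nbhs (0 : 'rV[R]_n)) id.
  by apply/eqaddoP; exact: expand.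
have dE : 'd f x = lL :> ('rV[R]_n -> R) by exact: diff_unique lc E.
have df' : differentiable f x by apply/diff_locallyP; rewrite dE; split.
by split=> // v; rewrite deriveE// dE.
Unshelve. all: by end_near. Qed.

End PartialDerivatives.

(** Restricted to the line through x in direction v, [tau] becomes a curve whose components are
    derivable in one variable, hence a differentiable curve; the chain rule for differentials
    applies to u along it. *)
Lemma derive_chain (R : realType) n m (u : 'rV[R]_m -> R) (tau : 'rV[R]_n -> 'rV[R]_m) x v :
  differentiable u (tau x) ->
  (forall j, derivable (fun y => tau y 0 j) x v) ->
  derivable (u \o tau) x v /\
  'D_v (u \o tau) x = 'D_(\row_j 'D_v (fun y => tau y 0 j) x) u (tau x).
Proof.
move=> du dtau.
pose k (j : 'I_m) (s : R) := tau (x + s *: v) 0 j.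
have dk j : is_derive (0 : R) (1 : R) (k j) ('D_v (fun y => tau y 0 j) x).
  have := @is_derive_line R n (fun y => tau y 0 j) x v 0.
  by rewrite scale0r addr0; apply.
pose gam (s : R) : 'rV[R]_m := tau (x + s *: v).
have gamE : gam = \sum_j (fun s => k j s *: (delta_mx 0 j : 'rV[R]_m)).
  apply/funext => s; rewrite fct_sumE /gam [LHS]row_sum_delta.
  by [].
have dkj j : differentiable (k j) (0 : R) by apply/derivable1_diffP; have [] := dk j.
have dgam : differentiable gam (0 : R).
  by rewrite gamE; apply: differentiable_sum => j; exact: differentiableZl.
have gam0 : gam 0 = tau x by rewrite /gam scale0r addr0.
have dgamE : 'd gam (0 : R) 1 = \row_j 'D_v (fun y => tau y 0 j) x.
  rewrite -deriveE// gamE derive_sum; last first.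
    by move=> j; apply: diff_derivable; exact: differentiableZl.
  rewrite [RHS]row_sum_delta; apply: eq_bigr => j _.
  rewrite deriveE ?diffZl//; last exact: differentiableZl.
  by rewrite -deriveE// mxE; have [_ ->] := dk j.
have dug : differentiable (u \o gam) (0 : R).
  by apply: differentiable_comp => //; rewrite gam0.
have := @derivable_line R n (u \o tau) x v 0.
rewrite scale0r addr0 => /(_ (diff_derivable dug)) [H1 H2]; split=> //.
rewrite H2; transitivity ('D_1 (u \o gam) (0 : R)); first by [].
rewrite deriveE// diff_comp//=; last by rewrite gam0.
by rewrite -deriveE gam0// -dgamE.
Qed.

Section ClassC.
Variables (R : realType) (n : nat).
Implicit Types (U : set 'rV[R]_n) (f g : 'rV[R]_n -> R) (k : nat).
Local Notation e_ i := (delta_mx 0 i : 'rV[R]_n).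

Lemma class_C_sub k U W f : U `<=` W -> class_C k W f -> class_C k U f.
Proof.
move=> UW; elim: k f => [|k IH] f /= [cf Hf].
  by split=> // x /UW; exact: cf.
split=> [x /UW|i]; first exact: cf.
by have [df Cf] := Hf i; split=> [x /UW|]; [exact: df | exact: IH].
Qed.

Lemma class_C_local k U f :
  (forall x, U x -> exists W, [/\ open W, W x & class_C k W f]) -> class_C k U f.
Proof.
elim: k f => [|k IH] f H /=.
  by split=> // x /H[W [_ Wx [cf _]]]; exact: cf.
split=> [x /H[W [_ Wx [cf _]]]|i]; first exact: cf.
split=> [x /H[W [_ Wx [_ /(_ i)[df _]]]]|]; first exact: df.
by apply: IH => x /H[W [oW Wx [_ /(_ i)[_ Cf]]]]; exists W.
Qed.

Lemma derive_coord i v x : 'D_v (fun y : 'rV[R]_n => y 0 i : R) x = v 0 i.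
Proof.
have := @derive_val _ _ _ _ _ _ _ (@is_derive_line R n (fun y => y 0 i) x v 0 _).
rewrite scale0r addr0 => <-; last exact/diff_derivable/differentiable_coord.
have -> : (fun t : R => (x + t *: v) 0 i) = cst (x 0 i) + (fun t => t * v 0 i).
  by apply/funext => t; rewrite !mxE.
have H := @is_derive_mulr R 0 (v 0 i).
by rewrite deriveD//; rewrite derive_cst add0r; have [_ ->] := H.
Qed.

Lemma class_C_coord k U i : class_C k U (fun x => x 0 i).
Proof.
have co x : {for x, continuous (fun y : 'rV[R]_n => y 0 i : R)}.
  exact: (@coord_continuous R 1 n 0 i x).
case: k => [|k] /=; split=> // j; split=> [x _|].
  exact/diff_derivable/differentiable_coord.
have -> : 'D_(e_ j) (fun y : 'rV[R]_n => y 0 i : R) = cst ((e_ j) 0 i).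
  by apply/funext => x; exact: derive_coord.
exact: class_C_cst.
Qed.

Lemma class_C_inv k U f : open U -> (forall x, U x -> f x != 0) ->
  class_C k U f -> class_C k U (fun x => (f x)^-1).
Proof.
move=> oU f0; elim: k => [|k IH] Cf; have [cf Hf] := Cf.
  by split=> // x Ux; exact: (cvgV (f0 x Ux) (cf x Ux)).
split=> [x Ux|i]; first exact: (cvgV (f0 x Ux) (cf x Ux)).
have [df Cdf] := Hf i; split=> [x Ux|]; first by apply: derivableV; [exact: f0|exact: df].
pose g := fun x => (f x)^-1.
have Cg : class_C k U g by apply: IH; exact: class_CW.
apply: (@class_C_eq _ _ _ _ (cst (-1) * (g * g) * 'D_(e_ i) f)) => //.
  move=> x Ux; rewrite deriveV; [|exact: f0|exact: df].
  by rewrite /g !fctE mulN1r -expr2 exprVn.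
by do 2 apply: class_CM => //; [exact: class_C_cst|exact: class_CM].
Qed.

Lemma class_C_sum k U (I : finType) (f : I -> 'rV[R]_n -> R) : open U ->
  (forall i, class_C k U (f i)) -> class_C k U (fun x => \sum_i f i x).
Proof.
move=> oU Cf.
have -> : (fun x => \sum_i f i x) = \sum_i f i by apply/funext => x; rewrite fct_sumE.
apply: (big_ind (fun g : 'rV[R]_n -> R => class_C k U g)) => //.
- exact: (@class_C_cst _ _ k U 0).
- by move=> g h; exact: class_CD.
Qed.

Lemma class_C_prod k U (I : finType) (f : I -> 'rV[R]_n -> R) : open U ->
  (forall i, class_C k U (f i)) -> class_C k U (fun x => \prod_i f i x).
Proof.
move=> oU Cf.
have -> : (fun x => \prod_i f i x) = \prod_i f i.
  by apply/funext => x; rewrite (big_morph (fun f => f x) (id1 := 1) (op1 := *%R)).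
apply: (big_ind (fun g : 'rV[R]_n -> R => class_C k U g)) => //.
- exact: (@class_C_cst _ _ k U 1).
- by move=> g h; exact: class_CM.
Qed.

Lemma class_C1_differentiable U f x : open U -> U x -> class_C 1 U f ->
  differentiable f x /\ forall v, 'D_v f x = \sum_i v 0 i * 'D_(e_ i) f x.
Proof.
move=> oU Ux [_ Hf]; apply: C1_differentiable.
  have : nbhs x U by exact: open_nbhs_nbhs.
  by apply: filterS => y Uy i; have [df _] := Hf i; exact: df.
by move=> i; have [_ [cf _]] := Hf i; exact: cf.
Qed.

End ClassC.

(** A partial derivative of [u \o tau] is a sum of products of partials of [tau] with compositions
    in which a partial of u replaces u. The induction therefore varies u and keeps [tau] fixed. *)
Lemma class_C_comp (R : realType) n m k (U : set 'rV[R]_n) (W : set 'rV[R]_m)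
    (u : 'rV[R]_m -> R) (tau : 'rV[R]_n -> 'rV[R]_m) :
  open U -> open W -> (forall x, U x -> W (tau x)) ->
  (forall j, class_C k U (fun x => tau x 0 j)) -> class_C k W u ->
  class_C k U (u \o tau).
Proof.
move=> oU oW UW Ct.
have ct x : U x -> {for x, continuous tau}.
  move=> Ux A /nbhs_ballP[r /= r0 rA].
  have : \forall y \near x, forall j, `|tau x 0 j - tau y 0 j| < r.
    apply: (@filter_forall _ _ (fun j y => `|tau x 0 j - tau y 0 j| < r) (nbhs x)) => j.
    have {}ct : {for x, continuous (fun x => tau x 0 j)}.
      by case: k Ct => [|k] /(_ j)[/(_ x Ux)].
    by move/cvgrPdist_lt : ct => /(_ _ r0).
  by apply: filterS => y Hy; apply: rA; split=> // i j; rewrite ord1; exact: Hy.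
elim: k u Ct => [|k IH] u Ct Cu; have [cu Hu] := Cu.
  by split=> // x Ux; apply: continuous_comp; [exact: ct | exact/cu/UW].
split=> [x Ux|i]; first by apply: continuous_comp; [exact: ct | exact/cu/UW].
have C1 : class_C 1 W u.
  by split=> // j; have [d C] := Hu j; split=> //; case: (k) C => [|?] [].
have dt j x : U x -> derivable (fun y => tau y 0 j) x (delta_mx 0 i).
  by move=> Ux; have [_ /(_ i)[d _]] := Ct j; exact: d.
have D x : U x -> derivable (u \o tau) x (delta_mx 0 i) /\
   'D_(delta_mx 0 i) (u \o tau) x =
   \sum_j 'D_(delta_mx 0 i) (fun y => tau y 0 j) x * 'D_(delta_mx 0 j) u (tau x).
  move=> Ux; have [du duE] := class_C1_differentiable oW (UW x Ux) C1.
  have [d1 d2] := derive_chain du (fun j => dt j x Ux).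
  by split=> //; rewrite d2 duE; apply: eq_bigr => j _; rewrite mxE.
split=> [x /D[]//|].
apply: (@class_C_eq _ _ _ _ (fun x =>
   \sum_j 'D_(delta_mx 0 i) (fun y => tau y 0 j) x * 'D_(delta_mx 0 j) u (tau x))) => //.
  by move=> x /D[_ ->].
apply: class_C_sum => // j; apply: class_CM => //.
  by have [_ /(_ i)[]] := Ct j.
apply: (IH ('D_(delta_mx 0 j) u)); last by have [] := Hu j.
by move=> l; exact: class_CW.
Qed.

(** * Flat functions and smooth steps *)

Section FlatFunction.
Variable R : realType.

(* The powers of [t^-1] make the family closed under differentiation. *)
Definition flat_fun (m : nat) (t : R) : R :=
  if 0 < t then t^-1 ^+ m * expR (- t^-1) else 0.

Lemma flat_fun_le0 m t : t <= 0 -> flat_fun m t = 0.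
Proof. by rewrite /flat_fun ltNge => ->. Qed.

Lemma flat_fun_ge0 m t : 0 <= flat_fun m t.
Proof.
rewrite /flat_fun; case: ifP => // t0.
by rewrite mulr_ge0 ?expR_ge0// exprn_ge0// invr_ge0 ltW.
Qed.

Lemma flat_fun0_gt0 t : 0 < t -> 0 < flat_fun 0 t.
Proof. by move=> t0; rewrite /flat_fun t0 expr0 mul1r expR_gt0. Qed.

(** With k = m+2, raise y <= exp y at y = 1/(k t) to the k-th power: exp(-1/t) <= k^k t^k. After
    division by t^m a factor t^2 is left, which makes the difference quotient at 0 tend to 0. *)
Lemma flat_fun_bound m t : 0 <= flat_fun m t <= (m.+2)%:R ^+ m.+2 * t ^+ 2.
Proof.
rewrite flat_fun_ge0 /=; have [t0|t0] := leP t 0.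
  by rewrite flat_fun_le0// mulr_ge0 ?sqr_ge0// exprn_ge0.
rewrite /flat_fun t0 expRN ler_pdivrMr ?expR_gt0//.
set k := m.+2.
have k0 : 0 < k%:R :> R by rewrite ltr0n.
have : (k%:R^-1 * t^-1) ^+ k <= expR (t^-1).
  have -> : expR t^-1 = expR (k%:R^-1 * t^-1) ^+ k.
    by rewrite -expRM_natl mulrA divff ?mul1r// lt0r_neq0.
  have le1 : k%:R^-1 * t^-1 <= expR (k%:R^-1 * t^-1).
    by apply: le_trans (expR_ge1Dx _); rewrite lerDr.
  by rewrite lerXn2r// ?nnegrE ?expR_ge0 ?mulr_ge0 ?invr_ge0 ?ltW.
rewrite exprMn => H.
apply: (@le_trans _ _ (k%:R ^+ k * t ^+ 2 * (k%:R^-1 ^+ k * t^-1 ^+ k))); last first.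
  by rewrite ler_pM2l// mulr_gt0// ?exprn_gt0.
rewrite mulrACA -exprMn divff ?lt0r_neq0// expr1n mul1r /k.
rewrite -(addn2 m) exprD mulrC -mulrA -exprMn mulVf ?lt0r_neq0//.
by rewrite expr1n mulr1.
Qed.

Lemma is_derive_flat m t :
  is_derive t (1 : R) (flat_fun m) (flat_fun m.+2 t - m%:R * flat_fun m.+1 t).
Proof.
have [t0|t0|->] := ltgtP t 0.
- have N : \forall s \near t, cst 0 s = flat_fun m s.
    have : \forall s \near t, s < 0 by exact: lt_nbhsl.
    by apply: filterS => s s0; rewrite flat_fun_le0// ltW.
  apply: (near_eq_is_derive N).
  by rewrite !flat_fun_le0 ?ltW// mulr0 subr0; exact: is_derive_cst.
- have N : \forall s \near t, (fun s => s^-1 ^+ m * expR (- s^-1)) s = flat_fun m s.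
    have : \forall s \near t, 0 < s by exact: lt_nbhsr.
    by apply: filterS => s s0; rewrite /flat_fun s0.
  apply: (near_eq_is_derive N).
  have dV : is_derive t (1 : R) (fun s : R => s^-1) (- t^-1 ^+ 2).
    split; first by apply: derivableV; rewrite ?lt0r_neq0.
    by rewrite deriveV ?lt0r_neq0// derive_id [LHS]mulr1 exprVn.
  have dE : is_derive t (1 : R) (expR \o (fun s : R => - s^-1)) (expR (- t^-1) * t^-1 ^+ 2).
    apply: is_derive1_comp; rewrite -[t^-1 ^+ 2]opprK.
    exact: (@is_deriveN _ _ _ (fun s : R => s^-1)).
  have dX : is_derive t (1 : R) (fun s : R => s^-1 ^+ m) (m%:R * t^-1 ^+ m.-1 * (- t^-1 ^+ 2)).
    have -> : (fun s : R => s^-1 ^+ m) = (fun s : R => s^-1) ^+ m.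
      by apply/funext => s; rewrite exprfctE.
    exact: (@is_deriveX R _ (fun s : R => s^-1) m t 1 _ dV).
  have dM := is_deriveM dX dE; apply: (is_derive_eq dM).
  rewrite /flat_fun t0 /=; set E := expR _; set y := t^-1.
  rewrite -![_ *: _]/(_ * _); case: (m) => [|k] /=; first by rewrite !mul0r; ring.
  by rewrite !exprS; ring.
- rewrite !flat_fun_le0// mulr0 subr0.
  have cv : h^-1 *: ((flat_fun m \o shift (0 : R)) (h *: (1 : R)) - flat_fun m 0)
      @[h --> (0 : R)^'] --> (0 : R).
    set C : R := (m.+2)%:R ^+ m.+2.
    have C0 : 0 < C by rewrite exprn_gt0.
    apply/cvgrPdist_le => e e0; near=> h.
    have h0 : h != 0 by near: h; exact: nbhs_dnbhs_neq.
    rewrite sub0r normrN /= addr0 [h *: 1]mulr1 (flat_fun_le0 m (lexx 0)) subr0.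
    rewrite normrM normfV ler_pdivrMl ?normr_gt0//.
    have /andP[p0 pC] := flat_fun_bound m h.
    rewrite ger0_norm// (le_trans pC)// -real_normK ?num_real// expr2 mulrA mulrC.
    rewrite ler_pM2l ?normr_gt0// mulrC -ler_pdivlMr//.
    near: h; apply: nbhs_dnbhs; apply/nbhs_ballP; exists (e / C) => /=.
      by rewrite divr_gt0.
    by move=> h /=; rewrite /ball /= sub0r normrN => /ltW.
  by split; [apply/cvg_ex; exists 0 | exact/cvg_lim].
Unshelve. all: by end_near. Qed.

Lemma flat_fun_continuous m : continuous (flat_fun m).
Proof.
move=> t; apply: differentiable_continuous; apply/derivable1_diffP.
by have [] := is_derive_flat m t.
Qed.

End FlatFunction.

Lemma derive_comp1 (R : realType) n (phi : R -> R) (f : 'rV[R]_n -> R) x v a :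
  is_derive (f x) (1 : R) phi a -> derivable f x v ->
  is_derive x v (phi \o f) (a * 'D_v f x).
Proof.
move=> dphi df; have dl := @is_derive_line R n f x v 0.
rewrite scale0r addr0 in dl; have {}dl := dl df.
have := @is_derive1_comp R phi (fun t : R => f (x + t *: v)) 0 a ('D_v f x).
rewrite scale0r addr0 => /(_ dphi dl) [d1 d2].
have := @derivable_line R n (phi \o f) x v 0.
by rewrite scale0r addr0 => /(_ d1)[H1 H2]; split=> //; rewrite H2 -d2.
Qed.

Section SmoothStep.
Variables (R : realType) (n : nat).
Implicit Types (U : set 'rV[R]_n) (f g : 'rV[R]_n -> R) (k : nat).
Local Notation e_ i := (delta_mx 0 i : 'rV[R]_n).

Lemma class_C_flat k m U f : open U -> class_C k U f -> class_C k U (flat_fun m \o f).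
Proof.
move=> oU; elim: k m => [|k IH] m Cf; have [cf Hf] := Cf.
  by split=> // x Ux; apply: continuous_comp; [exact: cf | exact: flat_fun_continuous].
split=> [x Ux|i].
  by apply: continuous_comp; [exact: cf | exact: flat_fun_continuous].
have [df Cdf] := Hf i.
have D x Ux := derive_comp1 (is_derive_flat m (f x)) (df x Ux).
split=> [x Ux|]; first by have [] := D x Ux.
have Cf' := class_CW Cf.
apply: (@class_C_eq _ _ _ _
  (((flat_fun m.+2 \o f) + cst (- m%:R) * (flat_fun m.+1 \o f)) * 'D_(e_ i) f)) => //.
  by move=> x Ux; have [_ ->] := D x Ux; rewrite !fctE /= mulNr.
apply: class_CM => //; apply: class_CD => //; first exact: IH.
by apply: class_CM => //; [exact: class_C_cst | exact: IH].
Qed.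

(** For c > 0 a transition from 0 on t <= 0 to 1 on t >= c. The denominator is positive because t
    and c - t cannot both be nonpositive. *)
Definition smooth_step (c t : R) : R := flat_fun 0 t / (flat_fun 0 t + flat_fun 0 (c - t)).

Lemma smooth_step_le0 c t : t <= 0 -> smooth_step c t = 0.
Proof. by move=> t0; rewrite /smooth_step flat_fun_le0// mul0r. Qed.

Lemma smooth_step_denom (c t : R) : 0 < c -> 0 < flat_fun 0 t + flat_fun 0 (c - t).
Proof.
move=> c0; have [t0|t0] := leP t 0.
  by rewrite ltr_wpDl ?flat_fun_ge0// flat_fun0_gt0// subr_gt0 (le_lt_trans t0).
by rewrite ltr_wpDr ?flat_fun_ge0// flat_fun0_gt0.
Qed.

Lemma smooth_step_ge c t : 0 < c -> c <= t -> smooth_step c t = 1.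
Proof.
move=> c0 ct; rewrite /smooth_step [X in _ + X]flat_fun_le0 ?subr_le0// addr0 divff//.
by rewrite lt0r_neq0// flat_fun0_gt0// (lt_le_trans c0).
Qed.

Lemma class_C_step k U c f : open U -> 0 < c -> class_C k U f ->
  class_C k U (smooth_step c \o f).
Proof.
move=> oU c0 Cf.
have C1 : class_C k U (flat_fun 0 \o f) by exact: class_C_flat.
have C2 : class_C k U (flat_fun 0 \o (cst c + cst (-1) * f)).
  apply: class_C_flat => //; apply: class_CD => //; first exact: class_C_cst.
  by apply: class_CM => //; exact: class_C_cst.
have E x : (cst c + cst (-1) * f) x = c - f x by rewrite !fctE mulN1r.
apply: (@class_C_eq _ _ _ _ ((flat_fun 0 \o f) *
    (fun x => (((flat_fun 0 \o f) + (flat_fun 0 \o (cst c + cst (-1) * f))) x)^-1))) => //.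
  by move=> x _; rewrite !fctE /= mulN1r.
apply: class_CM => //; apply: class_C_inv => // [x _|]; last exact: class_CD.
by rewrite !fctE /= mulN1r lt0r_neq0// smooth_step_denom.
Qed.

End SmoothStep.

(** * Hadamard's lemma *)

Section RadialIntegral.
Variables (R : realType) (n : nat) (r : R).
Implicit Types (f h : 'rV[R]_n -> R) (k m : nat) (x : 'rV[R]_n).
Local Notation e_ i := (delta_mx 0 i : 'rV[R]_n).
Local Notation B := [set x : 'rV[R]_n | `|x| < r].
Local Notation mu := (@lebesgue_measure R).

Lemma radial_ball_open : open B.
Proof.
have -> : B = ball (0 : 'rV[R]_n) r.
  by apply/seteqP; split=> x; rewrite -ball_normE /= sub0r normrN.
exact: ball_open.
Qed.

Lemma radial_ballZ x (t : R) : B x -> 0 <= t <= 1 -> B (t *: x).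
Proof.
move=> /= xr /andP[t0 t1]; rewrite normrZ ger0_norm//.
by rewrite (le_lt_trans _ xr)// ler_piMl.
Qed.

(** Differentiating h(t x) in x produces a factor t; the weight t^m absorbs it, so the family is
    stable under partial derivatives. Hadamard's lemma itself uses m = 0. *)
Definition radial_int m h x : R := \int[mu]_(t in `[0, 1]) (t ^+ m * h (t *: x)).

Definition cont_on h := forall x, B x -> {for x, continuous h}.

Lemma ray_continuous h x (t : R) : cont_on h -> B x -> 0 <= t <= 1 ->
  {for t, continuous (fun t : R => h (t *: x))}.
Proof.
move=> ch Bx t01; apply: continuous_comp; first exact: scalel_continuous.
exact/ch/radial_ballZ.
Qed.

Lemma radial_continuous m h x (t : R) : cont_on h -> B x -> 0 <= t <= 1 ->
  {for t, continuous (fun t : R => t ^+ m * h (t *: x))}.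
Proof.
move=> ch Bx t01.
have c1 : {for t, continuous (fun t : R => t ^+ m)} by exact: exprn_continuous.
have c2 : {for t, continuous (fun t : R => h (t *: x))} by exact: ray_continuous.
exact: (continuousM c1 c2).
Qed.

Lemma integrable01 (g : R -> R) : (forall t : R, 0 <= t <= 1 -> {for t, continuous g}) ->
  mu.-integrable `[0, 1] (EFin \o g).
Proof.
move=> cg; apply: continuous_compact_integrable; first exact: segment_compact.
by apply: continuous_in_subspaceT => t; rewrite inE /= in_itv /=; exact: cg.
Qed.

(** The map (t, x) |-> h(t x) is jointly continuous, and compactness of [0, 1] yields one
    neighbourhood of x0 that serves all t. *)
Lemma radial_unif h x0 (e : R) : cont_on h -> B x0 -> 0 < e ->
  \forall x \near x0, forall t : R, 0 <= t <= 1 -> `|h (t *: x0) - h (t *: x)| <= e.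
Proof.
move=> ch Bx0 e0.
have /compact_near_coveringP cov := @segment_compact R 0 1.
have /(cov _ _ (fun x (t : R) => `|h (t *: x0) - h (t *: x)| <= e)) :
    forall t0 : R, `[0, 1]%classic t0 ->
    \forall t \near t0 & x \near x0, `|h (t *: x0) - h (t *: x)| <= e.
  move=> t0; rewrite /= in_itv /= => t01.
  have ch0 : {for t0 *: x0, continuous h} by exact/ch/radial_ballZ.
  have e2 : 0 < e / 2 by rewrite divr_gt0.
  move/cvgrPdist_le : ch0 => /(_ _ e2) near_h.
  have c2 := @scale_continuous R 'rV[R]_n (t0, x0).
  have H1 : \forall t \near t0 & x \near x0, `|h (t0 *: x0) - h (t *: x)| <= e / 2.
    exact: (c2 _ near_h).
  have c1 : {for t0, continuous (fun t : R => t *: x0)} by exact: scalel_continuous.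
  have H2 : \forall t \near t0, `|h (t0 *: x0) - h (t *: x0)| <= e / 2.
    exact: (c1 _ near_h).
  have H2' : \forall t \near t0 & x \near x0, `|h (t0 *: x0) - h (t *: x0)| <= e / 2.
    exact: (@cvg_fst _ _ (nbhs t0) (nbhs x0) _ _ H2).
  apply: filterS2 H1 H2' => -[t x] /= h1 h2.
  rewrite (splitr e) (le_trans (ler_distD (h (t0 *: x0)) _ _))// lerD//.
  by rewrite distrC.
by apply: filterS => x H t t01; apply: H; rewrite /= in_itv.
Qed.

Lemma radial_int_continuous m h x : cont_on h -> B x -> {for x, continuous (radial_int m h)}.
Proof.
move=> ch Bx; apply/(@cvgrPdist_le _ _ _ (nbhs x)) => e e0.
have nB : nbhs x B by apply: open_nbhs_nbhs; split => //; exact: radial_ball_open.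
near=> y.
have By : B y by near: y.
have ix := integrable01 (fun t t01 => @radial_continuous m h x t ch Bx t01).
have iy := integrable01 (fun t t01 => @radial_continuous m h y t ch By t01).
have m01 : measurable (`[0, 1] : set R) by exact: measurable_itv.
rewrite /radial_int -RintegralB//.
have iB : mu.-integrable `[0, 1] (EFin \o (fun t : R => t ^+ m * h (t *: x) - t ^+ m * h (t *: y))).
  apply: integrable01 => t t01.
  exact: (continuousB (radial_continuous ch Bx t01) (radial_continuous ch By t01)).
apply: (le_trans (le_normr_Rintegral _ iB)) => //.
apply: (@le_trans _ _ (\int[mu]_(t in `[0, 1]) e)).
  apply: le_Rintegral => //.
  - apply: integrable01 => t t01; apply: cvg_norm.
    exact: (continuousB (radial_continuous ch Bx t01) (radial_continuous ch By t01)).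
  - by apply: integrable01 => t t01; exact: cvg_cst.
  - move=> t; rewrite /= in_itv /= => /[dup] t01 /andP[t0 t1].
    rewrite -mulrBr normrM ger0_norm ?exprn_ge0//.
    rewrite (@le_trans _ _ (`|h (t *: x) - h (t *: y)|)) ?ler_piMl ?exprn_ile1//.
    by move: t t01 {t0 t1}; near: y; exact: radial_unif.
have mu01 : mu (`[0, 1]%classic : set R) = 1%E.
  by rewrite lebesgue_measure_itv /= lte_fin ltr01 oppr0 adde0.
by rewrite Rintegral_cst// [X in _ * fine X]mu01 mulr1.
Unshelve. all: by end_near. Qed.

Lemma radial_int_derive m h x i : cont_on h -> (forall y, B y -> derivable h y (e_ i)) ->
  cont_on ('D_(e_ i) h) -> B x ->
  derivable (radial_int m h) x (e_ i) /\
  'D_(e_ i) (radial_int m h) x = radial_int m.+1 ('D_(e_ i) h) x.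
Proof.
move=> ch dh cdh Bx.
pose f (s t : R) := t ^+ m * h (t *: (x + s *: e_ i)).
have m01 : measurable (`[0, 1] : set R) by exact: measurable_itv.
have nB : nbhs x B by apply: open_nbhs_nbhs; split => //; exact: radial_ball_open.
have := radial_unif cdh Bx ltr01.
move=> /(filterI nB) /nbhs_ballP[d /= d0 Hd].
have inb (s : R) : `]-d, d[%classic s -> ball x d (x + s *: e_ i).
  rewrite /= in_itv /= -ball_normE /= opprD addrA subrr sub0r normrN normrZ -ltr_norml => sd.
  by rewrite (le_lt_trans _ sd)// ler_piMr// norm_delta_mx.
have Bs s sd := (Hd _ (inb s sd)).1.
have D (s t : R) : `]-d, d[%classic s -> `[0, 1]%classic t ->
    is_derive s (1 : R) (f ^~ t) (t ^+ m.+1 * 'D_(e_ i) h (t *: (x + s *: e_ i))).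
  rewrite [in `[0, 1]%classic t]/= in_itv /= => sd t01.
  have E : (fun s => h (t *: (x + s *: e_ i))) =
           (fun u : R => h (t *: x + u *: e_ i)) \o (fun s : R => s * t).
    by apply/funext => u /=; rewrite scalerDr scalerA mulrC.
  have dl : is_derive s (1 : R) (fun s => h (t *: (x + s *: e_ i))) ('D_(e_ i) h (t *: (x + s *: e_ i)) * t).
    rewrite E; apply: is_derive1_comp; last exact: is_derive_mulr.
    have -> : t *: (x + s *: e_ i) = t *: x + (s * t) *: e_ i.
      by rewrite scalerDr scalerA mulrC.
    apply: is_derive_line.
    rewrite mulrC -scalerA -scalerDr; apply: dh; apply: radial_ballZ => //; exact: Bs.
  have := is_deriveM (is_derive_cst (t ^+ m) s (1 : R)) dl.
  move=> H; apply: (is_derive_eq H).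
  by rewrite scaler0 addr0 /= exprS [LHS]mulrA mulrAC [t * _]mulrC.
have Ia : `]-d, d[%classic (0 : R) by rewrite /= in_itv /= oppr_lt0 d0.
have intf s : `]-d, d[%classic s -> mu.-integrable `[0, 1] (EFin \o f s).
  by move=> sd; apply: integrable01 => t; apply: radial_continuous => //; exact: Bs.
have derf s t : `]-d, d[%classic s -> `[0, 1]%classic t -> derivable (f ^~ t) s 1.
  by move=> sd t01; have [] := D s t sd t01.
(* The dominating function: within the radius d the partial derivative varies by at most 1,
   uniformly in t, which was the tolerance given to [radial_unif]. *)
pose G (t : R) := `|'D_(e_ i) h (t *: x)| + 1.
have G0 t : 0 <= G t by rewrite /G addr_ge0.
have intG : mu.-integrable `[0, 1] (EFin \o G).
  apply: integrable01 => t t01; apply: cvgD; last exact: cvg_cst.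
  by apply: cvg_norm; exact: (ray_continuous cdh Bx t01).
have Gub s t : `]-d, d[%classic s -> `[0, 1]%classic t -> `|partial1of2 f s t| <= G t.
  move=> sd t01; rewrite partial1of2E; have [_ ->] := D s t sd t01.
  move: t01; rewrite /= in_itv /= => /[dup] t01 /andP[t0 t1].
  rewrite normrM ger0_norm ?exprn_ge0//.
  rewrite (@le_trans _ _ (`|'D_(e_ i) h (t *: (x + s *: e_ i))|)) ?ler_piMl ?exprn_ile1//.
  rewrite /G -lerBlDl (le_trans (lerB_dist _ _))// distrC.
  exact: (Hd _ (inb s sd)).2.
have H1 := @derivable_under_integral R _ _ mu f _ m01 0 (- d) d Ia intf derf G G0 intG Gub.
have H2 := @differentiation_under_integral R _ _ mu f _ m01 0 (- d) d Ia intf derf G G0 intG Gub.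
have := @derivable_line R n (radial_int m h) x (e_ i) 0.
rewrite scale0r addr0 => /(_ H1)[d1 d2]; split=> //.
rewrite d2 -derive1E H2; apply: eq_Rintegral => t; rewrite inE => t01.
rewrite partial1of2E; have [_ ->] := D 0 t Ia t01.
by rewrite scale0r addr0.
Qed.

Lemma class_C_radial k m h : class_C k B h -> class_C k B (radial_int m h).
Proof.
elim: k m h => [|k IH] m h [ch Hh]; (split; first by move=> x Bx;
  exact: radial_int_continuous) => // i.
have [dh Ch] := Hh i.
have cdh : cont_on ('D_(e_ i) h) by case: (k) Ch => [|?] [].
have D x Bx := @radial_int_derive m h x i ch dh cdh Bx.
split=> [x /D[]//|].
apply: (@class_C_eq _ _ _ _ (radial_int m.+1 ('D_(e_ i) h))).
- exact: radial_ball_open.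
- by move=> x /D[_ ->].
- exact: IH.
Qed.

(** Integrate the derivative of t |-> f(t x) over [0, 1], where the chain rule writes it as the sum
    of the x_i (D_i f)(t x). *)
Lemma hadamard_ball f : smooth_on B f -> 0 < r ->
  forall x, B x -> f x = f 0 + \sum_i x 0 i * radial_int 0 ('D_(e_ i) f) x.
Proof.
move=> sf r0 x Bx; have m01 : measurable (`[0, 1] : set R) by exact: measurable_itv.
have [cf Hf] := sf 1.
pose g (t : R) := f (t *: x).
pose dg (t : R) := \sum_i x 0 i * 'D_(e_ i) f (t *: x).
have cdf i : cont_on ('D_(e_ i) f) by have [_ [+ _]] := Hf i.
have ci i (t : R) : 0 <= t <= 1 -> {for t, continuous (fun t : R => x 0 i * 'D_(e_ i) f (t *: x))}.
  move=> t01; have c1 := ray_continuous (cdf i) Bx t01.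
  exact: (continuousM (@cst_continuous _ _ (x 0 i) t) c1).
have ii (s : seq 'I_n) : (forall t : R, 0 <= t <= 1 ->
      {for t, continuous (fun t : R => \sum_(i <- s) x 0 i * 'D_(e_ i) f (t *: x))}) /\
    \int[mu]_(t in `[0, 1]) (\sum_(i <- s) x 0 i * 'D_(e_ i) f (t *: x)) =
    \sum_(i <- s) x 0 i * radial_int 0 ('D_(e_ i) f) x.
  elim: s => [|i s [IH1 IH2]].
    have -> : (fun t : R => \sum_(i <- [::]) x 0 i * 'D_(e_ i) f (t *: x)) = cst 0.
      by apply/funext => t; rewrite big_nil.
    rewrite big_nil Rintegral_cst// mul0r; split=> // t _.
    exact: cst_continuous.
  have -> : (fun t : R => \sum_(i <- i :: s) x 0 i * 'D_(e_ i) f (t *: x)) =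
     (fun t : R => x 0 i * 'D_(e_ i) f (t *: x) + \sum_(i <- s) x 0 i * 'D_(e_ i) f (t *: x)).
    by apply/funext => t; rewrite big_cons.
  split=> [t t01|]; first exact: (continuousD (ci i t t01) (IH1 t t01)).
  have i1 := integrable01 (ci i); have i2 := integrable01 IH1.
  have i3 := integrable01 (fun t t01 => @ray_continuous _ x t (cdf i) Bx t01).
  rewrite RintegralD// IH2 big_cons; congr (_ + _).
  rewrite RintegralZl//; congr (_ * _).
  by apply: eq_Rintegral => t _; rewrite expr0 mul1r.
have [cdg E] := ii (index_enum 'I_n).
have is_dg (t : R) : 0 <= t <= 1 -> is_derive t (1 : R) g (dg t).
  move=> t01; have Btx := radial_ballZ Bx t01.
  have [df dfE] := class_C1_differentiable (radial_ball_open : open B) Btx (sf 1).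
  have := @is_derive_line R n f 0 x t.
  rewrite add0r dfE => /(_ (diff_derivable df)).
  have -> // : (fun t : R => f (0 + t *: x)) = g.
  by apply/funext => u; rewrite add0r.
have cg (t : R) : 0 <= t <= 1 -> {for t, continuous g}.
  move=> /is_dg[d _]; apply: differentiable_continuous.
  exact/derivable1_diffP.
have FTC : (\int[mu]_(t in `[0%R, 1%R]) (dg t)%:E = (g 1)%:E - (g 0)%:E)%E.
  apply: continuous_FTC2 => //.
  - apply: continuous_in_subspaceT => t; rewrite inE /= in_itv /= => t01.
    exact: cdg.
  - split.
    + move=> t; rewrite in_itv /= => /andP[t0 t1].
      by have [] : is_derive t (1 : R) g (dg t) by apply: is_dg; rewrite !ltW.
    + by apply: cvg_at_right_filter; apply: cg; rewrite lexx ler01.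
    + by apply: cvg_at_left_filter; apply: cg; rewrite lexx ler01.
  - move=> t; rewrite in_itv /= => /andP[t0 t1]; rewrite derive1E.
    by have [_ ->] : is_derive t (1 : R) g (dg t) by apply: is_dg; rewrite !ltW.
rewrite -E; have -> : \int[mu]_(t in `[0, 1]) dg t = g 1 - g 0.
  by rewrite /Rintegral FTC.
by rewrite /g scale1r scale0r addrC subrK.
Qed.

Lemma radial_int_0 h : radial_int 0 h 0 = h 0.
Proof.
have mu01 : mu (`[0, 1]%classic : set R) = 1%E.
  by rewrite lebesgue_measure_itv /= lte_fin ltr01 oppr0 adde0.
have m01 : measurable (`[0, 1] : set R) by exact: measurable_itv.
rewrite /radial_int; transitivity (\int[mu]_(t in `[0, 1]) h 0).
  by apply: eq_Rintegral => t _; rewrite expr0 mul1r scaler0.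
by rewrite Rintegral_cst// [X in _ * fine X]mu01 mulr1.
Qed.

End RadialIntegral.

Lemma hadamard (R : realType) n (p : 'rV[R]_n) (r : R) (f : 'rV[R]_n -> R) : 0 < r ->
  smooth_on (ball p r) f ->
  exists g : 'I_n -> 'rV[R]_n -> R,
    [/\ forall i, smooth_on (ball p r) (g i),
        forall i, g i p = 'D_(delta_mx 0 i) f p &
        forall x, ball p r x -> f x = f p + \sum_i (x 0 i - p 0 i) * g i x].
Proof.
move=> r0 sf; pose B := [set x : 'rV[R]_n | `|x| < r].
have BE x : B (x - p) <-> ball p r x by rewrite -ball_normE /= distrC.
have BE' x : B x <-> ball p r (x + p) by rewrite -BE addrK.
have trans_smooth q k j : class_C k [set: 'rV[R]_n] (fun x => (x + q) 0 j).
  have -> : (fun x : 'rV[R]_n => (x + q) 0 j) = (fun x => x 0 j) + cst (q 0 j).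
    by apply/funext => x; rewrite !mxE.
  by apply: class_CD => //; [exact: openT | exact: class_C_coord | exact: class_C_cst].
have oB : open B by exact: radial_ball_open.
pose F x := f (x + p).
have sF : smooth_on B F.
  move=> k; apply: (@class_C_comp _ _ _ _ _ (ball p r) f (fun x => x + p)) => //.
  - exact: ball_open.
  - by move=> x /BE'.
  - by move=> j; exact: (class_C_sub (@subsetT _ _) (trans_smooth p k j)).
pose g i x := radial_int 0 ('D_(delta_mx 0 i) F) (x - p).
have dF i x : 'D_(delta_mx 0 i) F x = 'D_(delta_mx 0 i) f (x + p).
  rewrite /derive (_ : (fun h : R => h^-1 *: ((F \o shift x) (h *: delta_mx 0 i) - F x)) =
    (fun h : R => h^-1 *: ((f \o shift (x + p)) (h *: delta_mx 0 i) - f (x + p)))) //.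
  by apply/funext => h; rewrite /F /= addrA.
exists g; split.
- move=> i k; apply: (@class_C_comp _ _ _ _ _ B (radial_int 0 _) (fun x => x - p)) => //.
  + exact: ball_open.
  + by move=> x /BE.
  + by move=> j; exact: (class_C_sub (@subsetT _ _) (trans_smooth (- p) k j)).
  + apply: class_C_radial; have [_ /(_ i)[_]] := sF k.+1.
    by [].
- by move=> i; rewrite /g subrr radial_int_0 dF add0r.
- move=> x /BE Bx; have := hadamard_ball sF r0 Bx.
  rewrite /F subrK add0r => ->; congr (_ + _).
  by apply: eq_bigr => i _; rewrite !mxE.
Qed.

(** * Bump functions and local coordinates *)

Section LocalSmoothness.
Variables (R : realType) (n : nat) (M : manifold R n).
Implicit Types (c : chart R n M) (W U : set M) (f g : M -> R).

Lemma chart_img_open c W : open W -> open (cmap c @` (cdom c `&` W)).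
Proof.
move=> oW; have oi := @cimg_open _ _ _ c.
rewrite openE => x [p [cp Wp] <-]; rewrite /interior.
have ix : (cmap c @` cdom c) (cmap c p) by exists p.
have nW : nbhs (cmap c p) (cinv c @^-1` W).
  apply: (cinv_continuous ix); rewrite cmapK//; exact: open_nbhs_nbhs.
have nI : nbhs (cmap c p) (cmap c @` cdom c) by exact: open_nbhs_nbhs.
apply: filterS2 nW nI => y Wy [q cq qy]; exists q => //; split=> //.
by move: Wy; rewrite /preimage /= -qy cmapK.
Qed.

Lemma chart_preimg_open c (V : set 'rV[R]_n) : open V -> open (cdom c `&` cmap c @^-1` V).
Proof.
move=> oV; rewrite openE => p [cp Vp]; rewrite /interior.
have n1 : nbhs p (cdom c) by apply: open_nbhs_nbhs; split=> //; exact: cdom_open.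
have n2 : nbhs p (cmap c @^-1` V).
  by apply: (cmap_continuous cp); exact: open_nbhs_nbhs.
exact: filterI.
Qed.

Definition smooth_near W f := forall c, atlas c ->
  smooth_on (cmap c @` (cdom c `&` W)) (f \o cinv c).

Lemma smooth_nearP f : f \in smooth <->
  (forall p, exists W, [/\ open W, W p & smooth_near W f]).
Proof.
split=> [/asboolP sf p|H].
  exists setT; split=> //; first exact: openT.
  by move=> c Ac; rewrite setIT; exact: sf.
apply/asboolP => c Ac k; apply: class_C_local => _ [p cp <-].
have [W [oW Wp sW]] := H p.
exists (cmap c @` (cdom c `&` W)); split; first exact: chart_img_open.
  by exists p.
exact: sW.
Qed.

Lemma smooth_smooth_near W f : f \in smooth -> smooth_near W f.
Proof.
move=> /asboolP sf c Ac k; apply: class_C_sub (sf c Ac k).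
by move=> _ [p [cp Up] <-]; exists p.
Qed.

Lemma smooth_near_eq W f g : open W -> (forall p, W p -> f p = g p) ->
  smooth_near W f -> smooth_near W g.
Proof.
move=> oW fg sf c Ac k; apply: class_C_eq (sf c Ac k); first exact: chart_img_open.
by move=> _ [p [cp Up] <-] /=; rewrite cmapK//; exact: fg.
Qed.

Lemma smooth_nearM W f g : open W -> smooth_near W f -> smooth_near W g ->
  smooth_near W (f * g).
Proof.
move=> oW sf sg c Ac k; apply: class_CM (sf c Ac k) (sg c Ac k).
exact: chart_img_open.
Qed.

Lemma smooth_nearV W f : open W -> (forall p, W p -> f p != 0) ->
  smooth_near W f -> smooth_near W (fun p => (f p)^-1).
Proof.
move=> oW f0 sf c Ac k; apply: class_C_inv (sf c Ac k); first exact: chart_img_open.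
by move=> _ [p [cp Up] <-] /=; rewrite cmapK//; exact: f0.
Qed.

Lemma smooth_near_cst W (a : R) : smooth_near W (cst a).
Proof. by move=> c Ac k; exact: class_C_cst. Qed.

Lemma smooth_near_chart c (V : set 'rV[R]_n) (u : 'rV[R]_n -> R) :
  atlas c -> open V -> smooth_on V u ->
  smooth_near (cdom c `&` cmap c @^-1` V) (u \o cmap c).
Proof.
move=> Ac oV su c' Ac' k.
have oW := chart_preimg_open c oV.
apply: (@class_C_comp _ _ _ _ _ V u (cmap c \o cinv c')) => //.
- exact: chart_img_open.
- by move=> _ [p [cp [Up Vp]] <-] /=; rewrite cmapK.
- move=> j; apply: class_C_sub (atlas_compatible Ac' Ac j k).
  by move=> _ [p [cp [Up Vp]] <-]; exists p.
Qed.

Definition supported_in (rho : M -> R) U :=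
  exists K : set M, [/\ closed K, K `<=` U & forall p, ~ K p -> rho p = 0].

(** Near points of K both factors are smooth, and on the open complement of K the product is 0. The
    values of f off U are thus immaterial, so a function known only in a chart becomes a global
    one. *)
Lemma smooth_cutoff U rho f : open U -> rho \in smooth -> supported_in rho U ->
  smooth_near U f -> rho * f \in smooth.
Proof.
move=> oU srho [K [cK KU K0]] sf; apply/smooth_nearP => p.
have [Kp|nKp] := pselect (K p).
  exists U; split=> //; first exact: KU.
  apply: smooth_nearM => //; exact: smooth_smooth_near.
exists (~` K); split=> //; first exact: closed_openC.
apply: (@smooth_near_eq _ (cst 0)); first exact: closed_openC.
  by move=> q Kq; rewrite -[RHS]/(rho q * f q) K0// mul0r.
exact: smooth_near_cst.
Qed.

End LocalSmoothness.

Section Bump.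
Variables (R : realType) (n : nat).

(** Balls of the sup norm are boxes, hence a product over coordinates. The threshold is 3/4 a^2 =
    a^2 - (a/2)^2, so the value is 1 up to distance a/2 and 0 beyond distance a. *)
Definition box_bump (a : R) (x0 x : 'rV[R]_n) : R :=
  \prod_(i < n) smooth_step (3 / 4 * a ^+ 2) (a ^+ 2 - (x 0 i - x0 0 i) ^+ 2).

Lemma box_bump_out (a : R) x0 x : 0 < a -> a < `|x0 - x| -> box_bump a x0 x = 0.
Proof.
move=> a0 ax.
have [i ai] : exists i, a < `|x 0 i - x0 0 i|.
  apply/existsP; apply: contraTT ax => /existsPn H; rewrite -leNgt.
  apply: norm_le_coord; first exact: ltW.
  by move=> i; rewrite !mxE distrC leNgt; exact: H.
rewrite /box_bump (bigD1 i)//= smooth_step_le0 ?mul0r// subr_le0.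
by rewrite -(real_normK (num_real (_ - _))) lerXn2r ?nnegrE// ltW.
Qed.

Lemma box_bump_in (a : R) x0 x : 0 < a -> `|x0 - x| <= a / 2 -> box_bump a x0 x = 1.
Proof.
move=> a0 xa; rewrite /box_bump big1// => i _; apply: smooth_step_ge.
  by rewrite mulr_gt0// exprn_gt0.
have : `|x 0 i - x0 0 i| <= a / 2.
  by rewrite distrC; have := le_trans (coord_norm (x0 - x) i) xa; rewrite !mxE.
move=> H; have : (x 0 i - x0 0 i) ^+ 2 <= (a / 2) ^+ 2.
  by rewrite -(real_normK (num_real (_ - _))) lerXn2r ?nnegrE// divr_ge0 ?ltW.
by move=> H2; nra.
Qed.

Lemma class_C_box_bump k (a : R) x0 : 0 < a -> class_C k setT (box_bump a x0).
Proof.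
move=> a0; apply: class_C_prod; first exact: openT.
move=> i; have oT := @openT 'rV[R]_n.
have Cx : class_C k setT (fun x : 'rV[R]_n => x 0 i - x0 0 i).
  apply: (@class_C_eq _ _ _ _ ((fun x => x 0 i) + cst (- x0 0 i))) => //.
  by apply: class_CD => //; [exact: class_C_coord | exact: class_C_cst].
apply: (class_C_step (f := fun x : 'rV[R]_n => a ^+ 2 - (x 0 i - x0 0 i) ^+ 2)) => //.
  by rewrite mulr_gt0// exprn_gt0.
apply: (@class_C_eq _ _ _ _ (cst (a ^+ 2) + cst (-1) *
  ((fun x : 'rV[R]_n => x 0 i - x0 0 i) * (fun x : 'rV[R]_n => x 0 i - x0 0 i)))) => //.
  by move=> x _; rewrite !fctE mulN1r expr2.
apply: class_CD => //; first exact: class_C_cst.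
by apply: class_CM => //; [exact: class_C_cst | exact: class_CM].
Qed.

Variable M : manifold R n.

Lemma bump_exists (p : M) (U : set M) : open U -> U p ->
  exists rho : Cinf M, supported_in rho U /\
    exists W, [/\ open W, W p, W `<=` U & forall q, W q -> rho q = 1].
Proof.
move=> oU Up; have [c Ac cp] := atlas_cover p.
have oV := @chart_img_open _ _ _ c _ oU.
have Vx : (cmap c @` (cdom c `&` U)) (cmap c p) by exists p.
have /nbhs_ballP[e /= e0 eV] : nbhs (cmap c p) (cmap c @` (cdom c `&` U)).
  exact: open_nbhs_nbhs.
set x0 := cmap c p in Vx eV.
pose a := e / 2.
have a0 : 0 < a by rewrite divr_gt0.
pose D := [set x : 'rV[R]_n | `|x0 - x| <= a].
have DV : D `<=` cmap c @` (cdom c `&` U).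
  move=> x Dx; apply: eV; rewrite -ball_normE /=.
  by rewrite (le_lt_trans Dx)// /a ltr_pdivrMr// ltr_pMr// ltr1n.
have cD : compact D.
  apply: bounded_closed_compact.
    exists (`|x0| + a); split; first exact: num_real.
    move=> r hr x Dx; apply: le_trans (ltW hr).
    by rewrite -(subrK x0 x) addrC (le_trans (ler_normD _ _))// lerD2l distrC.
  have -> : D = closed_ball_ (fun x : 'rV[R]_n => `|x|) x0 a by [].
  exact: closed_closed_ball_.
pose K := cinv c @` D.
(* K is compact in the chart; the Hausdorff property makes it closed in all of M, as extension by
   zero requires. *)
have clK : closed K.
  apply: compact_closed; first exact: manifold_hausdorff.
  apply: continuous_compact => //; apply: continuous_in_subspaceT => x /[!inE] /DV [q [cq _] <-].
  by apply: cinv_continuous; exists q.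
have KU : K `<=` U by move=> _ [x /DV [q [cq Uq] <-] <-]; rewrite cmapK.
have Kc : K `<=` cdom c by move=> _ [x /DV [q [cq Uq] <-] <-]; rewrite cmapK.
pose rho (q : M) : R := if pselect (cdom c q) then box_bump a x0 (cmap c q) else 0.
have rho0 q : ~ K q -> rho q = 0.
  rewrite /rho; case: pselect => // cq nK; apply: box_bump_out => //.
  rewrite ltNge; apply/negP => H; apply: nK; exists (cmap c q) => //.
  exact: cmapK.
have srho : rho \in smooth.
  apply/smooth_nearP => q; have [Kq|nKq] := pselect (K q).
    exists (cdom c `&` cmap c @^-1` setT); split.
    - by apply: chart_preimg_open; exact: openT.
    - by split=> //; exact: Kc.
    - apply: smooth_near_eq (smooth_near_chart Ac openT (fun k => class_C_box_bump k x0 a0)).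
        by apply: chart_preimg_open; exact: openT.
      by move=> q' [cq' _]; rewrite /rho; case: pselect.
  exists (~` K); split=> //; first exact: closed_openC.
  apply: (@smooth_near_eq _ _ _ _ (cst 0)); first exact: closed_openC.
    by move=> q' Kq'; rewrite rho0.
  exact: smooth_near_cst.
exists (MkCinf srho); split; first by exists K.
exists (cdom c `&` cmap c @^-1` (ball x0 (a / 2))); split.
- by apply: chart_preimg_open; exact: ball_open.
- by split=> //; rewrite /preimage /=; apply: ballxx; rewrite divr_gt0.
- move=> q [cq]; rewrite /preimage /= -ball_normE /= => H.
  apply: KU; exists (cmap c q); last exact: cmapK.
  rewrite /D /=; apply: le_trans (ltW H) _.
  by rewrite ler_pdivrMr// ler_pMr// ler1n.
- move=> q [cq]; rewrite /preimage /= -ball_normE /= => H.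
  rewrite -[LHS]/(rho q) /rho; case: pselect => // ?.
  by apply: box_bump_in => //; exact: ltW.
Qed.

End Bump.

(** * Tangent vectors as point derivations *)

Section PointDerivations.
Variables (R : realType) (n : nat) (M : manifold R n).
Local Notation A := (Cinf M).
Implicit Types (f g h : A) (p q : M) (U W : set M).

Lemma CinfP f g : (forall q, f q = g q) -> f = g.
Proof. by move=> H; apply: val_inj; apply/funext. Qed.

Lemma Cinf_sumE (I : Type) (s : seq I) (P : pred I) (F : I -> A) q :
  (\sum_(i <- s | P i) F i) q = \sum_(i <- s | P i) F i q.
Proof. exact: (big_morph (fun f : A => f q)). Qed.

Lemma Cinf_continuous f : continuous f.
Proof.
move=> p; have [c Ac cp] := atlas_cover p.
have /asboolP/(_ c Ac 0%N)[cf _] := Cinf_smooth f.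
have ip : (cmap c @` cdom c) (cmap c p) by exists p.
have cc : {for p, continuous ((f \o cinv c) \o cmap c)}.
  by apply: continuous_comp; [exact: cmap_continuous | exact: cf].
have E : \forall q \near p, ((f \o cinv c) \o cmap c) q = f q.
  have : nbhs p (cdom c) by apply: open_nbhs_nbhs; split=> //; exact: cdom_open.
  by apply: filterS => q cq /=; rewrite cmapK.
move: cc; rewrite /prop_for /continuous_at /= cmapK// => cc.
exact: cvg_trans (near_eq_cvg E) cc.
Qed.

Lemma near_openP p (P : set M) : (\forall q \near p, P q) ->
  exists W, [/\ open W, W p & forall q, W q -> P q].
Proof.
move=> pP; exists (interior P); split; [exact: open_interior | exact: pP |].
exact: interior_subset.
Qed.

Lemma open_near p W (P : set M) : open W -> W p -> (forall q, W q -> P q) ->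
  \forall q \near p, P q.
Proof.
move=> oW Wp WP; have : nbhs p W by exact: open_nbhs_nbhs.
by apply: filterS.
Qed.

Lemma Cinf_extend p U (f : M -> R) : open U -> U p -> smooth_near U f ->
  exists F : A, \forall q \near p, F q = f q.
Proof.
move=> oU Up sf; have [rho [srho [W [oW Wp WU rho1]]]] := bump_exists oU Up.
exists (MkCinf (smooth_cutoff oU (Cinf_smooth rho) srho sf)).
apply: open_near oW Wp _ => q Wq.
by rewrite -[LHS]/(rho q * f q) rho1// mul1r.
Qed.

Lemma Cinf_local_inv p h : h p != 0 -> exists u : A, \forall q \near p, u q * h q = 1.
Proof.
move=> hp; have : \forall q \near p, h q != 0.
  exact: (cvgr_neq0 (h p) (@Cinf_continuous h p)).
move=> /near_openP[W [oW Wp h0]].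
have [u Hu] := Cinf_extend oW Wp (smooth_nearV oW h0 (smooth_smooth_near W (Cinf_smooth h))).
exists u; have nW : \forall q \near p, W q by exact: open_near oW Wp _.
by apply: filterS2 Hu nW => q -> Wq; rewrite mulVf// h0.
Qed.

Lemma supported0 (rho : A) U q : supported_in rho U -> ~ U q -> rho q = 0.
Proof. by move=> [K [_ KU K0]] Uq; apply: K0 => /KU. Qed.

Section Tangent.
Variables (p : M) (v : A -> R^o).
Hypothesis vp : tangent p v.

Lemma tangentM f g : v (f * g) = f p * v g + g p * v f.
Proof. by case: vp => _; apply. Qed.

Lemma tangentD f g : v (f + g) = v f + v g.
Proof.
have [L _] := vp; have := L 1 f g.
by have -> : Cinf_cst 1 * f = f; [apply: CinfP => q; exact: mul1r | rewrite mul1r].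
Qed.

Lemma tangent0 : v 0 = 0.
Proof. have := tangentD 0 0; rewrite addr0 => /eqP.
by rewrite -subr_eq0 opprD addrA subrr sub0r oppr_eq0 => /eqP. Qed.

Lemma tangentZ (a : R) f : v (Cinf_cst a * f) = a * v f.
Proof. by have [L _] := vp; have := L a f 0; rewrite !addr0 tangent0 addr0. Qed.

Lemma tangent_cst (a : R) : v (Cinf_cst a) = 0.
Proof.
have v1 : v 1 = 0.
  have := tangentM 1 1; rewrite mul1r -[(1 : A) p]/(1 : R) !mul1r => /eqP.
  by rewrite -subr_eq0 opprD addrA subrr sub0r oppr_eq0 => /eqP.
by rewrite -(mulr1 (Cinf_cst a)) tangentZ v1 mulr0.
Qed.

Lemma tangentN f : v (- f) = - v f.
Proof. by apply/eqP; rewrite -addr_eq0 -tangentD addNr tangent0. Qed.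

Lemma tangent_sum (I : Type) (s : seq I) (P : pred I) (F : I -> A) :
  v (\sum_(i <- s | P i) F i) = \sum_(i <- s | P i) v (F i).
Proof. exact: (big_morph v tangentD tangent0). Qed.

(** A bump function [rho] supported where f = g gives rho (f - g) = 0; the Leibniz rule at p, with
    rho(p) = 1 and (f - g)(p) = 0, leaves v(f - g) = 0. *)
Lemma tangent_local f g : (\forall q \near p, f q = g q) -> v f = v g.
Proof.
move=> /near_openP[U [oU Up fg]].
have [rho [srho [W [oW Wp _ rho1]]]] := bump_exists oU Up.
have h0 : rho * (f - g) = 0.
  apply: CinfP => q; rewrite -[LHS]/(rho q * (f q - g q)).
  have [Uq|nUq] := pselect (U q); first by rewrite fg// subrr mulr0.
  by rewrite (supported0 srho nUq) mul0r.
have := tangentM rho (f - g); rewrite h0 tangent0 rho1// -[(f - g) p]/(f p - g p).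
by rewrite fg// subrr mul0r addr0 mul1r tangentD tangentN => /eqP; rewrite eq_sym subr_eq0 => /eqP.
Qed.

End Tangent.

Lemma tangent_at_pt (X : vfield M) p : tangent p (at_pt X p).
Proof.
split=> [a f g|f g]; rewrite /at_pt; first by rewrite vfieldL.
by rewrite vfieldM.
Qed.

Lemma vfieldP_eq (X Y : vfield M) : (forall p, at_pt X p = at_pt Y p) -> X = Y.
Proof.
move=> H; apply: val_inj; apply/funext => f; apply: CinfP => q.
exact: (congr1 (fun v => v f) (H q)).
Qed.

End PointDerivations.

Section CoordinateFrame.
Variables (R : realType) (n : nat) (M : manifold R n).
Local Notation A := (Cinf M).
Local Notation e_ i := (delta_mx 0 i : 'rV[R]_n).

Variables (c : chart R n M) (rho : A).
Hypotheses (Ac : atlas c) (srho : supported_in rho (cdom c)).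

Lemma cdomE : cdom c = cdom c `&` cmap c @^-1` (cmap c @` cdom c).
Proof. by apply/seteqP; split=> [p cp|p []//]; split=> //; exists p. Qed.

Lemma smooth_partial (f : A) i :
  smooth_near (cdom c) ('D_(e_ i) (f \o cinv c) \o cmap c).
Proof.
rewrite cdomE; apply: smooth_near_chart => //; first exact: cimg_open.
move=> k; have /asboolP/(_ c Ac k.+1)[_ /(_ i)[]] := Cinf_smooth f.
by [].
Qed.

Lemma chart_partial (f : A) i (p : M) : cdom c p -> derivable (f \o cinv c) (cmap c p) (e_ i).
Proof.
move=> cp; have /asboolP/(_ c Ac 1%N)[_ /(_ i)[d _]] := Cinf_smooth f.
by apply: d; exists p.
Qed.

(** The factor [rho] makes the coordinate derivation act on functions on all of M; it is the true
    partial derivative wherever [rho] is 1. *)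
Definition cut_partial i (f : A) : A^o :=
  MkCinf (smooth_cutoff (@cdom_open _ _ _ c) (Cinf_smooth rho) srho (smooth_partial f i)).

Lemma cut_partialE i f q : cut_partial i f q = rho q * 'D_(e_ i) (f \o cinv c) (cmap c q).
Proof. by []. Qed.

Lemma cut_partial_derivation i : cut_partial i \in is_derivation.
Proof.
apply/asboolP; split=> [a f g|f g]; apply: CinfP => q;
  have [cq|ncq] := pselect (cdom c q).
- rewrite cut_partialE.
  rewrite -[RHS]/(a * (rho q * 'D_(e_ i) (f \o cinv c) (cmap c q)) +
    rho q * 'D_(e_ i) (g \o cinv c) (cmap c q)).
  have -> : ((Cinf_cst a * f + g) \o cinv c) = a \*: (f \o cinv c) + (g \o cinv c) by [].
  rewrite deriveD; [|apply: derivableZ|]; try exact: chart_partial.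
  by rewrite deriveZ; [rewrite mulrDr mulrCA|exact: chart_partial].
- rewrite cut_partialE -[RHS]/(a * (rho q * _) + rho q * _).
  by rewrite (supported0 srho ncq) !mul0r mulr0 addr0.
- rewrite cut_partialE.
  rewrite -[RHS]/(f q * (rho q * 'D_(e_ i) (g \o cinv c) (cmap c q)) +
    g q * (rho q * 'D_(e_ i) (f \o cinv c) (cmap c q))).
  have -> : ((f * g) \o cinv c) = (f \o cinv c) * (g \o cinv c) by [].
  rewrite deriveM; try exact: chart_partial.
  rewrite /= cmapK// mulrDr.
  by congr (_ + _); rewrite -[_ *: _]/(_ * _) mulrCA.
- rewrite cut_partialE -[RHS]/(f q * (rho q * _) + g q * (rho q * _)).
  by rewrite (supported0 srho ncq) !mul0r !mulr0 addr0.
Qed.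

Definition cut_field i : vfield M := MkVfield (cut_partial_derivation i).

Lemma smooth_coord i : smooth_near (cdom c) (fun q => cmap c q 0 i).
Proof.
rewrite cdomE; apply: (smooth_near_chart (u := fun x => x 0 i)) => //; first exact: cimg_open.
by move=> k; exact: class_C_coord.
Qed.

Definition cut_coord i : A :=
  MkCinf (smooth_cutoff (@cdom_open _ _ _ c) (Cinf_smooth rho) srho (smooth_coord i)).

Lemma cut_coordE i q : cut_coord i q = rho q * cmap c q 0 i.
Proof. by []. Qed.

Variable W : set M.
Hypotheses (oW : open W) (Wc : W `<=` cdom c) (rho1 : forall q, W q -> rho q = 1).

Lemma cut_field_coord q i j : W q -> cut_field i (cut_coord j) q = (i == j)%:R.
Proof.
move=> Wq; rewrite -[LHS]/(rho q * 'D_(e_ i) (cut_coord j \o cinv c) (cmap c q)) rho1// mul1r.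
have E : \forall x \near cmap c q, cut_coord j (cinv c x) = x 0 j.
  have oV := @chart_img_open _ _ _ c _ oW.
  have : nbhs (cmap c q) (cmap c @` (cdom c `&` W)).
    by apply: open_nbhs_nbhs; split=> //; exists q => //; split=> //; exact: Wc.
  by apply: filterS => _ [q' [cq' Wq'] <-]; rewrite cmapK// cut_coordE rho1// mul1r.
rewrite (near_eq_derive (e_ i) E).
by rewrite derive_coord mxE eqxx /= eq_sym.
Qed.

(* Hadamard's lemma at [q] turns the algebraic derivation [v] into a combination
   of the coordinate fields. *)
Lemma cut_field_span q v (f : A) : W q -> tangent q v ->
  v f = \sum_i v (cut_coord i) * cut_field i f q.
Proof.
move=> Wq vq; set y := cmap c q.
have cq := Wc Wq.
have oV := @chart_img_open _ _ _ c _ oW.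
have /nbhs_ballP[r /= r0 rV] : nbhs y (cmap c @` (cdom c `&` W)).
  by apply: open_nbhs_nbhs; split=> //; exists q.
have sF : smooth_on (ball y r) (f \o cinv c).
  move=> k; have /asboolP/(_ c Ac k) := Cinf_smooth f.
  by apply: class_C_sub => x /rV [q' [cq' _] <-]; exists q'.
have [g [sg g0 gE]] := hadamard r0 sF.
pose U := cdom c `&` cmap c @^-1` (ball y r).
have oU : open U by apply: chart_preimg_open; exact: ball_open.
have Uq : U q by split=> //; exact: ballxx.
have UW : U `<=` W.
  by move=> q' [cq' /rV [q2 [cq2 Wq2] /(congr1 (cinv c))]]; rewrite !cmapK// => <-.
have Hh i := Cinf_extend oU Uq (smooth_near_chart Ac (@ball_open _ _ y r) (sg i)).
have [h {}Hh] := choice Hh.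
have hq i : h i q = 'D_(e_ i) (f \o cinv c) y.
  by have /nbhs_singleton -> := Hh i; rewrite /= g0.
have E : \forall q' \near q, f q' =
    (Cinf_cst (f q) + \sum_i (cut_coord i - Cinf_cst (y 0 i)) * h i) q'.
  have nU : \forall q' \near q, U q' by exact: open_near oU Uq _.
  have nh : \forall q' \near q, forall i, h i q' = (g i \o cmap c) q'.
    exact: (@filter_forall _ _ (fun i q' => h i q' = (g i \o cmap c) q') (nbhs q)).
  apply: filterS2 nU nh => q' Uq' hq'.
  have [cq' by'] := Uq'.
  have := gE _ by'; rewrite /= !cmapK// => ->.
  rewrite -[RHS]/(f q + (\sum_i (cut_coord i - Cinf_cst (y 0 i)) * h i) q'); congr (_ + _).
  rewrite Cinf_sumE; apply: eq_bigr => i _.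
  rewrite -[RHS]/((rho q' * cmap c q' 0 i - y 0 i) * h i q') hq'.
  by rewrite rho1 ?mul1r//; exact: UW.
rewrite (tangent_local vq E) (tangentD vq) (tangent_cst vq) add0r (tangent_sum vq).
apply: eq_bigr => i _; rewrite (tangentM vq).
rewrite -[(cut_coord i - Cinf_cst (y 0 i)) q]/(rho q * y 0 i - y 0 i) rho1// mul1r subrr mul0r add0r.
rewrite (tangentD vq) (tangentN vq) (tangent_cst vq) subr0 mulrC hq; congr (_ * _).
by rewrite -[RHS]/(rho q * 'D_(e_ i) (f \o cinv c) y) rho1// mul1r.
Qed.

End CoordinateFrame.

Lemma coordinate_frame (R : realType) n (M : manifold R n) (p : M) :
  exists (x : 'I_n -> Cinf M) (E : 'I_n -> vfield M), \forall q \near p,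
    (forall v f, tangent q v -> v f = \sum_i v (x i) * E i f q) /\
    (forall i j, E i (x j) q = (i == j)%:R).
Proof.
have [c Ac cp] := atlas_cover p.
have [rho [srho [W [oW Wp WU rho1]]]] := bump_exists (@cdom_open _ _ _ c) cp.
exists (cut_coord Ac srho), (cut_field Ac srho).
apply: (open_near oW Wp) => q Wq; split=> [v f vq|i j].
  exact: (cut_field_span Ac srho oW WU rho1 f Wq vq).
exact: (cut_field_coord Ac srho oW WU rho1).
Qed.

(** * Frames of subbundles *)

(** Fix points with nonzero minor for the last r functions and let one further point s vary. If the
    determinant vanished for every s, its expansion along the column of s would be a linear relation
    whose first coefficient is that minor. Applied with T the smooth functions, this picks functions
    that separate the vectors of a frame. *)
Lemma independent_det (K : fieldType) (T : Type) r (v : 'I_r -> T -> K) :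
  (forall c : 'I_r -> K, (forall t, \sum_i c i * v i t = 0) -> forall i, c i = 0) ->
  exists t : 'I_r -> T, \det (\matrix_(i, k) v i (t k)) != 0.
Proof.
elim: r v => [|r IH] v indep.
  have t : 'I_0 -> T by case.
  by exists t; rewrite det_mx00 oner_eq0.
have [c H|t Ht] := IH (fun i => v (lift ord0 i)).
  move=> i; pose c' j := if unlift ord0 j is Some j' then c j' else 0.
  have := indep c' _ (lift ord0 i); rewrite /c' liftK; apply => s.
  rewrite big_ord_recl unlift_none mul0r add0r -[RHS](H s).
  by apply: eq_bigr => j _; rewrite liftK.
pose tt s (k : 'I_r.+1) := if unlift ord0 k is Some k' then t k' else s.
pose B s := \matrix_(i < r.+1, k < r.+1) v i (tt s k).
have cofE s s' i : cofactor (B s) i ord0 = cofactor (B s') i ord0.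
  congr (_ * \det _); apply/matrixP => a b; rewrite !mxE /tt.
  by rewrite -[ord0]/ord0 liftK.
apply: contrapT => nex.
have det0 s : \det (B s) = 0.
  by apply/eqP; apply: contrapT => /negP H; apply: nex; exists (tt s).
(* Over an empty T every relation holds, contradicting independence. *)
have [[s0]|nT] := pselect (exists s0 : T, True); last first.
  have H s : \sum_i 1 * v i s = 0 by case: nT; exists s.
  by have /eqP := indep (fun=> 1) H ord0; rewrite oner_eq0.
move=> _.
have H s : \sum_i cofactor (B s0) i ord0 * v i s = 0.
  rewrite -[RHS](det0 s) (expand_det_col _ ord0).
  apply: eq_bigr => i _; rewrite mulrC (cofE s0 s).
  by rewrite mxE /tt unlift_none.
have /eqP := indep _ H ord0; rewrite /cofactor mulf_eq0 signr_eq0 /=.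
apply/negP; rewrite (_ : row' _ _ = \matrix_(i, k) v (lift ord0 i) (t k))//.
by apply/matrixP => i k; rewrite !mxE /tt liftK.
Qed.

Section Evaluation.
Variables (R : realType) (n : nat) (M : manifold R n) (q : M).
Definition Cinf_ev (f : Cinf M) : R := f q.
Lemma Cinf_ev_zmod : zmod_morphism Cinf_ev. Proof. by []. Qed.
Lemma Cinf_ev_monoid : monoid_morphism Cinf_ev. Proof. by []. Qed.
HB.instance Definition _ := GRing.isZmodMorphism.Build _ _ Cinf_ev Cinf_ev_zmod.
HB.instance Definition _ := GRing.isMonoidMorphism.Build _ _ Cinf_ev Cinf_ev_monoid.
End Evaluation.

Section Frames.
Variables (R : realType) (n : nat) (M : manifold R n).
Local Notation A := (Cinf M).
Implicit Types (p q : M) (X Y : vfield M).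

Definition independent_at q r (E : 'I_r -> vfield M) :=
  forall c : 'I_r -> R, \sum_i c i *: at_pt (E i) q = 0 -> forall i, c i = 0.

Lemma sum_at_ptE r (c : 'I_r -> R) (E : 'I_r -> vfield M) q f :
  (\sum_i c i *: at_pt (E i) q) f = \sum_i c i * E i f q.
Proof. by rewrite fct_sumE. Qed.

Lemma at_ptL (a : A) X Y q : at_pt (a *: X + Y) q = a q *: at_pt X q + at_pt Y q.
Proof. by []. Qed.

Lemma at_pt_sum (I : Type) (s : seq I) (a : I -> A) (E : I -> vfield M) q :
  at_pt (\sum_(i <- s) a i *: E i) q = \sum_(i <- s) a i q *: at_pt (E i) q.
Proof.
elim: s => [|i s IH]; first by rewrite !big_nil.
by rewrite !big_cons at_ptL IH.
Qed.

(* Cramer's rule. *)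
Lemma frame_coeffs p r (E : 'I_r -> vfield M) : independent_at p E ->
  exists coef : 'I_r -> vfield M -> A, \forall q \near p,
    forall X (d : 'I_r -> R), at_pt X q = \sum_i d i *: at_pt (E i) q ->
    forall i, d i = coef i X q.
Proof.
move=> indep.
have [|f Hf] := @independent_det R A r (fun i => at_pt (E i) p).
  by move=> c Hc; apply: indep; apply/funext => f; rewrite sum_at_ptE; exact: Hc.
pose B : 'M[A]_r := \matrix_(i, k) E i (f k).
have detB q : \det B q = \det (map_mx (Cinf_ev q) B).
  by rewrite det_map_mx.
have [|u Hu] := @Cinf_local_inv R n M p (\det B).
  rewrite detB; rewrite (_ : map_mx _ _ = \matrix_(i, k) E i (f k) p)//.
  by apply/matrixP => i k; rewrite !mxE.
pose xf X : 'rV[A]_r := \row_k X (f k).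
exists (fun i X => u * (xf X *m \adj B) 0 i).
apply: filterS Hu => q uq X d Xd i.
pose dd : 'rV[R]_r := \row_i d i.
have E1 : map_mx (Cinf_ev q) (xf X) = dd *m map_mx (Cinf_ev q) B.
  apply/rowP => k; rewrite !mxE.
  rewrite -[LHS]/(at_pt X q (f k)) Xd sum_at_ptE.
  by apply: eq_bigr => j _; rewrite !mxE.
rewrite -[RHS]/(u q * Cinf_ev q ((xf X *m \adj B) 0 i)).
have -> : Cinf_ev q ((xf X *m \adj B) 0 i) = (map_mx (Cinf_ev q) (xf X *m \adj B)) 0 i.
  by rewrite [RHS]mxE.
rewrite map_mxM E1 map_mx_adj -mulmxA mul_mx_adj mul_mx_scalar !mxE -detB.
by rewrite mulrA uq mul1r.
Qed.

Lemma fiberL (D : subbundle M) q (a : R) v w : D q v -> D q w -> D q (a *: v + w).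
Proof.
have [r frame] := local_frame D.
have [U [X [_ Uq /(_ q Uq)[DX _]]]] := frame q.
move=> /DX[c ->] /DX[d ->]; apply/DX; exists (fun i => a * c i + d i).
rewrite scaler_sumr -big_split; apply: eq_bigr => i _ /=.
by rewrite scalerDl scalerA.
Qed.

Lemma fiber0 (D : subbundle M) q : D q 0.
Proof.
have [r frame] := local_frame D.
have [U [X [_ Uq /(_ q Uq)[DX _]]]] := frame q.
by apply/DX; exists (fun=> 0); rewrite big1// => i _; rewrite scale0r.
Qed.

Lemma fiberZ (D : subbundle M) q (a : R) v : D q v -> D q (a *: v).
Proof. by move=> Dv; have := fiberL a Dv (fiber0 D q); rewrite addr0. Qed.

Lemma fiber_sum (D : subbundle M) q (I : finType) (c : I -> R) (v : I -> A -> R^o) :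
  (forall i, D q (v i)) -> D q (\sum_i c i *: v i).
Proof.
move=> Dv; apply: (big_ind (D q)).
- exact: fiber0.
- by move=> x y Dx Dy; have := fiberL 1 Dx Dy; rewrite scale1r.
- by move=> i _; exact: fiberZ.
Qed.

Lemma sect_at (D : subbundle M) (Y : sect D) q : D q (at_pt Y q).
Proof. by have /asboolP := sectP Y. Qed.

Lemma local_sections (D : subbundle M) p : exists r (E : 'I_r -> sect D),
  \forall q \near p, (forall v, D q v -> exists c : 'I_r -> R, v = \sum_i c i *: at_pt (E i) q) /\
     independent_at q (fun i => E i : vfield M).
Proof.
have [r frame] := local_frame D.
have [U [X [oU Up DX]]] := frame p.
have [rho [srho [W [oW Wp WU rho1]]]] := bump_exists oU Up.
have DE i : rho *: X i \in is_section D.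
  apply/asboolP => q.
  rewrite (_ : at_pt _ q = rho q *: at_pt (X i) q)//.
  have [Uq|nUq] := pselect (U q); last first.
    by rewrite (supported0 srho nUq) scale0r; exact: fiber0.
  apply: fiberZ; apply/(DX q Uq).1; exists (fun j => (j == i)%:R).
  rewrite (bigD1 i)//= eqxx scale1r big1 ?addr0// => j /negPf ->.
  by rewrite scale0r.
exists r, (fun i => MkSect (DE i)); apply: (open_near oW Wp) => q Wq.
have EX i : at_pt (MkSect (DE i)) q = at_pt (X i) q.
  by apply/funext => f; rewrite -[LHS]/(rho q * X i f q) rho1// mul1r.
have [D1 D2] := DX q (WU q Wq); split=> [v /D1 [c ->]|c].
  by exists c; apply: eq_bigr => i _; rewrite EX.
by under eq_bigr do rewrite EX; exact: D2.
Qed.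

Lemma sect_eq (D : subbundle M) (Y Z : sect D) : (forall q, at_pt Y q = at_pt Z q) -> Y = Z.
Proof. by move=> H; apply: val_inj; exact: vfieldP_eq. Qed.

Lemma sect_extend (D : subbundle M) p v : D p v -> exists Y : sect D, at_pt Y p = v.
Proof.
move=> Dv; have [r [E /nbhs_singleton [/(_ v Dv) [c ->] _]]] := local_sections D p.
exists (\sum_i Cinf_cst (c i) *: E i).
have -> : (\sum_i Cinf_cst (c i) *: E i : sect D) = \sum_i Cinf_cst (c i) *: (E i : vfield M) :> vfield M.
  exact: (big_morph (@sect_field _ _ _ D)).
by rewrite at_pt_sum.
Qed.

(** If Y vanishes at p, then so do its smooth coefficients in a local frame. After multiplication by
    a bump function the expansion of Y is an identity of global sections, to which linearity of b
    applies. *)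
Lemma sect_tensorial (D : subbundle M) (b : sect D -> A) :
  (forall (a : A) (Y Z : sect D), b (a *: Y + Z) = a * b Y + b Z) ->
  forall p (Y Z : sect D), at_pt Y p = at_pt Z p -> b Y p = b Z p.
Proof.
move=> bL p.
have bD (Y Z : sect D) : b (Y + Z) = b Y + b Z by have := bL 1 Y Z; rewrite scale1r mul1r.
have b0 : b 0 = 0.
  have := bD 0 0; rewrite addr0 => /eqP.
  by rewrite -subr_eq0 opprD addrA subrr sub0r oppr_eq0 => /eqP.
have bZ a (Y : sect D) : b (a *: Y) = a * b Y by have := bL a Y 0; rewrite !addr0 b0 addr0.
suff H (Y : sect D) : at_pt Y p = 0 -> b Y p = 0.
  move=> Y Z YZ; have := H (- 1 *: Z + Y).
  have -> : at_pt (- 1 *: Z + Y : sect D) p = - 1 *: at_pt Z p + at_pt Y p by [].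
  have -> : b (- 1 *: Z + Y) p = - b Z p + b Y p by rewrite bL mulN1r.
  rewrite YZ scaleN1r addNr => /(_ erefl) /eqP.
  by rewrite addrC subr_eq0 => /eqP.
move=> Yp; have [r [E frame]] := local_sections D p.
have [coef Hcoef] := frame_coeffs (nbhs_singleton frame).2.
have Yc : \forall q \near p, at_pt Y q = \sum_i coef i (Y : vfield M) q *: at_pt (E i) q.
  apply: filterS2 frame Hcoef => q [span _] Hc.
  have [d dE] := span _ (sect_at Y q).
  by rewrite dE; apply: eq_bigr => i _; rewrite -(Hc _ _ dE).
have [U [oU Up UY]] := near_openP Yc.
have [rho [srho [W [oW Wp WU rho1]]]] := bump_exists oU Up.
have EY : rho *: Y = \sum_i (rho * coef i (Y : vfield M)) *: E i.
  apply: sect_eq => q.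
  have -> : (\sum_i (rho * coef i (Y : vfield M)) *: E i : sect D) =
     \sum_i (rho * coef i (Y : vfield M)) *: (E i : vfield M) :> vfield M.
    exact: (big_morph (@sect_field _ _ _ D)).
  rewrite at_pt_sum (_ : at_pt _ q = rho q *: at_pt Y q)//.
  have [Uq|nUq] := pselect (U q).
    by rewrite UY// scaler_sumr; apply: eq_bigr => i _; rewrite scalerA.
  rewrite (supported0 srho nUq) scale0r big1// => i _.
  by rewrite -[(rho * _) q]/(rho q * _) (supported0 srho nUq) mul0r scale0r.
have : b (rho *: Y) p = 0.
  rewrite EY (big_morph b bD b0) Cinf_sumE big1// => i _; rewrite bZ.
  rewrite -[LHS]/(rho p * coef i Y p * b (E i) p) -(nbhs_singleton Hcoef _ (fun=> 0)).
    by rewrite mulr0 mul0r.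
  by rewrite Yp big1// => j _; rewrite scale0r.
by rewrite bZ -[LHS]/(rho p * b Y p) rho1// mul1r.
Qed.

Lemma full_local_frame : exists r : nat, forall p : M,
    exists (U : set M) (X : 'I_r -> vfield M),
      [/\ open U, U p & forall q, U q ->
        (forall v, tangent q v <->
           exists c : 'I_r -> R, v = \sum_(i < r) c i *: at_pt (X i) q) /\
        (forall c : 'I_r -> R, \sum_(i < r) c i *: at_pt (X i) q = 0 ->
           forall i, c i = 0)].
Proof.
exists n => p; have [x [E /near_openP[U [oU Up HU]]]] := coordinate_frame p.
exists U, E; split=> // q Uq; have [span dual] := HU q Uq; split=> [v|c Hc i].
  split=> [vq|[c ->]].
    by exists (fun i => v (x i)); apply/funext => f; rewrite sum_at_ptE span.
  apply: (big_ind (tangent q)).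
  - by split=> [a f g|f g]; rewrite /= ?mulr0 ?addr0.
  - move=> v1 v2 [L1 M1] [L2 M2]; split=> [a f g|f g].
      by rewrite -![(v1 + v2) _]/(v1 _ + v2 _) L1 L2 mulrDr addrACA.
    by rewrite -![(v1 + v2) _]/(v1 _ + v2 _) M1 M2 !mulrDr addrACA.
  - move=> i _; have [L1 M1] := tangent_at_pt (E i) q; split=> [a f g|f g].
      by rewrite -![(c i *: _) _]/(c i * at_pt (E i) q _) L1 mulrDr mulrCA.
    by rewrite -![(c i *: _) _]/(c i * at_pt (E i) q _) M1 mulrDr !(mulrCA (c i)).
have := congr1 (fun v => v (x i)) Hc; rewrite sum_at_ptE.
rewrite (bigD1 i)//= dual eqxx mulr1 big1 ?addr0// => j /negPf ji.
by rewrite dual ji mulr0.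
Qed.

(** With the tangent bundle as a subbundle of itself, the results on sections cover all vector
    fields. *)
Definition full_bundle : subbundle M := Subbundle full_local_frame.

Lemma full_section X : X \in is_section full_bundle.
Proof. by apply/asboolP => p; exact: tangent_at_pt. Qed.

Definition full_sect X : sect full_bundle := MkSect (full_section X).

Lemma vfield_tensorial (b : vfield M -> A) :
  (forall (a : A) Y Z, b (a *: Y + Z) = a * b Y + b Z) ->
  forall p Y Z, at_pt Y p = at_pt Z p -> b Y p = b Z p.
Proof.
move=> bL p Y Z YZ.
pose b' (V : sect full_bundle) : A := b V.
have bL' (a : A) (V W : sect full_bundle) : b' (a *: V + W) = a * b' V + b' W.
  exact: bL.
exact: (sect_tensorial bL' (p := p) (Y := full_sect Y) (Z := full_sect Z) YZ).
Qed.

Lemma tangent_extend p v : tangent p v -> exists X, at_pt X p = v.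
Proof. by move=> vp; have [Y <-] := @sect_extend full_bundle p v vp; exists Y. Qed.

(** Uniqueness replaces a partition of unity: the field takes at q the value of the local solution
    chosen for q, and near p all these values agree with the solution chosen for p, which is
    smooth. *)
Lemma glue_vfield (P : forall q, (A -> R^o) -> Prop) :
  (forall q v w, P q v -> P q w -> v = w) ->
  (forall p, exists X, \forall q \near p, P q (at_pt X q)) ->
  exists X, forall q, P q (at_pt X q).
Proof.
move=> uniq loc; have [X HX] := choice loc.
pose Zf (f : A) (q : M) : R := X q f q.
have sZ f : Zf f \in smooth.
  apply/smooth_nearP => p; have [W [oW Wp HW]] := near_openP (HX p).
  exists W; split=> //; apply: smooth_near_eq (smooth_smooth_near W (Cinf_smooth (X p f))) => // q Wq.
  exact: (congr1 (fun v => v f) (uniq q _ _ (HW q Wq) (nbhs_singleton (HX q)))).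
pose Z (f : A) : A^o := MkCinf (sZ f).
have dZ : Z \in is_derivation.
  apply/asboolP; split=> [a f g|f g]; apply: CinfP => q.
    by rewrite -[LHS]/(X q (Cinf_cst a * f + g) q) vfieldL.
  by rewrite -[LHS]/(X q (f * g) q) vfieldM.
by exists (MkVfield dZ) => q; exact: (nbhs_singleton (HX q)).
Qed.

(** [form_at] evaluates w on some extension of the vectors; tensoriality, one slot after the other,
    exchanges that extension for X and Y. *)
Lemma form_at2 (w : dform M 2) (X Y : vfield M) p : alternating_forms 2 w ->
  form_at w p (pair2 (at_pt X p) (at_pt Y p)) = w (pair2 X Y) p.
Proof.
move=> [lin _]; rewrite /form_at; case: xgetP => [r _ [Z HZ <-]|nex]; last first.
  exfalso; apply: (nex (w (pair2 X Y) p)); exists (pair2 X Y) => // i.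
  by rewrite /pair2; case: (i == 0).
have E (U : 'I_2 -> vfield M) : U = pair2 (U 0) (U 1).
  by apply/funext => i; rewrite /pair2; case: eqP => [->//|/eqP i0]; congr U;
     apply: val_inj; case: i i0 => -[|[|]].
have l0 (a : Cinf M) U V U' : w (pair2 (a *: U + V) U') = a * w (pair2 U U') + w (pair2 V U').
  have := lin 0 (pair2 U U') a U V.
  have u T : upd (pair2 U U') 0 T = pair2 T U' by apply/funext => i; rewrite /upd /pair2; case: eqP.
  by rewrite !u.
have l1 (a : Cinf M) U V U' : w (pair2 U' (a *: U + V)) = a * w (pair2 U' U) + w (pair2 U' V).
  have := lin 1 (pair2 U' U) a U V.
  have u T : upd (pair2 U' U) 1 T = pair2 U' T.
    by apply/funext => i; rewrite /upd /pair2; case: i => -[|[|]].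
  by rewrite !u.
have Z0 : at_pt (Z 0) p = at_pt X p by have := HZ 0.
have Z1 : at_pt (Z 1) p = at_pt Y p by have := HZ 1.
rewrite (E Z).
transitivity (w (pair2 X (Z 1)) p).
  exact: (@vfield_tensorial (fun V => w (pair2 V (Z 1))) (fun a U V => l0 a U V _) p _ _ Z0).
exact: (@vfield_tensorial (fun V => w (pair2 X V)) (fun a U V => l1 a U V _) p _ _ Z1).
Qed.

End Frames.

(** * Two-forms and pullbacks *)

Section TwoForms.
Variables (R : realType) (n : nat) (M : manifold R n).
Local Notation A := (Cinf M).
Variable w : dform M 2.
Hypothesis w_alt : alternating_forms 2 w.
Implicit Types X Y Z : vfield M.

Definition form2 X Y : A := w (pair2 X Y).

Lemma pair2_cons X Y (W : 'I_0 -> vfield M) : vcons X (vcons Y W) = pair2 X Y.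
Proof.
apply/funext => i; case: (unliftP ord0 i) => [j|] ->; last by rewrite vcons0.
by rewrite vconsS (ord1 j) vcons0.
Qed.

Lemma form2L (a : A) X Y Z : form2 (a *: X + Y) Z = a * form2 X Z + form2 Y Z.
Proof.
have V0 : 'I_0 -> vfield M by case.
by rewrite /form2 -!(pair2_cons _ _ V0) alternating_consL.
Qed.

Lemma form2C X Y : form2 X Y = - form2 Y X.
Proof.
have V0 : 'I_0 -> vfield M by case.
by rewrite /form2 -!(pair2_cons _ _ V0) alternating_swap.
Qed.

Lemma form2R (a : A) X Y Z : form2 Z (a *: X + Y) = a * form2 Z X + form2 Z Y.
Proof. by rewrite form2C form2L opprD -mulrN -!form2C. Qed.

Lemma form20 Y : form2 0 Y = 0.
Proof. by have := form2L (-1) 0 0 Y; rewrite scaleN1r addNr mulN1r addNr. Qed.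

Lemma form2_suml (I : Type) (s : seq I) (a : I -> A) (E : I -> vfield M) Y :
  form2 (\sum_(i <- s) a i *: E i) Y = \sum_(i <- s) a i * form2 (E i) Y.
Proof.
elim: s => [|i s IH]; first by rewrite !big_nil form20.
by rewrite !big_cons form2L IH.
Qed.

Lemma form2_sumr (I : Type) (s : seq I) (a : I -> A) (E : I -> vfield M) Y :
  form2 Y (\sum_(i <- s) a i *: E i) = \sum_(i <- s) a i * form2 Y (E i).
Proof.
rewrite form2C form2_suml -sumrN; apply: eq_bigr => i _.
by rewrite -mulrN -form2C.
Qed.

Lemma form2_at X Y X' Y' p : at_pt X p = at_pt X' p -> at_pt Y p = at_pt Y' p ->
  form2 X Y p = form2 X' Y' p.
Proof.
move=> EX EY; transitivity (form2 X' Y p).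
  exact: (@vfield_tensorial _ _ _ (form2^~ Y) (fun a U V => form2L a U V Y) p _ _ EX).
exact: (@vfield_tensorial _ _ _ (form2 X') (fun a U V => form2R a U V X') p _ _ EY).
Qed.

Lemma ext_d2 X Y Z (V : 'I_0 -> vfield M) :
  ext_d w (vcons X (vcons Y (vcons Z V))) =
  X (form2 Y Z) - form2 (lie X Y) Z - form2 Y (lie X Z)
  - Y (form2 X Z) + form2 X (lie Y Z) + Z (form2 X Y).
Proof.
rewrite /ext_d (koszul_cons _ _ _ w_alt) (koszul_cons _ _ _ (contr_alternating X w_alt)).
rewrite koszul_cons1 /lieder !big_ord_recl !big_ord0 /= !addr0.
rewrite !vcons0 !vconsS vcons0 upd_vcons0 upd_vconsS !upd_vcons0 /contr !pair2_cons.
rewrite -![w (pair2 _ _)]/(form2 _ _) !opprD !opprK !addrA.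
by [].
Qed.

(** The sum runs over all ordered pairs, so the coefficients are w(E_i, E_j) with no factor 1/2. It
    is stated for vectors, not fields, in order to apply to vectors pushed forward from a
    submanifold. *)
Lemma form2_local_coords (p : M) : exists (x : 'I_n -> A) (a : 'I_n -> 'I_n -> A),
  (forall i j, a i j = - a j i) /\
  \forall q \near p, forall u v, tangent q u -> tangent q v ->
    form_at w q (pair2 u v) = \sum_i \sum_j a i j q * u (x i) * v (x j).
Proof.
have [x [E HE]] := coordinate_frame p.
exists x, (fun i j => form2 (E i) (E j)); split=> [i j|]; first exact: form2C.
apply: filterS HE => q [span _] u v uq vq.
have EU u' : tangent q u' -> u' = at_pt (\sum_i Cinf_cst (u' (x i)) *: E i) q.
  by move=> u'q; apply/funext => f; rewrite (span _ f u'q) at_pt_sum sum_at_ptE.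
rewrite {1}(EU u uq) {1}(EU v vq) form_at2// -[w _]/(form2 _ _) form2_suml.
apply: etrans (Cinf_sumE _ _ _ _) _.
apply: eq_bigr => i _; rewrite form2_sumr -[LHS]/(u (x i) * (\sum_j Cinf_cst (v (x j)) * form2 (E i) (E j)) q).
rewrite (Cinf_sumE _ _ (fun j => Cinf_cst (v (x j)) * form2 (E i) (E j)) q) mulr_sumr.
apply: eq_bigr => j _.
by rewrite -[LHS]/(u (x i) * (v (x j) * form2 (E i) (E j) q)) ; ring.
Qed.

End TwoForms.

Section ClosedFormula.
Variables (R : realType) (n : nat) (M : manifold R n) (w : dform M 2).
Hypothesis w_alt : alternating_forms 2 w.
Variables (r : nat) (x : 'I_r -> Cinf M) (a : 'I_r -> 'I_r -> Cinf M) (p : M).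
Hypothesis aC : forall i j, a i j = - a j i.
Hypothesis wE : \forall q \near p, forall X Y : vfield M,
  form2 w X Y q = \sum_i \sum_j a i j q * X (x i) q * Y (x j) q.

(** All second derivatives of the x_i drop out, so the value depends on the three vectors at p
    alone. *)
Lemma ext_d2_coords (X Y Z : vfield M) (V : 'I_0 -> vfield M) :
  ext_d w (vcons X (vcons Y (vcons Z V))) p =
  \sum_i \sum_j (X (a i j) p * Y (x i) p * Z (x j) p -
                 Y (a i j) p * X (x i) p * Z (x j) p +
                 Z (a i j) p * X (x i) p * Y (x j) p).
Proof.
have D (X' Y' Z' : vfield M) : X' (form2 w Y' Z') p =
    \sum_i \sum_j (X' (a i j) p * Y' (x i) p * Z' (x j) p +
      a i j p * X' (Y' (x i)) p * Z' (x j) p + a i j p * Y' (x i) p * X' (Z' (x j)) p).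
  have E : \forall q \near p, form2 w Y' Z' q = (\sum_i \sum_j a i j * Y' (x i) * Z' (x j)) q.
    apply: filterS wE => q ->; rewrite Cinf_sumE; apply: eq_bigr => i _.
    by rewrite Cinf_sumE.
  have tp := tangent_at_pt X' p.
  rewrite -[LHS]/(at_pt X' p _) (tangent_local tp E) (tangent_sum tp).
  apply: eq_bigr => i _; rewrite (tangent_sum tp); apply: eq_bigr => j _.
  rewrite !(tangentM tp) -[(a i j * Y' (x i)) p]/(a i j p * Y' (x i) p) /at_pt.
  by ring.
have W1 (X' Y' Z' : vfield M) : form2 w (lie X' Y') Z' p =
    \sum_i \sum_j a i j p * (X' (Y' (x i)) p - Y' (X' (x i)) p) * Z' (x j) p.
  exact: (nbhs_singleton wE).
have W2 (X' Y' Z' : vfield M) : form2 w Z' (lie X' Y') p =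
    \sum_i \sum_j a i j p * Z' (x i) p * (X' (Y' (x j)) p - Y' (X' (x j)) p).
  exact: (nbhs_singleton wE).
rewrite ext_d2//.
rewrite -[LHS]/(X (form2 w Y Z) p - form2 w (lie X Y) Z p - form2 w Y (lie X Z) p
  - Y (form2 w X Z) p + form2 w X (lie Y Z) p + Z (form2 w X Y) p).
rewrite !D W1 !W2 -!sumrB -!big_split /=.
have sym (u v : 'I_r -> R) : \sum_i \sum_j a i j p * (u i * v j + v i * u j) = 0.
  under eq_bigr do under eq_bigr do rewrite mulrDr.
  under eq_bigr do rewrite big_split /=.
  rewrite big_split /= addrC exchange_big -big_split /= big1// => i _.
  rewrite -big_split big1// => j _ /=; rewrite (aC i j) -[(- a j i) p]/(- a j i p).
  by ring.
(* The bracket terms cancel every second derivative except two with Z(X x), which are symmetric in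
   i, j and vanish against the skew coefficients. *)
rewrite -[RHS]addr0 -[X in _ = _ + X](sym (fun i => Y (x i) p) (fun j => Z (X (x j)) p)).
rewrite -big_split.
apply: eq_bigr => i _; rewrite -!sumrB -!big_split /=.
apply: eq_bigr => j _.
by ring.
Qed.

End ClosedFormula.

Section Pullback.
Variables (R : realType) (m n : nat) (M : manifold R m) (C : manifold R n).
Variables (iota : submanifold M C) (w : dform M 2) (wC : dform C 2).
Hypotheses (w_alt : alternating_forms 2 w) (dw0 : ext_d w = 0).
Hypothesis w_pull : is_pullback iota w wC.

Lemma incl_continuous : continuous iota.
Proof. by apply/continuousP => V oV; apply/(incl_topology iota _).2; exists V. Qed.

Lemma pull_funM (f g : Cinf M) : pull_fun iota (f * g) = pull_fun iota f * pull_fun iota g.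
Proof. exact: CinfP. Qed.

Lemma push_tangent p v : tangent p v -> tangent (iota p) (push iota v).
Proof.
move=> [vL vM]; split=> [a f g|f g]; rewrite /push /=.
  by rewrite -vL; congr v; exact: CinfP.
by rewrite pull_funM vM.
Qed.

(* In coordinates of [M], [d w_C] and [d w] are given by one and the same formula
   in the values of the vectors at the point; no vector field of [C] needs to be
   extended to a neighbourhood in [M]. *)
Lemma pullback_closed : ext_d wC = 0.
Proof.
have [wC_alt wCE] := w_pull.
apply/funext => V; apply: CinfP => p.
set X := V ord0; set Y := vtail V ord0; set Z := vtail (vtail V) ord0.
have -> : V = vcons X (vcons Y (vcons Z (vtail (vtail (vtail V))))) by rewrite !vcons_eta.
move: (vtail (vtail (vtail V))) => W.
have [x [a [aC wE]]] := form2_local_coords w_alt (iota p).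
have wCE' : \forall q \near p, forall X Y : vfield C, form2 wC X Y q =
    \sum_i \sum_j pull_fun iota (a i j) q * X (pull_fun iota (x i)) q * Y (pull_fun iota (x j)) q.
  pose P q := forall u v, tangent q u -> tangent q v ->
    form_at w q (pair2 u v) = \sum_i \sum_j a i j q * u (x i) * v (x j).
  have : \forall q \near p, P (iota q) by exact: (@incl_continuous p P wE).
  apply: filterS => q H X' Y'.
  rewrite /form2 wCE.
  have -> : (fun i => push iota (at_pt (pair2 X' Y' i) q)) =
      pair2 (push iota (at_pt X' q)) (push iota (at_pt Y' q)).
    by apply/funext => i; rewrite /pair2; case: ifP.
  by rewrite H//; apply: push_tangent; exact: tangent_at_pt.
rewrite (ext_d2_coords wC_alt _ wCE'); last first.
  by move=> i j; rewrite [in LHS]aC; exact: CinfP.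
have ext (U : vfield C) := tangent_extend (push_tangent (tangent_at_pt U p)).
have [[X' EX] [Y' EY] [Z' EZ]] := And3 (ext X) (ext Y) (ext Z).
have V0 : 'I_0 -> vfield M by case.
have wE' : \forall q \near iota p, forall X Y : vfield M, form2 w X Y q =
    \sum_i \sum_j a i j q * X (x i) q * Y (x j) q.
  apply: filterS wE => q H X2 Y2; rewrite /form2 -form_at2//.
  by rewrite H//; exact: tangent_at_pt.
have := ext_d2_coords w_alt aC wE' X' Y' Z' V0.
rewrite dw0 -[LHS]/(0 : R) => E0; rewrite -[RHS]/(0 : R) [RHS]E0.
have E (U : vfield C) U' f : at_pt U' (iota p) = push iota (at_pt U p) ->
    U (pull_fun iota f) p = U' f (iota p).
  by move=> H; rewrite -[RHS]/(at_pt U' (iota p) f) H.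
apply: eq_bigr => i _; apply: eq_bigr => j _.
by rewrite !(E X X')// !(E Y Y')// !(E Z Z').
Qed.

End Pullback.

(** * The splitting by a complement of the foliation *)

Section Splitting.
Variables (R : realType) (n : nat) (C : manifold R n) (F G : subbundle C).
Hypothesis hFG : complementary F G.
Local Notation A := (Cinf C).

Lemma fiberB (D : subbundle C) q v w : D q v -> D q w -> D q (v - w).
Proof. by move=> Dv Dw; rewrite addrC -scaleN1r; exact: fiberL. Qed.

(** At each point the F-component is unique, so local solutions glue. Near p, local frames of F and
    G together are independent, and Cramer's rule gives smooth coefficients of X in the joint
    frame. *)
Lemma splitting_exists (X : vfield C) : exists (V : sect F) (Y : sect G),
  X = (V : vfield C) + (Y : vfield C).
Proof.
have [||Z HZ] := @glue_vfield R n C (fun q v => F q v /\ G q (at_pt X q - v)).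
- move=> q v w [Fv Gv] [Fw Gw]; apply/eqP; rewrite -subr_eq0; apply/eqP.
  have [_ H] := hFG q; apply: H; first exact: fiberB.
  have -> : v - w = (at_pt X q - w) - (at_pt X q - v) by rewrite opprB [RHS]addrC addrA subrK.
  exact: fiberB.
- move=> p; have [r [E HE]] := local_sections F p.
  have [s [H HH]] := local_sections G p.
  pose K (i : 'I_(r + s)) : vfield C :=
    match fintype.split i with inl j => E j | inr j => H j end.
  have KS q (c : 'I_(r + s) -> R) : \sum_i c i *: at_pt (K i) q =
     \sum_i c (lshift s i) *: at_pt (E i) q + \sum_j c (rshift r j) *: at_pt (H j) q.
    rewrite big_split_ord /=; congr (_ + _); apply: eq_bigr => i _; rewrite /K.
      by case: split_ordP => j /eqP; rewrite ?eq_lshift ?eq_lrshift// => /eqP ->.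
    by case: split_ordP => j /eqP; rewrite ?eq_rshift ?eq_rlshift// => /eqP ->.
  have Kp : independent_at p K.
    move=> c; rewrite KS => /eqP; rewrite addr_eq0 => /eqP Hc.
    have Fs : F p (\sum_i c (lshift s i) *: at_pt (E i) p).
      by apply: fiber_sum => i; exact: sect_at.
    have Gs : G p (\sum_i c (rshift r i) *: at_pt (H i) p).
      by apply: fiber_sum => i; exact: sect_at.
    have Z0 : \sum_i c (lshift s i) *: at_pt (E i) p = 0.
      have [_ inter] := hFG p; apply: inter => //.
      by rewrite Hc -scaleN1r; exact: fiberZ.
    have c1 := (nbhs_singleton HE).2 _ Z0.
    have c2 := (nbhs_singleton HH).2 (fun j => c (rshift r j)).
    move=> i; case: (split_ordP i) => j ->; first exact: c1.
    by apply: c2; apply/eqP; rewrite -oppr_eq0 -Hc Z0.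
  have [coef Hcoef] := frame_coeffs Kp.
  exists (\sum_i coef (lshift s i) X *: (E i : vfield C)).
  apply: filterS3 HE HH Hcoef => q [spanE _] [spanH _] Hc.
  have [a Fa [b Gb Xab]] := (hFG q).1 _ (tangent_at_pt X q).
  have [c cE] := spanE a Fa; have [d dH] := spanH b Gb.
  pose cd (i : 'I_(r + s)) := match fintype.split i with inl j => c j | inr j => d j end.
  have cdl i : cd (lshift s i) = c i.
    by rewrite /cd; case: split_ordP => j /eqP; rewrite ?eq_lshift ?eq_lrshift// => /eqP ->.
  have cdr i : cd (rshift r i) = d i.
    by rewrite /cd; case: split_ordP => j /eqP; rewrite ?eq_rshift ?eq_rlshift// => /eqP ->.
  have Xcd : at_pt X q = \sum_i cd i *: at_pt (K i) q.
    rewrite Xab KS cE dH; congr (_ + _); apply: eq_bigr => i _; first by rewrite cdl.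
    by rewrite cdr.
  have -> : at_pt (\sum_i coef (lshift s i) X *: (E i : vfield C)) q = a.
    rewrite at_pt_sum cE; apply: eq_bigr => i _.
    by rewrite -(Hc X cd Xcd) cdl.
  by split=> //; rewrite Xab addrC addKr.
have FZ : Z \in is_section F by apply/asboolP => q; have [] := HZ q.
have GZ : X - Z \in is_section G by apply/asboolP => q; have [] := HZ q.
exists (MkSect FZ), (MkSect GZ).
by rewrite /= addrC subrK.
Qed.

Lemma splitting_unique (V V' : sect F) (Y Y' : sect G) :
  (V : vfield C) + (Y : vfield C) = (V' : vfield C) + (Y' : vfield C) -> V = V' /\ Y = Y'.
Proof.
move=> E; have VV : V = V'.
  apply: sect_eq => q; apply/eqP; rewrite -subr_eq0; apply/eqP.
  have [_ inter] := hFG q; apply: inter; first by apply: fiberB; exact: sect_at.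
  have -> : at_pt V q - at_pt V' q = at_pt Y' q - at_pt Y q.
    have e : at_pt V q + at_pt Y q = at_pt V' q + at_pt Y' q.
      exact: (congr1 (fun X => at_pt X q) E).
    by rewrite -[at_pt V q](addrK (at_pt Y q)) e addrAC (addrC (at_pt V' q)) addrK.
  by apply: fiberB; exact: sect_at.
split=> //; apply: val_inj; move: E; rewrite VV; exact: addrI.
Qed.

End Splitting.

Section Projections.
Variables (R : realType) (n : nat) (C : manifold R n) (F : foliation C) (G : subbundle C).
Hypothesis hFG : complementary F G.
Local Notation A := (Cinf C).

Lemma pr_decomposes (X : vfield C) : decomposes X (pr_F F G X) (pr_G F G X).
Proof.
have [V [Y E]] := splitting_exists hFG X.
have -> : pr_F F G X = V.
  rewrite /pr_F; case: xgetP => [V' _ [Y' E']|/(_ V)[]]; last by exists Y.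
  by have [] := splitting_unique hFG (V := V') (V' := V) (Y := Y') (Y' := Y) _; rewrite -?E -?E'.
have -> // : pr_G F G X = Y.
rewrite /pr_G; case: xgetP => [Y' _ [V' E']|/(_ Y)[]]; last by exists V.
by have [] := splitting_unique hFG (V := V') (V' := V) (Y := Y') (Y' := Y) _; rewrite -?E -?E'.
Qed.

Lemma prE (X : vfield C) (V : sect F) (Y : sect G) :
  X = (V : vfield C) + (Y : vfield C) -> pr_F F G X = V /\ pr_G F G X = Y.
Proof. by move=> E; apply: (splitting_unique hFG); rewrite -E -pr_decomposes. Qed.

Lemma prL (a : A) X Y :
  pr_F F G (a *: X + Y) = a *: pr_F F G X + pr_F F G Y /\
  pr_G F G (a *: X + Y) = a *: pr_G F G X + pr_G F G Y.
Proof.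
apply: prE; rewrite {1}(pr_decomposes X) {1}(pr_decomposes Y).
by rewrite scalerDr addrACA.
Qed.

Lemma pr_leaf (V : sect F) : pr_F F G V = V /\ pr_G F G V = 0.
Proof. by apply: prE; rewrite /= addr0. Qed.

Lemma pr_compl (Y : sect G) : pr_F F G Y = 0 /\ pr_G F G Y = Y.
Proof. by apply: prE; rewrite /= add0r. Qed.

Lemma ext0_alternating k (a : cochain (sect F) A^o k) :
  alternating_forms k a -> alternating_forms k (ext0 G a).
Proof.
move=> [lin alt]; split=> [i V b x y|V i j ij Vij].
  have u z : (fun j => pr_F F G (upd V i z j)) = upd (fun j => pr_F F G (V j)) i (pr_F F G z).
    by apply/funext => j; rewrite /upd; case: ifP.
  by rewrite /ext0 !u (prL b x y).1 lin.
by rewrite /ext0 (alt _ i j)// Vij.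
Qed.

Lemma ext0_restricts k (a : cochain (sect F) A^o k) : restricts_to (ext0 G a) a.
Proof. by move=> V; rewrite /ext0; congr a; apply/funext => i; exact: (pr_leaf _).1. Qed.

End Projections.

(** * The form omega_C on a complement of its kernel *)

Section Characteristic.
Variables (R : realType) (n : nat) (C : manifold R n) (F : foliation C) (G : subbundle C).
Variable wC : dform C 2.
Hypotheses (w_alt : alternating_forms 2 wC) (dw0 : ext_d wC = 0).
Hypothesis hF : is_characteristic F wC.
Hypothesis hFG : complementary F G.
Local Notation A := (Cinf C).
Local Notation om := (form2 wC).
Local Notation TF := (sect F).
Local Notation GG := (sect G).
Local Notation NF := (normal_mod F).

Lemma form2_leaf (V : TF) X : om V X = 0.
Proof.
apply: CinfP => q; rewrite /form2 -form_at2//.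
by have [_ ->] := (hF q _).1 (sect_at V q); [|exact: tangent_at_pt].
Qed.

Lemma form2_leafr (V : TF) X : om X V = 0.
Proof. by rewrite form2C// form2_leaf oppr0. Qed.

Lemma form2_kernel X q : (forall Y, om X Y q = 0) -> F q (at_pt X q).
Proof.
move=> H; apply/hF; split=> [|u uq]; first exact: tangent_at_pt.
by have [Y <-] := tangent_extend uq; rewrite form_at2//; exact: H.
Qed.

Lemma form2_pr X (Z : GG) : om Z X = om Z (pr_G F G X).
Proof.
rewrite {1}(pr_decomposes hFG X) -(scale1r (pr_F F G X : vfield C)).
by rewrite (form2R w_alt) form2_leafr mulr0 add0r.
Qed.

Lemma form2_kernelG (Y : GG) q : (forall Z : GG, om Y Z q = 0) -> at_pt Y q = 0.
Proof.
move=> H; have [_ inter] := hFG q; apply: inter (sect_at Y q).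
by apply: form2_kernel => X; rewrite form2_pr; exact: H.
Qed.

(** In d omega_C(V, X, Y) = 0 every term with V itself as an entry of omega_C vanishes; what remains
    says that omega_C is invariant along the leaves. *)
Lemma lie_form2 (V : TF) X Y : V (om X Y) = om (lie V X) Y + om X (lie V Y).
Proof.
have V0 : 'I_0 -> vfield C by case.
have := ext_d2 w_alt V X Y V0; rewrite dw0 -[LHS]/(0 : A) !form2_leaf.
have d0 (Z : vfield C) : Z 0 = 0 by have := vfieldM Z 0 0; rewrite !mul0r addr0.
rewrite !d0 subr0 !addr0 => /esym/eqP; rewrite -addrA -opprD subr_eq0 => /eqP.
by [].
Qed.

Lemma dual_sum (b : dual_mod GG) q r (H : 'I_r -> GG) (Z : GG) (d : 'I_r -> R) :
  at_pt Z q = \sum_j d j *: at_pt (H j) q -> b Z q = \sum_j d j * b (H j) q.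
Proof.
move=> Zq.
have b0 : b 0 = 0 by have := dualL b (-1) 0 0; rewrite scaleN1r addNr mulN1r addNr.
have bS (s : seq 'I_r) : b (\sum_(j <- s) Cinf_cst (d j) *: H j) =
    \sum_(j <- s) Cinf_cst (d j) * b (H j).
  by elim: s => [|j s IH]; rewrite ?big_nil// !big_cons dualL IH.
transitivity (b (\sum_j Cinf_cst (d j) *: H j) q).
  apply: (sect_tensorial (dualL b)).
  have -> : (\sum_j Cinf_cst (d j) *: H j : GG) =
      \sum_j Cinf_cst (d j) *: (H j : vfield C) :> vfield C.
    exact: (big_morph (@sect_field _ _ _ G)).
  by rewrite at_pt_sum.
by rewrite bS Cinf_sumE.
Qed.

Lemma form2_dual (Y : GG) : (fun Z : GG => om Y Z) \in @linear_form A GG.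
Proof. by apply/asboolP => a Z Z'; exact: form2R. Qed.

(** On G the form is nondegenerate, its kernel being the complementary F. Hence the Gram matrix of a
    local frame is invertible near p, and the pointwise unique solutions glue. *)
Lemma sharp_G_exists (b : dual_mod GG) : exists Y : GG, forall Z : GG, om Y Z = b Z.
Proof.
have [||X HX] := @glue_vfield R n C (fun q v => G q v /\
    forall Y Z : GG, at_pt Y q = v -> om Y Z q = b Z q).
- move=> q v v' [Gv Hv] [Gv' Hv'].
  have [Y Yv] := sect_extend Gv; have [Y' Yv'] := sect_extend Gv'.
  have : at_pt (- 1 *: Y + Y' : GG) q = 0.
    apply: form2_kernelG => Z; rewrite (form2L w_alt) mulN1r.
    rewrite -[LHS]/(- om Y Z q + om Y' Z q) (Hv _ _ Yv) (Hv' _ _ Yv').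
    by rewrite addNr.
  have -> : at_pt (- 1 *: Y + Y' : GG) q = - 1 *: at_pt Y q + at_pt Y' q by [].
  by rewrite scaleN1r Yv Yv' addrC => /eqP; rewrite subr_eq0 => /eqP.
- move=> p; have [s [H HH]] := local_sections G p.
  pose W : 'M[A]_s := \matrix_(i, j) om (H i) (H j).
  have [|u Hu] := @Cinf_local_inv R n C p (\det W).
    rewrite -[X in X != _]/(Cinf_ev p (\det W)) -det_map_mx.
    (* A null vector of the Gram matrix would be the coefficients of a section pairing to zero with
       all of G at p, against independence of the frame. *)
    apply/det0P => -[c c0 cW].
    pose Y : GG := \sum_i Cinf_cst (c 0 i) *: H i.
    have YE : (Y : vfield C) = \sum_i Cinf_cst (c 0 i) *: (H i : vfield C).
      exact: (big_morph (@sect_field _ _ _ G)).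
    have : at_pt Y p = 0.
      apply: form2_kernelG => Z.
      have [d Zd] := (nbhs_singleton HH).1 _ (sect_at Z p).
      rewrite -[om Y Z]/((MkDual (form2_dual Y)) Z) (dual_sum _ Zd) big1// => j _.
      have /rowP/(_ j) := cW; rewrite !mxE /= YE (form2_suml w_alt) => E.
      rewrite (Cinf_sumE _ _ (fun i => Cinf_cst (c 0 i) * om (H i) (H j)) p).
      have -> : \sum_i (Cinf_cst (c 0 i) * om (H i) (H j)) p = 0.
        by rewrite -[RHS]E; apply: eq_bigr => i _; rewrite !mxE.
      by rewrite mulr0.
    rewrite YE at_pt_sum => /((nbhs_singleton HH).2 (fun i => c 0 i)) c00.
    by move/eqP: c0; apply; apply/rowP => i; rewrite mxE; exact: c00.
  pose bv : 'rV[A]_s := \row_j b (H j).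
  (* The solution of y W = [bv] near p, where u inverts the determinant. *)
  pose y : 'rV[A]_s := u *: (bv *m \adj W).
  pose Y : GG := \sum_i y 0 i *: H i.
  have YE : (Y : vfield C) = \sum_i y 0 i *: (H i : vfield C).
    exact: (big_morph (@sect_field _ _ _ G)).
  exists Y; apply: filterS2 HH Hu => q [span _] uq; split; first exact: sect_at.
  move=> Y' Z Y'q; rewrite (form2_at w_alt Y'q (erefl _)).
  have [d Zd] := span _ (sect_at Z q).
  rewrite -[om Y Z]/((MkDual (form2_dual Y)) Z) (dual_sum (MkDual (form2_dual Y)) Zd).
  rewrite (dual_sum b Zd).
  apply: eq_bigr => j _; congr (_ * _).
  rewrite -[LHS]/(om Y (H j) q) YE (form2_suml w_alt).
  have -> : \sum_i y 0 i * om (H i) (H j) = (y *m W) 0 j.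
    by rewrite [RHS]mxE; apply: eq_bigr => i _; rewrite [W _ _]mxE.
  rewrite /y -scalemxAl -mulmxA mul_adj_mx mul_mx_scalar !mxE.
  by rewrite -[LHS]/(u q * (\det W q * b (H j) q)) mulrA uq mul1r.
have GX : X \in is_section G by apply/asboolP => q; have [] := HX q.
exists (MkSect GX) => Z; apply: CinfP => q.
by have [_ H] := HX q; exact: H.
Qed.

End Characteristic.

Section NormalModule.
Variables (R : realType) (n : nat) (C : manifold R n) (F : foliation C).
Local Notation A := (Cinf C).
Local Notation NF := (normal_mod F).
Local Notation pN := (proj_N F).

Lemma proj_NK (N : NF) : pN (repr_N N) = N.
Proof. exact: lquot_piK. Qed.

Lemma proj_NL (a : A) X Y : pN (a *: X + Y) = a *: pN X + pN Y.
Proof. by rewrite /proj_N lquot_piD lquot_piZ. Qed.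

Lemma proj_N_eq X Y : X - Y \in is_section F <-> pN X = pN Y.
Proof. by split=> /lquot_piP. Qed.

Lemma proj_N0 : pN 0 = 0.
Proof. by have := proj_NL (-1) 0 0; rewrite scaleN1r addNr scaleN1r addNr. Qed.

Lemma proj_N_leaf (V : sect F) : pN V = 0.
Proof. by rewrite -proj_N0; apply/proj_N_eq; rewrite subr0; exact: sectP. Qed.

Lemma dual_NP (b c : dual_mod NF) : (forall X, b (pN X) = c (pN X)) -> b = c.
Proof. by move=> H; apply: val_inj; apply/funext => N; rewrite -(proj_NK N); exact: H. Qed.

End NormalModule.

Section Sharp.
Variables (R : realType) (n : nat) (C : manifold R n) (F : foliation C) (G : subbundle C).
Variable wC : dform C 2.
Hypotheses (w_alt : alternating_forms 2 wC) (dw0 : ext_d wC = 0).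
Hypothesis hF : is_characteristic F wC.
Hypothesis hFG : complementary F G.
Local Notation A := (Cinf C).
Local Notation om := (form2 wC).
Local Notation TF := (sect F).
Local Notation GG := (sect G).
Local Notation NF := (normal_mod F).
Local Notation pN := (proj_N F).

Lemma flat_NE X Y : flat_N wC (pN X) (pN Y) = om X Y.
Proof.
have E Z : exists V : TF, repr_N (pN Z) = (V : vfield C) + Z.
  have FZ : repr_N (pN Z) - Z \in is_section F by apply/proj_N_eq; exact: proj_NK.
  by exists (MkSect FZ); rewrite -[RHS]/(repr_N (pN Z) - Z + Z) subrK.
have [V EV] := E X; have [V' EV'] := E Y.
rewrite /flat_N -[LHS]/(om _ _) EV' EV.
rewrite -(scale1r (V : vfield C)) -(scale1r (V' : vfield C)).
rewrite (form2L w_alt) (form2_leaf w_alt hF) mulr0 add0r.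
by rewrite (form2R w_alt) (form2_leafr w_alt hF) mulr0 add0r.
Qed.

Lemma flat_N_inj (N N' : NF) : (forall X, flat_N wC N (pN X) = flat_N wC N' (pN X)) -> N = N'.
Proof.
rewrite -(proj_NK N) -(proj_NK N'); move: (repr_N N) (repr_N N') => X X' H.
apply/proj_N_eq/asboolP => q; apply: (form2_kernel w_alt hF) => Y.
have := H Y; rewrite !flat_NE => E.
rewrite addrC -scaleN1r (form2L w_alt) E mulN1r addNr.
by [].
Qed.

Lemma proj_pr_G X : pN (pr_G F G X) = pN X.
Proof.
rewrite {2}(pr_decomposes hFG X) -(scale1r (pr_F F G X : vfield C)) proj_NL.
by rewrite proj_N_leaf scaler0 add0r.
Qed.

Lemma proj_N_injG (Y Y' : GG) : pN Y = pN Y' -> Y = Y'.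
Proof.
move=> /proj_N_eq FY; have := @prE _ _ _ _ _ hFG (Y : vfield C) (MkSect FY) Y'.
rewrite /= subrK => /(_ erefl) [_ <-].
by have [_ ->] := pr_compl hFG Y.
Qed.

(** The preimage is found in the complement: b restricts to a functional on sections of G, which
    omega_C represents, and pairing with X only sees its G-component. *)
Lemma sharp_NE (b : dual_mod NF) X : flat_N wC (sharp_N wC b) (pN X) = b (pN X).
Proof.
rewrite /sharp_N; case: xgetP => [N _ <- //|nex]; exfalso.
have lb : (fun Y : GG => b (pN Y)) \in @linear_form A GG.
  by apply/asboolP => a Y Z; rewrite -dualL -proj_NL.
have [Y HY] := sharp_G_exists w_alt hF hFG (MkDual lb).
apply: (nex (pN Y)); apply/funext => N; rewrite -(proj_NK N) flat_NE.
rewrite (form2_pr w_alt hF hFG) -(proj_pr_G (repr_N N)).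
by rewrite (HY (pr_G F G (repr_N N))).
Qed.

Lemma sharp_NL (a : A) (b c : dual_mod NF) :
  sharp_N wC (a *: b + c) = a *: sharp_N wC b + sharp_N wC c.
Proof.
apply: flat_N_inj => X; rewrite sharp_NE.
rewrite -(proj_NK (sharp_N wC b)) -(proj_NK (sharp_N wC c)) -proj_NL flat_NE (form2L w_alt).
by rewrite -!flat_NE !proj_NK !sharp_NE.
Qed.

(** After pairing with a field, both sides are compared by the invariance of omega_C along the
    leaves. *)
Lemma sharp_N_nabla (V : TF) (b : dual_mod NF) :
  sharp_N wC (nabla (dual_bott F) V b) = nabla (bott F) V (sharp_N wC b).
Proof.
apply: flat_N_inj => Y; rewrite sharp_NE.
rewrite -[RHS]/(flat_N wC (bott_nabla V (sharp_N wC b)) (pN Y)).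
set N := sharp_N wC b; rewrite -(proj_NK N) bott_nablaE flat_NE.
rewrite -[LHS]/(V (b (pN Y)) - b (bott_nabla V (pN Y))) bott_nablaE -!sharp_NE -/N.
rewrite -(proj_NK N) !flat_NE (lie_form2 w_alt dw0 hF V (repr_N N) Y).
by rewrite addrK proj_NK.
Qed.

(** The lift to G of the coefficient map in (ii); its properties are checked in the normal module,
    where sections of G embed. *)
Definition neg_sharp (b : dual_mod NF) : GG := pr_G F G (repr_N (- sharp_N wC b)).

Lemma proj_neg_sharp b : pN (neg_sharp b) = - sharp_N wC b.
Proof. by rewrite proj_pr_G proj_NK. Qed.

Lemma neg_sharpL a b c : neg_sharp (a *: b + c) = a *: neg_sharp b + neg_sharp c.
Proof.
apply: proj_N_injG; rewrite proj_neg_sharp sharp_NL.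
rewrite -[_ (a *: neg_sharp b + neg_sharp c)]/(a *: (neg_sharp b : vfield C) + neg_sharp c).
by rewrite proj_NL !proj_neg_sharp opprD scalerN.
Qed.

Lemma bott_nablaD (V : TF) (N N' : NF) : bott_nabla V (N + N') = bott_nabla V N + bott_nabla V N'.
Proof.
have V1 : V 1 = 0.
  have := vfieldM V 1 1; rewrite !mul1r => /eqP.
  by rewrite -subr_eq0 opprD addrA subrr sub0r oppr_eq0 => /eqP.
by have := bott_nablaL V 1 N N'; rewrite V1 scale0r addr0 !scale1r.
Qed.

Lemma bott_nablaN (V : TF) (N : NF) : bott_nabla V (- N) = - bott_nabla V N.
Proof.
have V0 : bott_nabla V (0 : NF) = 0.
  have := bott_nablaD V 0 0; rewrite addr0 => /eqP.
  by rewrite -subr_eq0 opprD addrA subrr sub0r oppr_eq0 => /eqP.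
by apply/eqP; rewrite -addr_eq0 -bott_nablaD addNr V0.
Qed.

Lemma proj_bott_G (V : TF) (Y : GG) : pN (nabla (bott_G F G) V Y) = nabla (bott F) V (pN Y).
Proof.
rewrite -[nabla (bott_G F G) V Y]/(pr_G F G (lie V Y)) proj_pr_G.
by rewrite -[RHS]/(bott_nabla V (pN Y)) bott_nablaE.
Qed.

Lemma neg_sharp_nabla (V : TF) b :
  neg_sharp (nabla (dual_bott F) V b) = nabla (bott_G F G) V (neg_sharp b).
Proof.
apply: proj_N_injG; rewrite proj_neg_sharp proj_bott_G proj_neg_sharp sharp_N_nabla.
by rewrite -[RHS]/(bott_nabla V _) bott_nablaN.
Qed.

Lemma bott_G_nablaD (V : TF) (Y Z : GG) :
  nabla (bott_G F G) V (Y + Z) = nabla (bott_G F G) V Y + nabla (bott_G F G) V Z.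
Proof.
apply: proj_N_injG; rewrite proj_bott_G.
have pD (Y' Z' : GG) : pN (Y' + Z' : GG) = pN Y' + pN Z'.
  by have := proj_NL F 1 (Y' : vfield C) Z'; rewrite !scale1r.
by rewrite pD [RHS]pD !proj_bott_G -bott_nablaD.
Qed.

End Sharp.

(** * Normal parts of forms vanishing on the leaves *)

Section LieRinehartInstances.
Variables (R : realType) (n : nat) (C : manifold R n) (F : foliation C).
Local Notation A := (Cinf C).

Lemma vfield_eqP (X Y : vfield C) : (forall f, X f = Y f) -> X = Y.
Proof. by move=> H; apply: val_inj; apply/funext. Qed.

Lemma vfield1 (X : vfield C) : X 1 = 0.
Proof.
have := vfieldM X 1 1; rewrite !mul1r => /eqP.
by rewrite -subr_eq0 opprD addrA subrr sub0r oppr_eq0 => /eqP.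
Qed.

Lemma lieDl (X Y Z : vfield C) : lie (X + Y) Z = lie X Z + lie Y Z.
Proof.
apply: vfield_eqP => f.
rewrite -[LHS]/(X (Z f) + Y (Z f) - Z (X f + Y f)) vfieldD opprD addrACA.
by [].
Qed.

Lemma lieL (X : vfield C) (a : A) (Y Z : vfield C) :
  lie X (a *: Y + Z) = a *: lie X Y + X a *: Y + lie X Z.
Proof.
apply: vfield_eqP => f.
rewrite -[LHS]/(X (a * Y f + Z f) - (a * Y (X f) + Z (X f))) vfieldD vfieldM.
rewrite -[RHS]/(a * (X (Y f) - Y (X f)) + X a * Y f + (X (Z f) - Z (X f))).
by rewrite mulrBr opprD addrACA; congr (_ + _); rewrite addrAC (mulrC (Y f)).
Qed.

Lemma lie_xx (X : vfield C) : lie X X = 0.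
Proof. by apply: vfield_eqP => f; exact: subrr. Qed.

Lemma lie_jacobi (X Y Z : vfield C) :
  lie (lie X Y) Z = lie X (lie Y Z) - lie Y (lie X Z).
Proof.
apply: vfield_eqP => f.
rewrite -[LHS]/(X (Y (Z f)) - Y (X (Z f)) - Z (X (Y f) - Y (X f))).
rewrite -[RHS]/(X (Y (Z f) - Z (Y f)) - (Y (Z (X f)) - Z (Y (X f))) -
  (Y (X (Z f) - Z (X f)) - (X (Z (Y f)) - Z (X (Y f))))).
rewrite !vfieldD !vfieldN !opprD !opprK !addrA.
move: (X (Y (Z f))) (Y (X (Z f))) (Z (X (Y f))) (Z (Y (X f))) (X (Z (Y f))) (Y (Z (X f))).
move=> a b c d e g.
by rewrite [RHS](ACl (1*5*8*4*((2*7)*(3*6))))/= !addNr !addr0 ?opprD ?opprK ?addrA.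
Qed.

Lemma de_rham_lie_rinehart : lie_rinehart (de_rham C) (fun X f => X f).
Proof.
split=> //=.
- exact: lieDl.
- exact: lieL.
- exact: lie_xx.
- exact: lie_jacobi.
- move=> X a e f; rewrite -[LHS]/(X (a * e + f)) vfieldD vfieldM.
  by congr (_ + _); congr (_ + _); exact: mulrC.
- exact: vfield1.
Qed.

Lemma leafwise_lie_rinehart : lie_rinehart (leafwise F) (fun V f => V f).
Proof.
have D := de_rham_lie_rinehart.
split=> /=.
- by move=> x y z; apply: val_inj; exact: lieDl.
- by move=> x a y z; apply: val_inj; exact: lieL.
- by move=> x; apply: val_inj; exact: lie_xx.
- by move=> x y z; apply: val_inj; exact: lie_jacobi.
- by [].
- by move=> x; exact: (nablaL D).
- by [].
- by move=> x; exact: vfield1.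
Qed.

End LieRinehartInstances.

Section Snoc.
Variables (R : realType) (n : nat) (C : manifold R n) (F : foliation C).
Local Notation A := (Cinf C).
Local Notation TF := (sect F).
Local Notation NF := (normal_mod F).
Local Notation pN := (proj_N F).
Implicit Types (k : nat) (X Y : vfield C).

Lemma snoc_max k (V : 'I_k -> TF) X : snoc V X ord_max = X.
Proof. by rewrite /snoc unlift_none. Qed.

Lemma snoc_lift k (V : 'I_k -> TF) X i : snoc V X (lift ord_max i) = V i.
Proof. by rewrite /snoc liftK. Qed.

Lemma snoc_upd k (V : 'I_k -> TF) X Y : upd (snoc V X) ord_max Y = snoc V Y.
Proof.
apply/funext => i; rewrite /upd; case: (unliftP ord_max i) => [j|] ->.
  by rewrite !snoc_lift eq_sym (negPf (neq_lift _ _)).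
by rewrite eqxx !snoc_max.
Qed.

Lemma snoc_upd_lift k (V : 'I_k -> TF) X i (Y : TF) :
  upd (snoc V X) (lift ord_max i) (Y : vfield C) = snoc (upd V i Y) X.
Proof.
apply/funext => l; rewrite /upd; case: (unliftP ord_max l) => [j|] ->.
  by rewrite !snoc_lift (inj_eq lift_inj); case: ifP.
by rewrite !snoc_max (negPf (neq_lift _ _)).
Qed.

Lemma snoc_leaf k (V : 'I_k -> TF) (Y : TF) : exists W : 'I_k.+1 -> TF, snoc V Y = (fun i => W i).
Proof.
exists (fun i => if unlift ord_max i is Some j then V j else Y).
by apply/funext => i; rewrite /snoc; case: (unlift _ _).
Qed.

(** Contractions act on the first slot while the normal vector sits in the last one, so inductions
    on the leaf arguments leave it alone. *)
Lemma snoc_vcons k (Y : TF) (V : 'I_k -> TF) X :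
  snoc (vcons Y V) X = vcons (Y : vfield C) (snoc V X).
Proof.
apply/funext => i; case: (unliftP ord_max i) => [j|] ->.
  rewrite snoc_lift; case: (unliftP ord0 j) => [l|] ->.
    rewrite vconsS (_ : lift ord_max (lift ord0 l) = lift ord0 (lift ord_max l)).
      by rewrite vconsS snoc_lift.
    by apply: val_inj; rewrite /= /bump /= !add1n ltnS; lia.
  rewrite vcons0 (_ : lift ord_max ord0 = ord0) ?vcons0//.
  by apply: val_inj.
rewrite snoc_max (_ : ord_max = lift ord0 ord_max) ?vconsS ?snoc_max//.
by apply: val_inj.
Qed.

Definition leaf_vanishing k (eta : dform C k) := forall V : 'I_k -> TF, eta (fun i => V i) = 0.

Lemma snoc_linear k (eta : dform C k.+1) (V : 'I_k -> TF) a X Y : alternating_forms k.+1 eta ->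
  eta (snoc V (a *: X + Y)) = a * eta (snoc V X) + eta (snoc V Y).
Proof. by move=> [lin _]; have := lin ord_max (snoc V 0) a X Y; rewrite !snoc_upd. Qed.

(** Fields with the same normal class differ by a leaf field, which contributes nothing next to leaf
    arguments; so the functional descends to NF and the choice has a solution. *)
Lemma normal_partE k (eta : dform C k.+1) (V : 'I_k -> TF) X :
  alternating_forms k.+1 eta -> leaf_vanishing eta ->
  normal_part eta V (pN X) = eta (snoc V X).
Proof.
move=> He eta0; rewrite /normal_part; case: xgetP => [b _ -> //|nex]; exfalso.
have E Y Z : pN Y = pN Z -> eta (snoc V Y) = eta (snoc V Z).
  move=> /proj_N_eq FYZ; have := snoc_linear V 1 (MkSect FYZ) Z He.
  rewrite scale1r /= subrK mul1r => ->.
  by have [W ->] := snoc_leaf V (MkSect FYZ); rewrite eta0 add0r.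
have lin : (fun N : NF => eta (snoc V (repr_N N))) \in @linear_form A NF.
  apply/asboolP => a N N'; rewrite -snoc_linear//; apply: E.
  by rewrite proj_NL !proj_NK.
by apply: (nex (MkDual lin)) => Y; apply: E; exact: proj_NK.
Qed.

Lemma normal_part_alternating k (eta : dform C k.+1) :
  alternating_forms k.+1 eta -> leaf_vanishing eta ->
  alternating_forms k (normal_part eta : cochain TF (dual_mod NF) k).
Proof.
move=> He eta0; have [lin alt] := He; split=> [i V a x y|V i j ij Vij]; apply: dual_NP => X.
  rewrite normal_partE// -!snoc_upd_lift.
  have := lin (lift ord_max i) (snoc V X) a x y => E.
  apply: etrans E _; rewrite !snoc_upd_lift -!normal_partE//.
rewrite normal_partE//; apply: (alt _ (lift ord_max i) (lift ord_max j)).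
  by rewrite (inj_eq lift_inj).
by rewrite !snoc_lift Vij.
Qed.

Lemma contr_normal_part k (V0 : TF) (eta : dform C k.+2) :
  alternating_forms k.+2 eta -> leaf_vanishing eta ->
  leaf_vanishing (contr (V0 : vfield C) eta) /\
  contr V0 (normal_part eta : cochain TF (dual_mod NF) k.+1) =
  normal_part (contr (V0 : vfield C) eta).
Proof.
move=> He eta0; have v0 : leaf_vanishing (contr (V0 : vfield C) eta).
  move=> V; rewrite /contr -[RHS](eta0 (vcons V0 V)); congr eta.
  by apply/funext => i; rewrite /vcons; case: unlift.
split=> //; apply/funext => V; apply: dual_NP => X.
rewrite [RHS]normal_partE//; last exact: contr_alternating.
by rewrite /contr normal_partE// snoc_vcons.
Qed.

(** Brackets of leaf fields are again leaf fields, so on leaf arguments the two Koszul formulas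
    agree term by term. *)
Lemma ext_d_restricts k (a' : dform C k) (a : cochain TF A^o k) :
  restricts_to a' a -> restricts_to (ext_d a') (koszul (leafwise F) a).
Proof.
move=> ra V; rewrite /ext_d /koszul; congr (_ + _).
  by apply: eq_bigr => i _; congr (_ *: (V i) _); exact: ra.
apply: eq_bigr => i _; apply: eq_bigr => j _; congr (_ *: _).
rewrite -[RHS]ra; congr a'; apply/funext => l; rewrite /insert_remove2.
by case: ifP.
Qed.

Lemma leaf_vanishing_d k (eta : dform C k) : leaf_vanishing eta -> leaf_vanishing (ext_d eta).
Proof.
move=> eta0 V; have := @ext_d_restricts k eta 0 eta0 V.
move=> ->; rewrite (koszul0 (nablaD (leafwise_lie_rinehart F))).
by [].
Qed.

Lemma dual_sumE (I : Type) (s : seq I) (b : I -> dual_mod NF) N :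
  (\sum_(i <- s) b i) N = \sum_(i <- s) b i N.
Proof. exact: (big_morph (fun b : dual_mod NF => b N)). Qed.

(** The bracket inserted in the last slot on the right is exactly the Bott term of the dual
    connection on the left. *)
Lemma lieder_normal_part k (V0 : TF) (eta : dform C k.+1) (V : 'I_k -> TF) X :
  alternating_forms k.+1 eta -> leaf_vanishing eta ->
  lieder (dual_bott F) V0 (normal_part eta) V (pN X) =
  lieder (de_rham C) (V0 : vfield C) eta (snoc V X).
Proof.
move=> He eta0; rewrite /lieder.
rewrite -[LHS]/((V0 (normal_part eta V (pN X)) - normal_part eta V (bott_nabla V0 (pN X))) -
  (\sum_(j < k) normal_part eta (upd V j (lieF V0 (V j)))) (pN X)).
rewrite bott_nablaE !normal_partE// dual_sumE big_ord_recr /= snoc_max snoc_upd.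
rewrite opprD [in RHS]addrA [RHS]addrAC; congr (_ - _).
apply: eq_bigr => j _; rewrite normal_partE//.
have -> : widen_ord (leqnSn k) j = lift ord_max j by apply: val_inj; exact: (esym (lift_max j)).
by rewrite snoc_lift -snoc_upd_lift.
Qed.

(* Cartan's formula holds in both complexes, so the claim reduces by induction to
   the compatibility of the two Lie derivatives. *)
Lemma koszul_normal_part k (eta : dform C k.+1) :
  alternating_forms k.+1 eta -> leaf_vanishing eta ->
  koszul (dual_bott F) (normal_part eta) = normal_part (ext_d eta).
Proof.
elim: k eta => [|k IH] eta He eta0; have dalt := koszul_alternating (de_rham_lie_rinehart C) He;
  have dv := leaf_vanishing_d eta0; apply/funext => V; apply: dual_NP => X;
  rewrite [RHS]normal_partE// -(vcons_eta V) snoc_vcons; set V0 := V ord0; set V' := vtail V.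
  rewrite koszul_cons1 [RHS]koszul_cons//.
  (* In degree 1 this contraction is the function eta(V0), zero because V0 is a leaf field. *)
  have -> : contr (V0 : vfield C) eta = 0.
    apply/funext => W; rewrite -[RHS](eta0 (vcons V0 V')) /contr; congr eta.
    apply/funext => i; rewrite /vcons; case: unlift => // -[].
    by [].
  rewrite (koszul0 (nablaD (de_rham_lie_rinehart C))) -[RHS]/(lieder _ _ _ _ - 0) subr0.
  rewrite -(lieder_normal_part V0 V' X He eta0).
  by rewrite /lieder big_ord0 subr0.
have [cv cE] := contr_normal_part V0 He eta0.
have ca := contr_alternating (V0 : vfield C) He.
rewrite koszul_cons; last exact: normal_part_alternating.
rewrite [RHS]koszul_cons// -(lieder_normal_part V0 V' X He eta0).
rewrite cE IH// -[LHS]/(lieder (dual_bott F) V0 (normal_part eta) V' (pN X) -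
  normal_part (ext_d (contr (V0 : vfield C) eta)) V' (pN X)).
have ka := koszul_alternating (de_rham_lie_rinehart C) ca.
by rewrite (normal_partE V' X ka (leaf_vanishing_d cv)).
Qed.

End Snoc.

(** * Transverse differentiation *)

Section CohomologyClasses.
Variables (A : comPzRingType) (L E : lmodType A) (D : connection L E).
Hypothesis nbD : forall x e f, nabla D x (e + f) = nabla D x e + nabla D x f.

Lemma exact_formsD k (eta theta : cochain L E k) :
  exact_forms D eta -> exact_forms D theta -> exact_forms D (eta + theta).
Proof.
case: k eta theta => [|k] eta theta /=; first by move=> -> ->; rewrite addr0.
move=> [s As <-] [t At <-]; exists (s + t); first exact: alternating_formsD.
exact: koszulD.
Qed.

Lemma exact_formsN k (eta : cochain L E k) : exact_forms D eta -> exact_forms D (- eta).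
Proof.
case: k eta => [|k] eta /=; first by move=> ->; rewrite oppr0.
move=> [s As <-]; exists (- s); first exact: alternating_formsN.
exact: koszulN.
Qed.

Lemma alternating_zero k : alternating_forms k (0 : cochain L E k).
Proof. by split=> [i V a x y|//]; rewrite -![(0 : cochain L E k) _]/(0 : E) scaler0 addr0. Qed.

Lemma exact_forms0 k : exact_forms D (0 : cochain L E k).
Proof.
case: k => [|k] //=; exists 0; first exact: alternating_zero.
exact: koszul0.
Qed.

Lemma coh_class_refl k (eta : cochain L E k) : alternating_forms k eta -> coh_class D eta eta.
Proof. by move=> He; split=> //; rewrite subrr; exact: exact_forms0. Qed.

Lemma coh_class_eq k (eta theta : cochain L E k) :
  exact_forms D (eta - theta) -> coh_class D eta = coh_class D theta.
Proof.
move=> ex; apply/seteqP; split=> z [Az ez]; split=> //.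
  have -> : z - theta = (z - eta) + (eta - theta) by rewrite addrA subrK.
  exact: exact_formsD.
have -> : z - eta = (z - theta) - (eta - theta) by rewrite opprB addrA subrK.
by apply: exact_formsD => //; exact: exact_formsN.
Qed.

Lemma alternating_zero_arg k (eta : cochain L E k) V i :
  alternating_forms k eta -> V i = 0 -> eta V = 0.
Proof.
move=> [lin _] Vi; have := lin i V (-1) 0 0.
have -> : upd V i 0 = V by apply/funext => j; rewrite /upd; case: eqP => // ->.
by rewrite scaler0 addr0 (_ : upd V i 0 = V) ?scaleN1r ?addNr//;
   apply/funext => j; rewrite /upd; case: eqP => // ->.
Qed.

End CohomologyClasses.

(** [coh_map] is a union of classes; it collapses to one as soon as all images of representatives
    are cohomologous to a fixed cochain. *)
Lemma coh_map_class (A : comPzRingType) (L E E' : lmodType A)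
    (D' : connection L E') k (f : cochain L E k -> cochain L E' k) (S : set (cochain L E k))
    (eta : cochain L E' k) :
  (forall x e e', nabla D' x (e + e') = nabla D' x e + nabla D' x e') ->
  S !=set0 -> (forall theta, S theta -> exact_forms D' (f theta - eta)) ->
  coh_map D' f S = coh_class D' eta.
Proof.
move=> nbD [t St] H; apply/seteqP; split=> [z [s Ss]|z Hz].
  by rewrite (coh_class_eq nbD (H s Ss)).
by exists t => //; rewrite (coh_class_eq nbD (H t St)).
Qed.

Lemma exact_forms_map (A : comPzRingType) (L E E' : lmodType A)
    (D : connection L E) (D' : connection L E') (f : E -> E') k (eta : cochain L E k) :
  bracket D = bracket D' ->
  (forall a e e', f (a *: e + e') = a *: f e + f e') ->
  (forall x e, f (nabla D x e) = nabla D' x (f e)) ->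
  exact_forms D eta -> exact_forms D' (fun V => f (eta V)).
Proof.
move=> br fL fn; case: k eta => [|k] eta /=.
  move=> ->; apply/funext => V; have := fL (-1) 0 0.
  by rewrite !scaleN1r oppr0 addr0 addNr.
move=> [t At <-]; exists (fun V => f (t V)); first exact: alternating_map.
by rewrite (koszul_map br fL fn).
Qed.

Section Transverse.
Variables (R : realType) (n : nat) (C : manifold R n) (F : foliation C).
Variable wC : dform C 2.
Hypotheses (w_alt : alternating_forms 2 wC) (dw0 : ext_d wC = 0).
Hypothesis hF : is_characteristic F wC.
Local Notation A := (Cinf C).
Local Notation om := (form2 wC).
Local Notation TF := (sect F).
Local Notation NF := (normal_mod F).
Local Notation pN := (proj_N F).
Local Notation dF := (koszul (leafwise F)).
Local Notation np := (@normal_part _ _ _ F _).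

Let nbR := nablaD (de_rham_lie_rinehart C).
Let nbF := nablaD (leafwise_lie_rinehart F).

Lemma normal_partB k (eta theta : dform C k.+1) :
  alternating_forms k.+1 eta -> leaf_vanishing F eta ->
  alternating_forms k.+1 theta -> leaf_vanishing F theta ->
  np (eta - theta) = np eta - np theta.
Proof.
move=> He e0 Ht t0; apply/funext => V; apply: dual_NP => X.
have Hs : alternating_forms k.+1 (eta - theta).
  by apply: alternating_formsD => //; exact: alternating_formsN.
have s0 : leaf_vanishing F (eta - theta).
  by move=> W; rewrite -[LHS]/(eta _ - theta _) e0 t0 subr0.
rewrite normal_partE//.
by rewrite -[RHS]/(np eta V (pN X) - np theta V (pN X)) !normal_partE.
Qed.

Lemma dual_bott_nablaD x (e f : dual_mod NF) :
  nabla (dual_bott F) x (e + f) = nabla (dual_bott F) x e + nabla (dual_bott F) x f.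
Proof.
apply: dual_NP => X.
rewrite -[LHS]/(x (e (pN X) + f (pN X)) - (e (bott_nabla x (pN X)) + f (bott_nabla x (pN X)))).
by rewrite vfieldD opprD addrACA.
Qed.

(* Two extensions of the same leafwise form differ by a form vanishing on the
   leaves, whose differential has exact normal part. *)
Lemma normal_part_extension k (a : cochain TF A^o k) (a1 a2 : dform C k) :
  dF a = 0 -> alternating_forms k a1 -> alternating_forms k a2 ->
  restricts_to a1 a -> restricts_to a2 a ->
  exact_forms (dual_bott F) (np (ext_d a1) - np (ext_d a2)).
Proof.
move=> da0 H1 H2 r1 r2.
have dv b : restricts_to b a -> leaf_vanishing F (ext_d b).
  by move=> rb V; rewrite (ext_d_restricts rb) da0.
have da b Hb := @koszul_alternating _ _ _ _ _ (de_rham_lie_rinehart C) k b Hb.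
rewrite -normal_partB//; [|exact: da|exact: dv|exact: da|exact: dv].
have -> : ext_d a1 - ext_d a2 = ext_d (a1 - a2).
  by rewrite /ext_d (koszulD nbR) (koszulN nbR).
have v : leaf_vanishing F (a1 - a2).
  by move=> V; rewrite -[LHS]/(a1 _ - a2 _) r1 r2 subrr.
have H : alternating_forms k (a1 - a2).
  by apply: alternating_formsD => //; exact: alternating_formsN.
(* In degree 0 the two extensions coincide, there being no arguments to restrict; in positive degree
   p(a1 - a2) is a primitive. *)
case: k a a1 a2 H v {da0 H1 H2 r1 r2 dv da} => [|k] a a1 a2 H v.
  have -> : a1 - a2 = 0.
    have V0 : 'I_0 -> TF by case.
    by apply/funext => V; rewrite (forms0E _ _ (fun i => V0 i : vfield C)) v.
  rewrite /ext_d (koszul0 nbR) -(subrr (0 : dform C 1)) normal_partB ?subrr//;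
    exact: alternating_zero.
rewrite -koszul_normal_part//; exists (np (a1 - a2)) => //.
exact: normal_part_alternating.
Qed.

Section Complement.
Variable G : subbundle C.
Hypothesis hFG : complementary F G.
Local Notation GG := (sect G).

(** For a not closed, d(j a) does not vanish on the leaves and has no normal part. The correction
    removes its leafwise part and is invisible to [Phi], since extension by zero kills any entry
    from G. *)
Definition mixed_part k (a : cochain TF A^o k) : dform C k.+1 :=
  ext_d (ext0 G a) - ext0 G (dF a).

Lemma mixed_part_alternating k (a : cochain TF A^o k) : alternating_forms k a ->
  alternating_forms k.+1 (mixed_part a).
Proof.
move=> Ha; apply: alternating_formsD.
  exact: (koszul_alternating (de_rham_lie_rinehart C) (ext0_alternating hFG Ha)).
apply: alternating_formsN; apply: (ext0_alternating hFG).
exact: (koszul_alternating (leafwise_lie_rinehart F) Ha).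
Qed.

Lemma mixed_part_vanishing k (a : cochain TF A^o k) : leaf_vanishing F (mixed_part a).
Proof.
move=> V; rewrite -[LHS]/(ext_d (ext0 G a) _ - ext0 G (dF a) _).
rewrite (ext_d_restricts (ext0_restricts hFG a)) (ext0_restricts hFG (dF a)).
exact: subrr.
Qed.

Lemma mixed_part_snoc k (a : cochain TF A^o k) (V : 'I_k -> TF) (Z : GG) :
  alternating_forms k a -> mixed_part a (snoc V Z) = ext_d (ext0 G a) (snoc V Z).
Proof.
move=> Ha; rewrite -[LHS]/(ext_d (ext0 G a) _ - ext0 G (dF a) _).
rewrite [X in _ - X](_ : _ = 0) ?subr0// /ext0.
have Hd := koszul_alternating (leafwise_lie_rinehart F) Ha.
apply: (@alternating_zero_arg _ _ _ _ _ _ ord_max Hd).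
by rewrite snoc_max; exact: (pr_compl hFG Z).1.
Qed.

Lemma sharp_GE (b : dual_mod GG) (Z : GG) : om (sharp_G wC b) Z = b Z.
Proof.
rewrite /sharp_G; case: xgetP => [Y _ <- //|nex]; exfalso.
have [Y HY] := sharp_G_exists w_alt hF hFG b.
by apply: (nex Y); apply/funext => Z'; exact: HY.
Qed.

(** With c the normal part at V, b(Y) = c(sharp b) = omega_C(sharp c, sharp b) = - omega_C(sharp b,
    sharp c) = - b(sharp c): skew symmetry is the source of the sign. *)
Lemma PhiE k (a : cochain TF A^o k) : alternating_forms k a ->
  Phi wC G a = fun V => neg_sharp G wC (np (mixed_part a) V).
Proof.
move=> Ha; apply/funext => V; set c := np _ V; set Y := neg_sharp _ _ c.
have HY (b : dual_mod GG) : b Y = ext_d (ext0 G a) (snoc V (sharp_G wC b)).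
  rewrite -mixed_part_snoc// -normal_partE; last first.
  - exact: mixed_part_vanishing.
  - exact: mixed_part_alternating.
  rewrite -/c -(sharp_NE w_alt hF hFG) -sharp_GE.
  have -> : sharp_N wC c = pN (- 1 *: (Y : vfield C) + 0).
    by rewrite proj_NL proj_N0 addr0 scaleN1r (proj_neg_sharp wC hFG) opprK.
  by rewrite (flat_NE w_alt hF) (form2L w_alt) (form20 w_alt) addr0 mulN1r -form2C.
rewrite /Phi; case: xgetP => [Y' _ HY'|/(_ Y)[]//].
apply: (proj_N_injG hFG); apply: (flat_N_inj w_alt hF) => X; rewrite !(flat_NE w_alt hF).
rewrite !(form2_pr w_alt hF hFG X).
rewrite (form2C w_alt Y') (form2C w_alt Y); congr (- _).
(* The functionals omega_C(Z, .) with Z in G already separate sections of G, so the choice in [Phi]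
   is unique. *)
pose b := MkDual (form2_dual w_alt (pr_G F G X)).
by rewrite -[LHS]/(b Y') -[RHS]/(b Y) HY' HY.
Qed.

Lemma Phi_alternating k (a : cochain TF A^o k) :
  alternating_forms k a -> alternating_forms k (Phi wC G a).
Proof.
move=> Ha; rewrite PhiE//; apply: alternating_map; first exact: neg_sharpL.
by apply: normal_part_alternating; [exact: mixed_part_alternating | exact: mixed_part_vanishing].
Qed.

Lemma neg_sharpB (b c : dual_mod NF) : neg_sharp G wC (b - c) = neg_sharp G wC b - neg_sharp G wC c.
Proof. by rewrite addrC -scaleN1r neg_sharpL// scaleN1r addrC. Qed.

Lemma PhiB k (a b : cochain TF A^o k) : alternating_forms k a -> alternating_forms k b ->
  Phi wC G (a - b) = Phi wC G a - Phi wC G b.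
Proof.
move=> Ha Hb.
have Hab : alternating_forms k (a - b).
  by apply: alternating_formsD => //; exact: alternating_formsN.
rewrite !PhiE//.
have -> : mixed_part (a - b) = mixed_part a - mixed_part b.
  rewrite /mixed_part (_ : ext0 G (a - b) = ext0 G a - ext0 G b)//.
  rewrite /ext_d (koszulD nbR) (koszulN nbR) (koszulD nbF) (koszulN nbF).
  rewrite (_ : ext0 G (dF a - dF b) = ext0 G (dF a) - ext0 G (dF b))//.
  by rewrite opprB [RHS]addrC opprB addrACA [RHS]addrC; apply/funext => V;
     rewrite !fctE; ring.
rewrite normal_partB; [|exact: mixed_part_alternating|exact: mixed_part_vanishing
  |exact: mixed_part_alternating|exact: mixed_part_vanishing].
by apply/funext => V; exact: neg_sharpB.
Qed.

Lemma Phi_koszul k (a : cochain TF A^o k) : alternating_forms k a ->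
  Phi wC G (dF a) = - koszul (bott_G F G) (Phi wC G a).
Proof.
move=> Ha; have Hda := koszul_alternating (leafwise_lie_rinehart F) Ha.
have Hm := mixed_part_alternating Ha; have vm := @mixed_part_vanishing k a.
have He := ext0_alternating hFG Ha.
(* The leading 0 puts this in the form of a difference, ready for [normal_partB]. *)
have E : mixed_part (dF a) = 0 - ext_d (mixed_part a).
  rewrite {1}/mixed_part (koszul_koszul (leafwise_lie_rinehart F) Ha).
  have -> : ext0 G (dF a) = ext_d (ext0 G a) - mixed_part a by rewrite /mixed_part subKr.
  rewrite [in LHS]/ext_d (koszulD nbR) (koszulN nbR).
  rewrite (koszul_koszul (de_rham_lie_rinehart C) He).
  exact: subr0.
rewrite !PhiE// (koszul_map (D := dual_bott F)) //; last first.
- by move=> x e; exact: neg_sharp_nabla.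
- exact: neg_sharpL.
rewrite koszul_normal_part// E normal_partB.
- have -> : np (0 : dform C k.+2) = 0.
    by rewrite -[X in np X](subrr (0 : dform C k.+2)) normal_partB ?subrr//;
      exact: alternating_zero.
  apply/funext => V; rewrite -[LHS]/(neg_sharp G wC (0 - np _ V)) sub0r.
  by rewrite -scaleN1r -[_ *: _]addr0 neg_sharpL// -(subrr 0) neg_sharpB subrr addr0 scaleN1r.
- exact: alternating_zero.
- by [].
- exact: (koszul_alternating (de_rham_lie_rinehart C) Hm).
- exact: leaf_vanishing_d.
Qed.

End Complement.
End Transverse.

(** * The induced maps in cohomology *)

Section TransverseCohomology.
Variables (R : realType) (n : nat) (C : manifold R n) (F : foliation C).
Variable wC : dform C 2.
Hypotheses (w_alt : alternating_forms 2 wC) (dw0 : ext_d wC = 0).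
Hypothesis hF : is_characteristic F wC.
Variable G : subbundle C.
Hypothesis hFG : complementary F G.
Local Notation A := (Cinf C).
Local Notation TF := (sect F).
Local Notation NF := (normal_mod F).
Local Notation dF := (koszul (leafwise F)).

Let nbF := nablaD (leafwise_lie_rinehart F).
Let nbG := bott_G_nablaD hFG.

Let nbN x (e f : NF) : nabla (bott F) x (e + f) = nabla (bott F) x e + nabla (bott F) x f.
Proof. exact: (bott_nablaD x e f). Qed.

Lemma exact_leafwise_closed j (a : cochain TF A^o j) : exact_forms (leafwise F) a -> dF a = 0.
Proof.
case: j a => [|j] a /= => [->|[t At <-]]; first by rewrite (koszul0 nbF).
exact: (koszul_koszul (leafwise_lie_rinehart F) At).
Qed.

Lemma Phi0 j : Phi wC G (0 : cochain TF A^o j) = 0.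
Proof.
have H0 := @alternating_zero _ TF A^o j.
by rewrite -[X in Phi _ _ X](subrr 0) (PhiB w_alt hF hFG)// subrr.
Qed.

Lemma Phi_exact_forms j (b : cochain TF A^o j) :
  exact_forms (leafwise F) b -> exact_forms (bott_G F G) (Phi wC G b).
Proof.
case: j b => [|j] b /=; first by move=> ->; exact: Phi0.
move=> [t At <-]; exists (- Phi wC G t).
  by apply: alternating_formsN; exact: Phi_alternating.
by rewrite (koszulN nbG) -(Phi_koszul w_alt dw0 hF hFG).
Qed.

Variables (k : nat) (a0 : cochain TF A^o k).
Hypotheses (Ha0 : alternating_forms k a0) (da0 : dF a0 = 0).
Local Notation c := (coh_class (leafwise F) a0).

Lemma coh_class_closed a : c a -> alternating_forms k a /\ dF a = 0.
Proof.
move=> [Ha ex]; split=> //.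
by rewrite -(subrK a0 a) (koszulD nbF) da0 addr0 exact_leafwise_closed.
Qed.

Lemma Phi_exact a : c a -> exact_forms (bott_G F G) (Phi wC G a - Phi wC G a0).
Proof. by move=> [Ha ex]; rewrite -(PhiB w_alt hF hFG)//; exact: Phi_exact_forms. Qed.

Lemma Phi_coh_class : Phi_coh wC G c = coh_class (bott_G F G) (Phi wC G a0).
Proof.
apply: coh_map_class => //; last exact: Phi_exact.
by exists a0; exact: (coh_class_refl nbF).
Qed.

Lemma Phi_coh_cohomology : cohomology (bott_G F G) k (Phi_coh wC G c).
Proof.
exists (Phi wC G a0); last by rewrite Phi_coh_class.
split; first exact: Phi_alternating.
apply/eqP; rewrite -oppr_eq0 -(Phi_koszul w_alt dw0 hF hFG)// da0.
by rewrite Phi0.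
Qed.

Lemma G_to_N_exact (eta theta : cochain TF (sect G) k) :
  exact_forms (bott_G F G) (eta - theta) ->
  exact_forms (bott F) (@G_to_N _ _ _ F G k eta - G_to_N theta).
Proof.
move=> ex.
have L (a : A) (Y Z : sect G) : proj_N F (a *: Y + Z : sect G) = a *: proj_N F Y + proj_N F Z.
  exact: (proj_NL F a (Y : vfield C) Z).
have -> : @G_to_N _ _ _ F G k eta - G_to_N theta = fun V => proj_N F ((eta - theta) V).
  apply/funext => V.
  have -> : (eta - theta) V = - 1 *: theta V + eta V by rewrite scaleN1r addrC.
  by rewrite L scaleN1r addrC.
apply: (exact_forms_map _ L _ ex) => //.
exact: (proj_bott_G hFG).
Qed.

Lemma Phi_coh_N_class : Phi_coh_N wC G c = coh_class (bott F) (G_to_N (Phi wC G a0)).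
Proof.
rewrite /Phi_coh_N Phi_coh_class; apply: coh_map_class.
- exact: nbN.
- by exists (Phi wC G a0); apply: (coh_class_refl nbG); exact: Phi_alternating.
- by move=> theta [_ ex]; exact: G_to_N_exact.
Qed.

(** Every element of [d_nu c] is cohomologous to p(d(j a)) for some representative a, by comparing
    an arbitrary extension with extension by zero. The parallel map -(omega_C^flat)^-1 sends this to
    [Phi] of a, and a may then be replaced by [a0]. *)
Lemma d_nu_class : coh_map (bott F) (fun theta => minus_id_sharp wC theta) (d_nu c) =
  coh_class (bott F) (G_to_N (Phi wC G a0)).
Proof.
have nbD := @dual_bott_nablaD _ _ _ F.
apply: coh_map_class.
- exact: nbN.
- have H := ext0_alternating hFG Ha0.
  exists (normal_part (ext_d (ext0 G a0))), a0, (ext0 G a0); split=> //.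
  + exact: (coh_class_refl nbF).
  + exact: ext0_restricts.
  + apply: (coh_class_refl nbD); apply: normal_part_alternating.
      exact: (koszul_alternating (de_rham_lie_rinehart C) H).
    by move=> V; rewrite (ext_d_restricts (ext0_restricts hFG a0)) da0.
move=> theta [a [a' [ca Ha' ra' [Htheta ex]]]].
have [Ha da] := coh_class_closed ca.
have ex2 := normal_part_extension da Ha' (ext0_alternating hFG Ha) ra' (ext0_restricts hFG a).
have {ex ex2} ex := exact_formsD nbD ex ex2; rewrite addrA subrK in ex.
pose f (b : dual_mod NF) : NF := - sharp_N wC b.
have fL (x : A) b b' : f (x *: b + b') = x *: f b + f b'.
  by rewrite /f (sharp_NL w_alt hF hFG) opprD scalerN.
have fn V b : f (nabla (dual_bott F) V b) = nabla (bott F) V (f b).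
  by rewrite /f (sharp_N_nabla w_alt dw0 hF hFG); exact: (esym (bott_nablaN _ _)).
have := @exact_forms_map _ _ _ _ (dual_bott F) (bott F) f _ _ (erefl _) fL fn ex.
move=> /(exact_formsD nbN) /(_ (G_to_N_exact (Phi_exact ca))).
rewrite (PhiE w_alt hF hFG Ha).
congr (exact_forms _ _); rewrite addrA; congr (_ - _).
apply/funext => V; rewrite -[LHS]/(f (theta V - _ V) + proj_N F (neg_sharp G wC _)).
rewrite (proj_neg_sharp wC hFG) -/(f _).
(* For closed a the correction term is the extension of 0. *)
have -> : mixed_part G a = ext_d (ext0 G a).
  by rewrite /mixed_part da; exact: subr0.
have := fL 1 (theta V - normal_part (ext_d (ext0 G a)) V) (normal_part (ext_d (ext0 G a)) V).
by rewrite !scale1r subrK => <-.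
Qed.

End TransverseCohomology.

Theorem proposition2p10 (R : realType) (m n : nat)
    (M : manifold R m) (w : dform M 2) (hw : symplectic w)
    (C : manifold R n) (iota : submanifold M C) (hC : coisotropic iota w)
    (wC : dform C 2) (hwC : is_pullback iota w wC)
    (F : foliation C) (hF : is_characteristic F wC)
    (G : subbundle C) (hG : complementary F G) :
  (forall (k : nat) (a : cochain (sect F) (Cinf C)^o k),
     alternating_forms k a ->
     alternating_forms k (Phi wC G a) /\
     Phi wC G (koszul (leafwise F) a) = - koszul (bott_G F G) (Phi wC G a)) /\
  (forall (k : nat) (c : set (cochain (sect F) (Cinf C)^o k)),
     cohomology (leafwise F) k c ->
     [/\ cohomology (bott_G F G) k (Phi_coh wC G c),
         Phi_coh_N wC G c = coh_map (bott F) (fun theta => minus_id_sharp wC theta) (d_nu c)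
       & forall G' : subbundle C, complementary F G' ->
           Phi_coh_N wC G' c = Phi_coh_N wC G c]).
Proof.
have [w_alt dw0 _] := hw.
have wC_alt := hwC.1; have dwC0 := pullback_closed w_alt dw0 hwC.
split=> [k a Ha|k _ [a [Ha da] <-]].
  by split; [exact: Phi_alternating | exact: Phi_koszul].
(* The right-hand side does not mention [G'], so using this for two complements gives the
   independence. *)
have E G' (hG' : complementary F G') :
    Phi_coh_N wC G' (coh_class (leafwise F) a) =
    coh_map (bott F) (fun theta => minus_id_sharp wC theta) (d_nu (coh_class (leafwise F) a)).
  by rewrite (Phi_coh_N_class wC_alt dwC0 hF hG')// (d_nu_class wC_alt dwC0 hF hG').
split; [exact: Phi_coh_cohomology | exact: E |].
by move=> G' hG'; rewrite !E.
Qed.
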